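(* Let $n \ge 2$ and $1 \le r < n$ be integers and let $T_{n,r}$ be the Higman--Thompson group generalising Thompson's group $T$. Then $\mathrm{Aut}(\mathrm{Aut}(T_{n,r})) = \mathrm{Aut}(T_{n,r})$; that is, the canonical homomorphism $\mathrm{Aut}(T_{n,r}) \to \mathrm{Aut}(\mathrm{Aut}(T_{n,r}))$ sending each element to the inner automorphism (conjugation) it induces is an isomorphism.
   Context: Functions are written to the right of their arguments. Let $X_n = \{0,1,\ldots,n-1\}$, $\mathfrak{C}_n = X_n^{\omega}$, $\dot{\mathbf r} = \{\dot 1,\ldots,\dot r\}$. Let $X_{n,r}^+$ be the set of finite words $\dot a w$ with $\dot a \in \dot{\mathbf r}$ and $w$ a finite (possibly empty) word over $X_n$, and let $\mathfrak{C}_{n,r} = \dot{\mathbf r} \times X_n^{\omega}$ be the Cantor space of infinite words consisting of a letter of $\dot{\mathbf r}$ followed by an element of $X_n^{\omega}$. A finite subset of $X_{n,r}^+$ is a complete antichain if every element of $\mathfrak{C}_{n,r}$ has exactly one of its elements as a prefix; antichains are listed in lexicographic order. $T_{n,r}$ is the group of homeomorphisms $g$ of $\mathfrak{C}_{n,r}$ for which there are lexicographically ordered finite complete antichains $\{u_0,\ldots,u_l\}$ and $\{v_0,\ldots,v_l\}$ in $X_{n,r}^+$ and $b \in \{0,\ldots,l\}$ such that $(u_a\rho)g = v_{(a+b) \bmod (l+1)}\,\rho$ for all $0 \le a \le l$ and $\rho \in \mathfrak{C}_n$. *)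

(* Defs.v *)
From HB Require Import structures.
From mathcomp Require Import all_boot all_order.
From mathcomp Require Import boolp classical_sets topology.

Set Implicit Arguments.
Unset Strict Implicit.
Unset Printing Implicit Defensive.

Import Order.TTheory.

Local Open Scope group_scope.

(* Maps act on the right throughout: [f * g] is "first f, then g", both for    *)
(* homeomorphisms and for automorphisms, so that [x ^ y = y^-1 * (x * y)]      *)
(* is a right action of a group on itself.                                     *)

Section Automorphisms.

Record aut (G : groupType) := Aut {
  aut_fun :> G -> G;
  aut_inv : G -> G;
  aut_morph : {morph aut_fun : x y / x * y};
  aut_funK : cancel aut_fun aut_inv;
  aut_invK : cancel aut_inv aut_fun
}.

HB.instance Definition _ G := gen_eqMixin (aut G).
HB.instance Definition _ G := gen_choiceMixin (aut G).

Variable G : groupType.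
Implicit Types f g : aut G.

HB.instance Definition _ f := isMultiplicative.Build G G f (@aut_morph G f).

Lemma aut_ext f g : f =1 g -> f = g.
Proof.
case: f g => f f' fM fK f'K [g g' gM gK g'K] /= /funext efg; subst g.
have ef'g' : f' = g' by apply/funext => x; rewrite -{1}(g'K x) fK.
by subst g'; congr Aut; apply: Prop_irrelevance.
Qed.

Definition aut_one : aut G :=
  @Aut G idfun idfun (fun _ _ => erefl) (frefl _) (frefl _).

Fact aut_inv_morph f : {morph aut_inv f : x y / x * y}.
Proof.
move=> x y; apply: (can_inj (@aut_funK G f)).
by rewrite aut_morph !aut_invK.
Qed.

Definition aut_V f : aut G :=
  Aut (@aut_inv_morph f) (@aut_invK G f) (@aut_funK G f).

Fact aut_mul_morph f g : {morph g \o f : x y / x * y}.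
Proof. by move=> x y /=; rewrite !aut_morph. Qed.

Definition aut_mul f g : aut G :=
  Aut (@aut_mul_morph f g)
    (can_comp (@aut_funK G g) (@aut_funK G f))
    (can_comp (@aut_invK G f) (@aut_invK G g)).

Fact aut_mulA : associative aut_mul.
Proof. by move=> f g h; apply: aut_ext. Qed.

Fact aut_mul1 : left_id aut_one aut_mul.
Proof. by move=> f; apply: aut_ext. Qed.

Fact aut_1mul : right_id aut_one aut_mul.
Proof. by move=> f; apply: aut_ext. Qed.

Fact aut_mulV : left_inverse aut_one aut_V aut_mul.
Proof. by move=> f; apply: aut_ext => x /=; rewrite aut_invK. Qed.

Fact aut_Vmul : right_inverse aut_one aut_V aut_mul.
Proof. by move=> f; apply: aut_ext => x /=; rewrite aut_funK. Qed.

HB.instance Definition _ :=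
  isGroup.Build (aut G) aut_mulA aut_mul1 aut_1mul aut_mulV aut_Vmul.

Definition inner (y : G) : aut G :=
  @Aut G (conjg^~ y) (conjg^~ y^-1) (fun u v => conjMg u v y)
    (conjgK y) (conjgKV y).

Definition group_isomorphism (H : groupType) (f : G -> H) : Prop :=
  {morph f : x y / x * y} /\ bijective f.

End Automorphisms.

Section Homeomorphisms.

Record homeo (X : topologicalType) := Homeo {
  homeo_fun :> X -> X;
  homeo_inv : X -> X;
  homeo_funK : cancel homeo_fun homeo_inv;
  homeo_invK : cancel homeo_inv homeo_fun;
  homeo_cont : continuous homeo_fun;
  homeo_inv_cont : continuous homeo_inv
}.

HB.instance Definition _ X := gen_eqMixin (homeo X).
HB.instance Definition _ X := gen_choiceMixin (homeo X).

Variable X : topologicalType.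
Implicit Types f g : homeo X.

Lemma homeo_ext f g : f =1 g -> f = g.
Proof.
case: f g => f f' fK f'K fc f'c [g g' gK g'K gc g'c] /= /funext efg; subst g.
have ef'g' : f' = g' by apply/funext => x; rewrite -{1}(g'K x) fK.
by subst g'; congr Homeo; apply: Prop_irrelevance.
Qed.

Fact homeo_id_cont : continuous (@idfun X).
Proof. by move=> x; apply: cvg_id. Qed.

Definition homeo_one : homeo X :=
  @Homeo X idfun idfun (frefl _) (frefl _) homeo_id_cont homeo_id_cont.

Definition homeo_V f : homeo X :=
  Homeo (@homeo_invK X f) (@homeo_funK X f)
    (@homeo_inv_cont X f) (@homeo_cont X f).

Fact homeo_mul_cont (f g : X -> X) :
  continuous f -> continuous g -> continuous (g \o f).
Proof. by move=> fc gc x; apply: continuous_comp; [apply: fc|apply: gc]. Qed.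

Definition homeo_mul f g : homeo X :=
  Homeo (can_comp (@homeo_funK X g) (@homeo_funK X f))
    (can_comp (@homeo_invK X f) (@homeo_invK X g))
    (homeo_mul_cont (@homeo_cont X f) (@homeo_cont X g))
    (homeo_mul_cont (@homeo_inv_cont X g) (@homeo_inv_cont X f)).

Fact homeo_mulA : associative homeo_mul.
Proof. by move=> f g h; apply: homeo_ext. Qed.

Fact homeo_mul1 : left_id homeo_one homeo_mul.
Proof. by move=> f; apply: homeo_ext. Qed.

Fact homeo_1mul : right_id homeo_one homeo_mul.
Proof. by move=> f; apply: homeo_ext. Qed.

Fact homeo_mulV : left_inverse homeo_one homeo_V homeo_mul.
Proof. by move=> f; apply: homeo_ext => x /=; rewrite homeo_invK. Qed.

Fact homeo_Vmul : right_inverse homeo_one homeo_V homeo_mul.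
Proof. by move=> f; apply: homeo_ext => x /=; rewrite homeo_funK. Qed.

HB.instance Definition _ := isGroup.Build (homeo X)
  homeo_mulA homeo_mul1 homeo_1mul homeo_mulV homeo_Vmul.

End Homeomorphisms.

(* The letters of the two alphabets are the ordinals below n and below r; the  *)
(* dotted letter is always the first component. Words carry the lexicographic  *)
(* order in which a proper prefix precedes its extensions.                     *)

Notation word n r := ('I_r *l seqlexi 'I_n)%type.

Notation cantor_seq n := (prod_topology (fun _ : nat => discrete_topology 'I_n)).

Notation cantor n r := (discrete_topology 'I_r * cantor_seq n)%type.

Section Words.

Variables n r : nat.

Definition scons (c : 'I_n) (rho : cantor_seq n) : cantor_seq n :=
  fun i => if i is j.+1 then rho j else c.

Definition prepend (s : seq 'I_n) (rho : cantor_seq n) : cantor_seq n :=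
  foldr scons rho s.

Definition wcat (u : word n r) (rho : cantor_seq n) : cantor n r :=
  (u.1, prepend u.2 rho).

Definition wprefix (u : word n r) (x : cantor n r) : Prop :=
  exists rho, x = wcat u rho.

Definition complete_antichain (A : seq (word n r)) : Prop :=
  forall x : cantor n r, exists! u, u \in A /\ wprefix u x.

Definition is_HigmanThompsonT (g : homeo (cantor n r)) : Prop :=
  exists l (u v : l.+1.-tuple (word n r)) (b : 'I_l.+1),
    [/\ sorted <%O u /\ complete_antichain u,
        sorted <%O v /\ complete_antichain v &
        forall (a : 'I_l.+1) (rho : cantor_seq n),
          g (wcat (tnth u a) rho) =
          wcat (tnth v (inord ((a + b) %% l.+1))) rho].

End Words.

(* Closure of T under composition: two expansions have a common refinement. *)

Section Closure.

Variables n r : nat.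
Hypotheses (n_gt1 : 1 < n) (r_gt0 : 0 < r).

Local Notation letters := (seqlexi 'I_n).
Local Notation word := (word n r).
Local Notation cantor := (cantor n r).

Let rho0 : cantor_seq n := fun _ => Ordinal (ltnW n_gt1).
Let w0 : word := (Ordinal r_gt0, [::]).

Definition wext (u : word) (s : letters) : word := (u.1, u.2 ++ s).

Lemma prepend_cat s t (rho : cantor_seq n) :
  prepend (s ++ t) rho = prepend s (prepend t rho).
Proof. exact: foldr_cat. Qed.

Lemma wcat_ext u s (rho : cantor_seq n) :
  wcat (wext u s) rho = wcat u (prepend s rho).
Proof. by rewrite /wcat /= prepend_cat. Qed.

Lemma scons_inj c d (rho rho' : cantor_seq n) :
  scons c rho = scons d rho' -> c = d /\ rho = rho'.
Proof.
move=> E; split; first exact: (congr1 (@^~ 0%N) E).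
by apply/funext => i; exact: (congr1 (@^~ i.+1) E).
Qed.

Lemma prepend_inj s : injective (prepend s : cantor_seq n -> _).
Proof. by elim: s => //= c s IH rho rho' /scons_inj [_ /IH]. Qed.

Lemma prepend_comp s t (rho rho' : cantor_seq n) :
  prepend s rho = prepend t rho' ->
  (exists p, t = s ++ p) \/ (exists p, s = t ++ p).
Proof.
elim: s t => [|c s IH] [|d t] /=; try by [left; exists [::] | left; exists (d :: t) | right; exists (c :: s)].
case/scons_inj => <- /IH [[p ->]|[p ->]]; [left|right]; by exists p.
Qed.

Lemma wcat_comp u v (rho rho' : cantor_seq n) : wcat u rho = wcat v rho' ->
  (exists p, v = wext u p) \/ (exists p, u = wext v p).
Proof.
case: u v => a s [b t] /= [<- /prepend_comp [[p ->]|[p ->]]]; [left|right];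
  by exists p.
Qed.

Lemma wext_inj u : injective (wext u).
Proof. by move=> s t [/eqP]; rewrite eqseq_cat // eqxx => /eqP. Qed.

Lemma wextA u s t : wext (wext u s) t = wext u (s ++ t).
Proof. by rewrite /wext /= catA. Qed.

Lemma wext0 u s : wext u s = u -> s = [::].
Proof.
case: u => a t [/(congr1 (@size _)) /eqP].
by rewrite size_cat -{2}[size t]addn0 eqn_add2l => /nilP.
Qed.

Lemma complete_uniq (A : seq word) (x : cantor) u v : complete_antichain A ->
  u \in A -> v \in A -> wprefix u x -> wprefix v x -> u = v.
Proof.
by move=> /(_ x) [w [_ wP]] uA vA ux vx; rewrite -(wP u) // (wP v).
Qed.

Lemma complete_ext A u p : complete_antichain A ->
  u \in A -> wext u p \in A -> p = [::].
Proof.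
move=> cA uA upA; apply: (@wext0 u); apply: (@complete_uniq A (wcat (wext u p) rho0)) => //.
- by exists rho0.
- by exists (prepend p rho0); rewrite wcat_ext.
Qed.

Lemma complete_incomp A u v p q : complete_antichain A ->
  u \in A -> v \in A -> wext u p = wext v q -> u = v.
Proof.
move=> cA uA vA E; apply: (@complete_uniq A (wcat (wext u p) rho0)) => //.
- by exists (prepend p rho0); rewrite wcat_ext.
- by exists (prepend q rho0); rewrite E wcat_ext.
Qed.

Lemma lexi_cat2l (s p q : letters) : (s ++ p < s ++ q :> letters)%O = (p < q)%O.
Proof. by elim: s => //= c s IH; rewrite ltxi_cons lexx /=. Qed.

Lemma wext_lt2l u p q : (wext u p < wext u q)%O = (p < q)%O.
Proof. by rewrite ltEprodlexi /= lexx /= lexi_cat2l. Qed.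

Lemma lexi_cat (s t p q : letters) : (s < t)%O -> (forall z, t <> s ++ z) ->
  (s ++ p < t ++ q :> letters)%O.
Proof.
elim: s t => [|c s IH] [|d t] //=; first by move=> _ /(_ (d :: t)).
rewrite !ltxi_cons => /andP[cd /implyP dcP] H; rewrite cd /=.
apply/implyP => dc; apply: IH => [|z tz]; first exact: dcP.
by apply: (H z); rewrite tz (@le_anti _ _ c d) ?cd.
Qed.

Lemma wext_lt u v p q : (u < v)%O -> (forall z, v <> wext u z) ->
  (wext u p < wext v q)%O.
Proof.
case: u v => a s [b t]; rewrite /wext /= !ltEprodlexi /=.
move=> /andP[ab /implyP baP] H; rewrite ab /=; apply/implyP => ba.
apply: lexi_cat => [|z tz]; first exact: baP.
by apply: (H z); rewrite tz /= (@le_anti _ _ a b) ?ab.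
Qed.

(* The list [A] in which the i-th word is replaced by its extensions by the    *)
(* i-th list of suffixes.                                                      *)
Definition expand (A : seq word) (P : seq (seq letters)) : seq word :=
  flatten [seq [seq wext ap.1 s | s <- ap.2] | ap <- zip A P].

Definition complete_suffixes (p : seq letters) : Prop :=
  sorted <%O p /\ forall rho, exists s rho', s \in p /\ rho = prepend s rho'
  /\ forall t rho'', t \in p -> rho = prepend t rho'' -> t = s.

Lemma mem_expand A P w : size P = size A -> w \in expand A P ->
  exists i, (i < size A)%N /\
    exists2 s, s \in nth [::] P i & w = wext (nth w0 A i) s.
Proof.
move=> sP /flatten_mapP[[a p] /(nthP (w0, [::]))[i]].
rewrite size_zip sP minnn => iA; rewrite nth_zip // => -[<- <-] /= /mapP[s sp ->].
by exists i; split => //; exists s.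
Qed.

Lemma expand_mem A P i s : size P = size A -> (i < size A)%N ->
  s \in nth [::] P i -> wext (nth w0 A i) s \in expand A P.
Proof.
move=> sP iA sPi; apply/flatten_mapP; exists (nth w0 A i, nth [::] P i).
  by rewrite -nth_zip // mem_nth // size_zip sP minnn.
exact: map_f.
Qed.

Lemma expand_complete A P : complete_antichain A -> uniq A -> size P = size A ->
  (forall i, (i < size A)%N -> complete_suffixes (nth [::] P i)) ->
  complete_antichain (expand A P).
Proof.
move=> cA uA sP cP x; have [a [[aA [rho xa]] aU]] := cA x.
have iA : (index a A < size A)%N by rewrite index_mem.
have [_ /(_ rho)[s [rho' [sP' [rhos sU]]]]] := cP _ iA.
exists (wext a s); split.
  split; last by exists rho'; rewrite wcat_ext -rhos.
  by rewrite -{1}(nth_index w0 aA); apply: expand_mem.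
move=> w [/(mem_expand sP)[j [jA [t tP ->]]] [rho'' xw]].
have E : a = nth w0 A j.
  apply: aU; split; first exact: mem_nth.
  by exists (prepend t rho''); rewrite -wcat_ext.
rewrite -E; congr wext; symmetry; apply: (sU t rho'').
  by rewrite E index_uniq.
have := xw; rewrite wcat_ext -E xa => -[]; exact: prepend_inj.
Qed.

Lemma expand_sorted A P : complete_antichain A -> sorted <%O A ->
  size P = size A ->
  (forall i, (i < size A)%N -> complete_suffixes (nth [::] P i)) ->
  sorted <%O (expand A P).
Proof.
move=> cA; rewrite (sorted_pairwise lt_trans) => sA sP cP.
rewrite (sorted_pairwise lt_trans).
suff H B : {subset B <= A} -> size P = size B ->
    (forall i, (i < size B)%N -> complete_suffixes (nth [::] P i)) ->
    pairwise <%O B -> pairwise <%O (expand B P) by exact: H.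
elim: B P {sP cP} => [|a B IH] [|p P] //= sub [sP] cP /andP[aB sB].
rewrite /expand /= pairwise_cat -/(expand B P); apply/and3P; split.
- apply/allrelP => w z /mapP[s sp ->] /(mem_expand sP)[i [iB [t tP ->]]].
  have Bi : nth w0 B i \in B by exact: mem_nth.
  apply: wext_lt => [|q E]; first exact: (allP aB).
  have := allP aB _ Bi; rewrite -(@complete_incomp A a (nth w0 B i) q [::] cA).
  + by rewrite ltxx.
  + by apply: sub; rewrite mem_head.
  + by apply: sub; rewrite inE Bi orbT.
  + by rewrite -E /wext cats0; case: (nth _ _ _).
- rewrite pairwise_map; have [] := cP 0%N isT.
  rewrite (sorted_pairwise lt_trans) => /= sp _; apply: sub_pairwise sp => s t st.
  by rewrite /= wext_lt2l.
- apply: IH => // [w wB|i iB]; last exact: (cP i.+1).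
  by apply: sub; rewrite inE wB orbT.
Qed.

Definition wprefixb (u w : word) := (u.1 == w.1) && prefix u.2 w.2.

Lemma wprefixbP u w : reflect (exists p, w = wext u p) (wprefixb u w).
Proof.
case: u w => a s [b t]; apply: (iffP andP) => /= [[/eqP <- /prefixP[p ->]]|[p [-> ->]]].
  by exists p.
by rewrite eqxx prefix_prefix.
Qed.

Definition refines (C A : seq word) : Prop :=
  forall c, c \in C -> exists2 a, a \in A & wprefixb a c.

Definition suffixes (C : seq word) (a : word) : seq letters :=
  [seq drop (size a.2) c.2 | c <- C & wprefixb a c].

Lemma mem_suffixes C a s : (s \in suffixes C a) = (wext a s \in C).
Proof.
apply/mapP/idP => [[c]|aC].
  rewrite mem_filter => /andP[/wprefixbP[p ->] pC] ->.
  by rewrite /= drop_size_cat.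
exists (wext a s); last by rewrite /= drop_size_cat.
by rewrite mem_filter aC andbT; apply/wprefixbP; exists s.
Qed.

Lemma suffixes_complete A C a : complete_antichain A -> complete_antichain C ->
  sorted <%O C -> refines C A -> a \in A -> complete_suffixes (suffixes C a).
Proof.
move=> cA cC sC CA aA; split.
  rewrite /suffixes (sorted_pairwise lt_trans) pairwise_map.
  have sF : sorted <%O [seq c <- C | wprefixb a c].
    exact: (sorted_filter lt_trans).
  have : all (wprefixb a) [seq c <- C | wprefixb a c] by exact: filter_all.
  move: sF; rewrite (sorted_pairwise lt_trans) => + aF.
  apply: sub_in_pairwise aF => _ _ /wprefixbP[p ->] /wprefixbP[q ->].
  by rewrite /= !drop_size_cat // wext_lt2l.
move=> rho; have [c [[cC' [rho' xc]] cU]] := cC (wcat a rho).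
have [b bA /wprefixbP[p cE]] := CA _ cC'.
have E : a = b.
  apply: (@complete_uniq A (wcat a rho)) => //; first by exists rho.
  by exists (prepend p rho'); rewrite -wcat_ext -cE.
subst b c; exists p, rho'; split; first by rewrite mem_suffixes.
split; first by move: xc; rewrite wcat_ext => -[/prepend_inj].
move=> t rho'' tC rhoE; apply: (@wext_inj a); symmetry; apply: cU.
by rewrite -mem_suffixes; split=> //; exists rho''; rewrite wcat_ext -rhoE.
Qed.

Lemma expand_refines A C : complete_antichain A -> sorted <%O A ->
  complete_antichain C -> sorted <%O C -> refines C A ->
  exists P, [/\ size P = size A,
    forall i, (i < size A)%N -> complete_suffixes (nth [::] P i)
    & C = expand A P].
Proof.
move=> cA sA cC sC CA; exists [seq suffixes C a | a <- A].
have sP : size [seq suffixes C a | a <- A] = size A by rewrite size_map.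
have cP i : (i < size A)%N -> complete_suffixes (nth [::] [seq suffixes C a | a <- A] i).
  move=> iA; rewrite (nth_map w0) //.
  by apply: (suffixes_complete cA) => //; apply: mem_nth.
split=> //; apply: lt_sorted_eq => //; first exact: expand_sorted.
move=> c; apply/idP/idP => [cC'|].
  have [a aA /wprefixbP[p cE]] := CA _ cC'.
  rewrite cE -(nth_index w0 aA); apply: expand_mem => //.
    by rewrite index_mem.
  by rewrite (nth_map w0) ?index_mem // nth_index // mem_suffixes -cE.
case/(mem_expand sP) => i [iA [s]].
by rewrite (nth_map w0) // mem_suffixes => ? ->.
Qed.

Lemma common_refinement A B : complete_antichain A -> complete_antichain B ->
  exists C, [/\ complete_antichain C, sorted <%O C, refines C A & refines C B].
Proof.
move=> cA cB.
pose C := [seq c <- A | has (wprefixb^~ c) B] ++ [seq c <- B | has (wprefixb^~ c) A].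
have memC c : c \in C -> (exists a p, a \in A /\ c = wext a p) /\
    (exists b q, b \in B /\ c = wext b q) /\ (c \in A \/ c \in B).
  have c0 : c = wext c [::] by case: c => a s; rewrite /wext cats0.
  rewrite mem_cat !mem_filter => /orP[] /andP[/hasP[d dB /wprefixbP[p cE]] cA'].
    split; first by exists c, [::].
    by split; [exists d, p | left].
  split; first by exists d, p.
  by split; [exists c, [::] | right].
have refl (w : word) : wprefixb w w by rewrite /wprefixb eqxx prefix_refl.
exists (sort <=%O (undup C)); split.
- move=> x; have [a [[aA [rho xa]] aU]] := cA x; have [b [[bB [rho' xb]] bU]] := cB x.
  have [c [cC xc]] : exists c, c \in C /\ wprefix c x.
    have : wcat a rho = wcat b rho' by rewrite -xa.
    move=> /wcat_comp[[p E]|[p E]].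
      exists b; split; last by exists rho'.
      rewrite mem_cat !mem_filter bB andbT orbC; apply/orP; left.
      by apply/hasP; exists a => //; apply/wprefixbP; exists p.
    exists a; split; last by exists rho.
    rewrite mem_cat !mem_filter aA andbT; apply/orP; left.
    by apply/hasP; exists b => //; apply/wprefixbP; exists p.
  exists c; split; first by rewrite mem_sort mem_undup.
  have pre w z q : wprefix (wext w q) z -> wprefix w z.
    by case=> t ->; exists (prepend q t); rewrite wcat_ext.
  have key d : d \in C -> wprefix d x ->
      (exists p, d = wext a p) /\ (exists q, d = wext b q) /\ (d = a \/ d = b).
    move=> /memC[[a' [p [a'A dE]]] [[b' [q [b'B dE']]] dAB]] dx.
    have -> : a = a' by apply: aU; split => //; apply: (pre _ _ p); rewrite -dE.
    have -> : b = b' by apply: bU; split => //; apply: (pre _ _ q); rewrite -dE'.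
    split; first by exists p.
    split; first by exists q.
    case: dAB => [dA|dB]; [left|right].
      have := dA; rewrite {1}dE => /(complete_ext cA a'A) p0.
      by rewrite dE p0 /wext cats0; case: (a').
    have := dB; rewrite {1}dE' => /(complete_ext cB b'B) q0.
    by rewrite dE' q0 /wext cats0; case: (b').
  move=> d [dC dx]; rewrite mem_sort mem_undup in dC.
  have anti u v : (exists p, u = wext v p) -> (exists p, v = wext u p) -> u = v.
    move=> [p E] [q E']; move: E'; rewrite E wextA => /esym/wext0.
    by case: p {E} => //; rewrite /wext cats0; case: (v).
  have [cp [cq ccase]] := key _ cC xc; have [dp [dq dcase]] := key _ dC dx.
  case: ccase dcase cp cq dp dq => -> [] -> // ? ? ? ?; exact: anti.
- by rewrite sort_lt_sorted undup_uniq.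
- move=> c; rewrite mem_sort mem_undup => /memC[[a [p [aA ->]]] _].
  by exists a => //; apply/wprefixbP; exists p.
- move=> c; rewrite mem_sort mem_undup => /memC[_ [[b [p [bB ->]]] _]].
  by exists b => //; apply/wprefixbP; exists p.
Qed.

Lemma size_expand A B P : size P = size A -> size P = size B ->
  size (expand A P) = size (expand B P).
Proof.
elim: P A B => [|p P IH] [|a A] [|b B] //= [sA] [sB].
by rewrite /expand /= !size_cat !size_map; congr addn; apply: IH.
Qed.

Lemma expand_cat A B P Q : size A = size P ->
  expand (A ++ B) (P ++ Q) = expand A P ++ expand B Q.
Proof. by move=> sAP; rewrite /expand zip_cat // map_cat flatten_cat. Qed.

Lemma rot_expand A P b : size P = size A ->
  exists k, rot k (expand A P) = expand (rot b A) (rot b P).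
Proof.
move=> sP; have st : size (take b A) = size (take b P) by rewrite !size_take sP.
have sd : size (drop b A) = size (drop b P) by rewrite !size_drop sP.
exists (size (expand (take b A) (take b P))).
rewrite -{2}(cat_take_drop b A) -{2}(cat_take_drop b P) expand_cat //.
by rewrite rot_size_cat /rot expand_cat.
Qed.

(* [g] maps each [nth w0 A i] to [nth w0 B i], suffix for suffix. *)
Definition maps (g : cantor -> cantor) (A B : seq word) : Prop :=
  size A = size B /\
  forall i, (i < size A)%N -> forall rho, g (wcat (nth w0 A i) rho) = wcat (nth w0 B i) rho.

Lemma maps_cons g a b A B : maps g (a :: A) (b :: B) <->
  (forall rho, g (wcat a rho) = wcat b rho) /\ maps g A B.
Proof.
split=> [[[sAB] H]|[H0 [sAB H]]].
  by split; [exact: (H 0%N) | split=> // i iA; exact: (H i.+1)].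
by split=> [|[|i] //= iA]; rewrite /= ?sAB //; exact: H.
Qed.

Lemma maps_cat g A A' B B' : maps g A B -> maps g A' B' -> maps g (A ++ A') (B ++ B').
Proof.
elim: A B => [|a A IH] [|b B]; try by case.
by move=> /maps_cons[H0 H] H'; apply/maps_cons; split => //; exact: IH.
Qed.

Lemma maps_expand g A B P : size P = size A ->
  maps g A B -> maps g (expand A P) (expand B P).
Proof.
elim: P A B => [|p P IH] [|a A] [|b B] //= [sA]; try by case.
move=> /maps_cons[H0 H]; rewrite /expand /=; apply: maps_cat; last exact: IH.
elim: p => //= s p IHp; apply/maps_cons; split=> // rho.
by rewrite !wcat_ext.
Qed.

Lemma nth_rot (T : Type) (x : T) k s i : (k <= size s)%N -> (i < size s)%N ->
  nth x (rot k s) i = nth x s ((k + i) %% size s).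
Proof.
move=> ks iS; rewrite /rot nth_cat size_drop nth_drop.
have [ik|ki] := ltnP; first by rewrite modn_small // -ltn_subRL.
have sik : (size s <= k + i)%N by rewrite -leq_subLR.
rewrite nth_take; last by rewrite ltn_subLR // subnK // addnC.
have -> : (i - (size s - k) = k + i - size s)%N by rewrite subnBA // addnC.
rewrite -[in RHS](subnK sik) modnDr modn_small //.
by rewrite ltn_subLR // (leq_ltn_trans (leq_add ks (leqnn i))) // ltn_add2l.
Qed.

Lemma maps_rot g A B k : maps g A B -> maps g (rot k A) (rot k B).
Proof.
move=> [sAB H]; split=> [|i]; first by rewrite !size_rot.
rewrite size_rot => iA rho.
have [kA|Ak] := leqP (size A) k; first by rewrite !rot_oversize -?sAB //; exact: H.
by rewrite !nth_rot -?sAB ?(ltnW Ak) //; apply: H; rewrite ltn_mod (leq_ltn_trans _ iA).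
Qed.

Lemma maps_comp (f g : homeo cantor) A B C : maps f A B -> maps g B C ->
  maps (f * g)%g A C.
Proof.
move=> [sAB H] [sBC H']; split; first by rewrite sAB.
by move=> i iA rho; rewrite /mul /= H // H' // -sAB.
Qed.

Lemma T_mapsP (g : homeo cantor) : is_HigmanThompsonT g <->
  exists U V k, [/\ sorted <%O U /\ complete_antichain U,
    sorted <%O V /\ complete_antichain V & maps g U (rot k V)].
Proof.
split=> [[l [u [v [b [Hu Hv H]]]]]|[U [V [k [HU HV [sUV H]]]]]].
  exists u, v, b; split=> //; split=> [|i]; first by rewrite size_rot !size_tuple.
  rewrite size_tuple => il rho.
  have := H (Ordinal il) rho; rewrite !(tnth_nth w0) /= => ->.
  rewrite inordK ?ltn_mod // nth_rot ?size_tuple ?(ltnW (ltn_ord b)) //.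
  by rewrite addnC.
have U0 : (0 < size U)%N.
  have [u [[uU _] _]] := HU.2 ((Ordinal r_gt0, rho0) : cantor).
  by case: (U) uU.
rewrite size_rot in sUV.
have sU : size U == (size U).-1.+1 by rewrite prednK.
have sV : size V == (size U).-1.+1 by rewrite prednK // sUV.
wlog ks : k H / (k < size V)%N.
  move=> W; have [ks|kV] := ltnP k (size V); first exact: (W k).
  by apply: (W 0%N); [rewrite rot0 -(rot_oversize kV) | rewrite -sUV].
have kl : (k < (size U).-1.+1)%N by rewrite prednK // sUV.
exists (size U).-1, (Tuple sU), (Tuple sV), (Ordinal kl); split=> // a rho.
rewrite !(tnth_nth w0) /= inordK ?ltn_mod //.
have aU : (a < size U)%N by have := ltn_ord a; rewrite [X in (_ < X)%N -> _]prednK.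
rewrite H // nth_rot ?(ltnW ks) -?sUV // addnC.
by congr (wcat (nth _ _ (_ %% _)) _); rewrite prednK.
Qed.

Lemma rot_rot_ex (T : Type) j k (s : seq T) : exists m, rot j (rot k s) = rot m s.
Proof.
have [ks|/ltnW sk] := leqP k (size s); last by exists j; rewrite (rot_oversize sk).
have [js|/ltnW sj] := leqP j (size s).
  by rewrite rot_add_mod //; eexists.
by exists k; rewrite rot_oversize // size_rot.
Qed.

Lemma T_mul (g h : homeo cantor) : is_HigmanThompsonT g ->
  is_HigmanThompsonT h -> is_HigmanThompsonT (g * h)%g.
Proof.
move=> /T_mapsP[U [V [k [[sU cU] [sV cV] gUV]]]].
move=> /T_mapsP[W [Z [m [[sW cW] [sZ cZ] hWZ]]]].
have [C [cC sC CV CW]] := common_refinement cV cW.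
have [P [zP cP CE]] := expand_refines cV sV cC sC CV.
have [Q [zQ cQ CE']] := expand_refines cW sW cC sC CW.
have zUV : size U = size V by case: gUV; rewrite size_rot.
have zWZ : size W = size Z by case: hWZ; rewrite size_rot.
have cR (s : seq (seq letters)) j N : size s = N ->
    (forall i, (i < N)%N -> complete_suffixes (nth [::] s i)) ->
    forall i, (i < N)%N -> complete_suffixes (nth [::] (rot j s) i).
  move=> <- H i iN; have [js|sj] := leqP (size s) j.
    by rewrite rot_oversize //; exact: H.
  rewrite nth_rot ?(ltnW sj) //; apply: H.
  by rewrite ltn_mod (leq_ltn_trans _ iN).
have zP' : size (rot k P) = size U by rewrite size_rot zP.
have cP' : forall i, (i < size U)%N -> complete_suffixes (nth [::] (rot k P) i).
  by apply: cR; rewrite zUV.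
have zQ' : size (rotr m Q) = size Z by rewrite size_rotr zQ.
have cQ' : forall i, (i < size Z)%N -> complete_suffixes (nth [::] (rotr m Q) i).
  by apply: cR; rewrite -zWZ.
have [j Ej] := rot_expand k zP.
have [j' Ej'] := rot_expand m zQ'.
rewrite rotrK -CE in Ej Ej'.
have [q Eq] := rot_rot_ex j j' (expand Z (rotr m Q)).
apply/T_mapsP; exists (expand U (rot k P)), (expand Z (rotr m Q)), q; split.
- by split; [apply: expand_sorted | apply: expand_complete => //; apply: lt_sorted_uniq].
- by split; [apply: expand_sorted | apply: expand_complete => //; apply: lt_sorted_uniq].
rewrite -Eq; apply: (@maps_comp _ _ _ (rot j C)).
  by rewrite Ej; apply: maps_expand.
by apply: maps_rot; rewrite CE' Ej'; apply: maps_expand.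
Qed.

Lemma T_inv (g : homeo cantor) : is_HigmanThompsonT g -> is_HigmanThompsonT g^-1%g.
Proof.
move=> /T_mapsP[U [V [k [HU HV gUV]]]]; apply/T_mapsP.
have zUV : size U = size V by case: gUV; rewrite size_rot.
have [k' Ek'] : exists k', rotr k U = rot k' U by eexists.
exists V, U, k'; split=> //; rewrite -Ek'.
have [_ H] : maps g (rotr k U) V.
  by rewrite -[V](rotK k) /rotr size_rot zUV; apply: maps_rot.
split=> [|i iV rho]; first by rewrite size_rotr.
rewrite -H ?size_rotr ?zUV //; exact: (homeo_funK g).
Qed.

Lemma T_one : is_HigmanThompsonT (1%g : homeo cantor).
Proof.
pose U : seq word := [seq (i, [::]) | i <- enum 'I_r].
have HU : sorted <%O U /\ complete_antichain U.
  split.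
    rewrite sorted_map; have := iota_ltn_sorted 0 r.
    rewrite -val_enum_ord sorted_map; apply: sub_sorted => i j /= ij.
    by rewrite ltEprodlexi /= !leEord (ltnW ij) leqNgt ij.
  move=> [a rho]; exists (a, [::]); split.
    by split; [apply: map_f; rewrite mem_enum | exists rho].
  by move=> w [/mapP[i _ ->] [rho' [->]]].
by apply/T_mapsP; exists U, U, 0%N; split=> //; rewrite rot0.
Qed.

End Closure.

Definition HigmanThompsonT_pred n r (n_gt1 : 1 < n) (r_gt0 : 0 < r) :
    pred (homeo (cantor n r)) :=
  fun g => `[< is_HigmanThompsonT g >].

(* The arguments 1 < n and 0 < r are used only to show that this is a group.    *)
Definition HigmanThompsonT n r (n_gt1 : 1 < n) (r_gt0 : 0 < r) : Type :=
  {g : homeo (cantor n r) | HigmanThompsonT_pred n_gt1 r_gt0 g}.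

Section HigmanThompson.

Variables (n r : nat) (n_gt1 : 1 < n) (r_gt0 : 0 < r).

HB.instance Definition _ := SubChoice.on (HigmanThompsonT n_gt1 r_gt0).

Fact T_group_closed : group_closed (HigmanThompsonT_pred n_gt1 r_gt0).
Proof.
split=> [|g h /asboolP Tg /asboolP Th]; apply/asboolP; first exact: T_one.
by apply: T_mul => //; apply: T_inv.
Qed.

HB.instance Definition _ := SubChoice_isSubGroup.Build
  (homeo (cantor n r)) (HigmanThompsonT_pred n_gt1 r_gt0)
  (HigmanThompsonT n_gt1 r_gt0) T_group_closed.

End HigmanThompson.

(* Main.v *)
(* Let M be the intersection of all nontrivial normal subgroups of Aut T. It is    *)
(* characteristic, consists of inner automorphisms, and contains the commutators   *)
(* of elements of T supported in a common cone. By Rubin's method the Cantor space *)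
(* can be reconstructed from M, so an automorphism phi of Aut T acts on M as the   *)
(* conjugation by a homeomorphism h, which preserves or reverses the cyclic order. *)
(* Hence phi (inner y) acts on T as the conjugation by y ^ h for every y in T.     *)
(* Once y ^ h is known to lie in T, the subgroup of inner automorphisms is         *)
(* characteristic in Aut T, and Aut T is complete by Burnside's criterion.         *)
(*                                                                                 *)
(* The elements of T that agree locally with elements of M form a normal subgroup  *)
(* K, whose conjugates under h lie in T, and T is generated by K and a rotation c  *)
(* of finite order. If n = 2 then c is in K. If n >= 3, for each word v without    *)
(* letter 1, applying a fixed map supported in the cone of v to every block        *)
(* between consecutive letters 1 defines a homeomorphism g_v which normalizes T.   *)
(* As T / K is finite, a power of phi^-1 (g_v) fixes the class of c, so c ^ h      *)
(* commutes modulo T with a power of g_v. Up to T, the map c ^ h fixes a point and *)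
(* is monotone, and near this point it commutes with these powers, so that it      *)
(* respects the gaps between their fixed points; this forces it to replace         *)
(* prefixes on some cone. As c ^ h normalizes T, which is transitive on cones, it  *)
(* does so everywhere, and it belongs to T.                                        *)

Require Import Defs.
From mathcomp Require Import all_boot all_order.
From mathcomp Require Import boolp classical_sets topology.
From mathcomp Require Import zify.

Set Implicit Arguments.
Unset Strict Implicit.
Unset Printing Implicit Defensive.

Import Order.TTheory.

(** * Agreement of points up to a depth *)

(** By Burnside's criterion ([inner_bij]), a group with trivial centre has a complete automorphism
    group as soon as every automorphism [phi] of that group sends inner automorphisms to inner ones.
    So [phi (inner y)] has to be described geometrically and shown to come from an element of [T]
    ([inner_char]).

    The geometry is recovered from the monolith of [Aut T], seen as a set [S] of homeomorphisms. All
    that is used of it is recorded in [large] and established by [S_large]. It follows that [S] has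
    elements supported in any prescribed cone ([large_cone]), which is enough for Rubin's argument:
    inclusion between closures of supports can be expressed inside the group ([belowP]), so an
    automorphism of [S] moves points and is the conjugation by a homeomorphism [h] ([autS_homeo]).
    Since [S] has trivial centralizer, [phi (inner y)] is the conjugation by [y ^ h] on all of [T]
    ([phi_homeo]). Elements of [S] slide points along arcs, so [h] respects the cyclic order up to
    reversal ([orientation]); hence an element of [T] that agrees locally with [S] stays in [T]
    after conjugation by [h] ([locS_conj]).

    Modulo such elements, [T] is generated by one rotation [c] of finite order ([T_mod]). With two
    letters [c] is one of them. With at least three letters, the maps [g_v] of [exotic_ex] normalize
    [T], and a counting argument shows that [c ^ h] commutes modulo [T] with a power of each of
    them. This forces [c ^ h] into [T] ([rigid_T]): near a fixed point the commutation becomes exact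
    on a cone ([conj_cone]), an increasing map that commutes with powers of the [g_v] permutes the
    gaps between their fixed points, and these gaps are rich enough to leave only prefix replacement
    ([exotic_rigid]), which then spreads to the whole space ([fixing_T]). *)

Section Agreement.

Local Open Scope classical_set_scope.

Variables n r : nat.
Local Notation Y := (cantor_seq n).
Local Notation X := (cantor n r).

Definition eqs (k : nat) (x y : Y) := forall i, (i < k)%N -> x i = y i.
Definition eqx (k : nat) (x y : X) := x.1 = y.1 /\ eqs k x.2 y.2.

Lemma eqs_nbhs (x : Y) k : nbhs x [set y : Y | eqs k x y].
Proof.
elim: k => [|k IH]; first by apply: filterS (@filterT _ (nbhs x) _) => y _ i.
have H : nbhs x [set y : Y | y k = x k].
  exact: (@proj_continuous nat (fun _ => discrete_topology 'I_n) k x _ (discrete_set1 (x k))).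
apply: filterS (filterI IH H) => y [/= E1 E2] i.
by rewrite ltnS leq_eqVlt => /orP[/eqP ->|/E1].
Qed.

(** The sets that contain a cylinder around [x] form a filter converging to [x] in each coordinate,
    hence in the product topology; so every neighbourhood belongs to it. *)
Lemma nbhs_eqs (x : Y) (A : set Y) :
  nbhs x A -> exists k, forall y, eqs k x y -> A y.
Proof.
pose F : set_system Y := [set A | exists k, forall y, eqs k x y -> A y].
have FF : Filter F.
  split; first by exists 0.
    move=> P Q [k HP] [l HQ]; exists (maxn k l) => y E.
    by split; [apply: HP|apply: HQ] => i ik; apply: E; rewrite leq_max ik ?orbT.
  by move=> P Q PQ [k HP]; exists k => y /HP/PQ.
suff H : F --> x by exact: H.
apply/cvg_sup => i.
move=> B [C [[D oD DC] Cx] CB].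
exists i.+1 => y E; apply: CB; rewrite -DC /= in Cx *.
by rewrite -(E i).
Qed.

Lemma continuousP_eqx (f : X -> X) : continuous f <->
  forall x m, exists k, forall y, eqx k x y -> eqx m (f x) (f y).
Proof.
split=> [cf x m|H x A].
  have H : nbhs (f x) [set y : X | eqx m (f x) y].
    exists ([set a : discrete_topology 'I_r | a = (f x).1],
            [set y : Y | eqs m (f x).2 y]) => /=.
      by split; [exact: discrete_set1|exact: eqs_nbhs].
    by move=> [a y] /= [-> ?].
  have [[P Q] /= [Px /nbhs_eqs[k Qk]] PQ] := cf x _ H; exists k => y [E1 E2].
  by apply: (PQ y); split=> /=; [rewrite -E1; apply: nbhs_singleton|apply: Qk].
move=> [[P Q] /= [Px /nbhs_eqs[k Qk]] PQ].
have [l Hl] := H x k.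
exists ([set a : discrete_topology 'I_r | a = x.1], [set y : Y | eqs l x.2 y]) => /=.
  by split; [exact: discrete_set1|exact: eqs_nbhs].
move=> y /= [E1 E2]; have [E3 E4] : eqx k (f x) (f y) by apply: Hl.
by apply: PQ; split=> /=; [rewrite -E3; apply: nbhs_singleton|apply: Qk].
Qed.

End Agreement.

(** * Lexicographic and cyclic orders *)

Section Streams.

Variable n : nat.
Local Notation D := 'I_n.+1.
Local Notation Y := (cantor_seq n.+1).
Implicit Types (x y z : Y) (s t : seq D).

Definition dig x i : nat := (x i : D).

Definition slt x y := exists i, eqs i x y /\ (dig x i < dig y i)%N.

Definition stake k x : seq D := mkseq x k.
Definition sdrop k x : Y := fun i => x (k + i)%N.

Lemma prependE s x i :
  prepend s x i = if (i < size s)%N then nth ord0 s i else x (i - size s)%N.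
Proof.
by elim: s i => [|c s IH] [|i] //=; rewrite ?subn0 // IH ltnS subSS.
Qed.

Lemma prepend_stake k x : prepend (stake k x) (sdrop k x) = x.
Proof.
apply/funext => i; rewrite prependE size_mkseq; case: ltnP => ik.
  by rewrite nth_mkseq.
by rewrite /sdrop subnKC.
Qed.

Lemma stake_prepend s x : stake (size s) (prepend s x) = s.
Proof.
apply: (@eq_from_nth _ ord0); rewrite ?size_mkseq // => i iS.
by rewrite nth_mkseq // prependE iS.
Qed.

Lemma sdrop_prepend s x : sdrop (size s) (prepend s x) = x.
Proof.
apply/funext => i; rewrite /sdrop prependE ltnNge leq_addr /=.
by rewrite addKn.
Qed.

Lemma size_stake k x : size (stake k x) = k. Proof. exact: size_mkseq. Qed.

Lemma sdropD k l x : sdrop k (sdrop l x) = sdrop (l + k) x.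
Proof. by apply/funext => i; rewrite /sdrop addnA. Qed.

Lemma stakeD k l x : stake (k + l) x = stake k x ++ stake l (sdrop k x).
Proof.
apply: (@eq_from_nth _ ord0); rewrite ?size_cat ?size_mkseq // => i ikl.
rewrite nth_cat size_mkseq nth_mkseq //; case: ltnP => ik.
  by rewrite nth_mkseq.
by rewrite nth_mkseq ?ltn_subLR // /sdrop subnKC.
Qed.

Lemma eqs_sym k x y : eqs k x y -> eqs k y x.
Proof. by move=> E i /E. Qed.
Lemma eqs_trans k y x z : eqs k x y -> eqs k y z -> eqs k x z.
Proof. by move=> E F i ik; rewrite E ?F. Qed.
Lemma eqs_le k l x y : (k <= l)%N -> eqs l x y -> eqs k x y.
Proof. by move=> kl E i ik; apply: E; apply: leq_trans kl. Qed.

Lemma eqs_stake k x y : eqs k x y <-> stake k x = stake k y.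
Proof.
split=> [E|E i ik].
  apply: (@eq_from_nth _ ord0); rewrite ?size_mkseq // => i ik.
  by rewrite !nth_mkseq // E.
by have := congr1 (fun s => nth ord0 s i) E; rewrite !nth_mkseq.
Qed.

Lemma eqs_eq x y : (forall k, eqs k x y) -> x = y.
Proof. by move=> E; apply/funext => i; apply: (E i.+1). Qed.

Lemma neq_first x y : x <> y -> exists i, eqs i x y /\ x i <> y i.
Proof.
move=> xy; apply: contrapT => H; apply: xy; apply: eqs_eq; elim=> [|k IH] //.
move=> i; rewrite ltnS leq_eqVlt => /orP[/eqP ->|/IH //].
by apply: contrapT => E; apply: H; exists k.
Qed.

Lemma slt_irr x : ~ slt x x.
Proof. by case=> i [_]; rewrite ltnn. Qed.

Lemma slt_trans y x z : slt x y -> slt y z -> slt x z.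
Proof.
move=> [i [Ei Li]] [j [Ej Lj]]; have [ij|ji|ij] := ltngtP i j.
- exists i; split; first by apply: eqs_trans Ei (eqs_le (ltnW ij) Ej).
  by rewrite /dig -(Ej i ij).
- exists j; split; first by apply: eqs_trans (eqs_le (ltnW ji) Ei) Ej.
  by rewrite /dig (Ei j ji).
- subst j; exists i; split; first exact: eqs_trans Ei Ej.
  exact: ltn_trans Li Lj.
Qed.

Lemma slt_asym x y : slt x y -> ~ slt y x.
Proof. by move=> xy yx; apply: (@slt_irr x); apply: slt_trans xy yx. Qed.

Lemma slt_total x y : x <> y -> slt x y \/ slt y x.
Proof.
move=> /neq_first[i [E F]]; have [ij|ji|ij] := ltngtP (dig x i) (dig y i).
- by left; exists i.
- by right; exists i; split=> //; exact: eqs_sym.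
- by case: F; apply: val_inj.
Qed.

Lemma eqs_prepend s k x y : eqs k x y -> eqs (size s + k) (prepend s x) (prepend s y).
Proof.
move=> E i ik; rewrite !prependE; case: ltnP => // si.
by apply: E; rewrite ltn_subLR.
Qed.

Lemma eqs_prependE s k x y :
  eqs (size s + k) (prepend s x) (prepend s y) <-> eqs k x y.
Proof.
split=> [E i ik|]; last exact: eqs_prepend.
have := E (size s + i)%N; rewrite ltn_add2l => /(_ ik).
by rewrite !prependE (leq_gtF (leq_addr _ _)) addKn.
Qed.

Lemma slt_prepend s x y : slt (prepend s x) (prepend s y) <-> slt x y.
Proof.
split=> [[i [E L]]|[i [E L]]].
  have si : (size s <= i)%N.
    by rewrite leqNgt; apply/negP => h; move: L; rewrite /dig !prependE h ltnn.
  exists (i - size s)%N; split; last by move: L; rewrite /dig !prependE (leq_gtF si).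
  by apply/(eqs_prependE s); rewrite subnKC.
exists (size s + i)%N; split; first exact: eqs_prepend.
by rewrite /dig !prependE (leq_gtF (leq_addr _ _)) addKn.
Qed.

Definition incone s x := exists z, x = prepend s z.

Lemma inconeP s x : incone s x <-> stake (size s) x = s.
Proof.
split=> [[z ->]|E]; first exact: stake_prepend.
by exists (sdrop (size s) x); rewrite -{1}(prepend_stake (size s) x) E.
Qed.

Lemma incone_prepend s x : incone s (prepend s x). Proof. by exists x. Qed.

Lemma incone_stake k x : incone (stake k x) x.
Proof. by exists (sdrop k x); rewrite prepend_stake. Qed.

Lemma eqs_incone k s x y : (size s <= k)%N -> eqs k x y -> incone s x -> incone s y.
Proof.
move=> sk /(eqs_le sk) /eqs_stake E /inconeP H; apply/inconeP.
by rewrite -E.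
Qed.

(** The letter that decides the comparison with an outside point lies within [s], so it is the same
    for all points of the cone. *)
Lemma cone_lt s x x' y : slt (prepend s x) y -> ~ incone s y -> slt (prepend s x') y.
Proof.
move=> [i [E L]] H; have si : (i < size s)%N.
  rewrite ltnNge; apply/negP => si; apply: H.
  exact: (eqs_incone si E (incone_prepend _ _)).
exists i; split; last by rewrite /dig prependE si; move: L; rewrite /dig prependE si.
move=> j ji; rewrite -(E j ji) !prependE.
by rewrite (ltn_trans ji si).
Qed.

Lemma cone_gt s x x' y : slt y (prepend s x) -> ~ incone s y -> slt y (prepend s x').
Proof.
move=> [i [E L]] H; have si : (i < size s)%N.
  rewrite ltnNge; apply/negP => si; apply: H.
  exact: (eqs_incone si (eqs_sym E) (incone_prepend _ _)).
exists i; split; last by rewrite /dig prependE si; move: L; rewrite /dig prependE si.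
move=> j ji; rewrite (E j ji) !prependE.
by rewrite (ltn_trans ji si).
Qed.

Lemma lexi_slt (s t : seqlexi D) x y : (s < t)%O -> (forall p : seq D, t <> s ++ p) ->
  slt (prepend s x) (prepend t y).
Proof.
elim: s t => [|c s IH] [|d t] //=; first by move=> _ /(_ (d :: t)).
rewrite ltxi_cons => /andP[cd /implyP dcP] H.
have [dc|dc] := leP d c; last by exists 0.
have E : c = d by apply: (@le_anti _ _ c d); rewrite cd dc.
subst d; rewrite -[scons c _]/(prepend [:: c] _) -[scons c (prepend t y)]/(prepend [:: c] _).
apply/slt_prepend; apply: IH => [|z tz]; first exact: dcP.
by apply: (H z); rewrite tz.
Qed.

End Streams.

(** * Points of the Cantor space: cyclic order, compactness, prefix replacement *)

Section Points.

Variables n r : nat.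
Local Notation D := 'I_n.+2.
Local Notation Y := (cantor_seq n.+2).
Local Notation X := (cantor n.+2 r.+1).
Local Notation W := (word n.+2 r.+1).
Implicit Types (x y z : X) (u v w : W).

Definition xlt x y := ((x.1 : 'I_r.+1) < (y.1 : 'I_r.+1))%N \/ (x.1 = y.1 /\ slt x.2 y.2).

Lemma xlt_irr x : ~ xlt x x.
Proof. by case=> [|[_ /slt_irr]]; rewrite ?ltnn. Qed.

Lemma xlt_trans y x z : xlt x y -> xlt y z -> xlt x z.
Proof.
move=> [xy|[xy xy']] [yz|[yz yz']].
- by left; exact: ltn_trans xy yz.
- by left; rewrite -yz.
- by left; rewrite xy.
- by right; split; [rewrite xy|exact: slt_trans yz'].
Qed.

Lemma xlt_asym x y : xlt x y -> ~ xlt y x.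
Proof. by move=> xy yx; apply: (@xlt_irr x); apply: xlt_trans xy yx. Qed.

Lemma xlt_total x y : x <> y -> xlt x y \/ xlt y x.
Proof.
case: x y => [a x] [b y] xy.
have [ab|ba|/val_inj ab] := ltngtP (a : 'I_r.+1) (b : 'I_r.+1).
- by left; left.
- by right; left.
- subst b; have /slt_total[] : x <> y by move=> E; apply: xy; rewrite E.
  + by left; right.
  + by right; right.
Qed.

Definition pre k x : W := (x.1, stake k x.2).

Lemma wcat_pre k x : wcat (pre k x) (sdrop k x.2) = x.
Proof. by case: x => a x; rewrite /wcat /= prepend_stake. Qed.

Lemma wprefix_pre k x : wprefix (pre k x) x.
Proof. by exists (sdrop k x.2); rewrite wcat_pre. Qed.

Lemma wprefixP w x : wprefix w x <-> w = pre (size w.2) x.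
Proof.
split=> [[z ->]|->]; last exact: wprefix_pre.
by case: w => a s; rewrite /pre /= stake_prepend.
Qed.

Lemma wprefix_wcat w (z : Y) : wprefix w (wcat w z). Proof. by exists z. Qed.

Lemma pre_eqx k x y : eqx k x y <-> pre k x = pre k y.
Proof.
by split=> [[E /eqs_stake F]|[E /eqs_stake F]] //; rewrite /pre E F.
Qed.

Lemma eqx_le k l x y : (k <= l)%N -> eqx l x y -> eqx k x y.
Proof. by move=> kl [E F]; split=> //; apply: eqs_le F. Qed.

Lemma neq_eqx x y : x <> y -> exists m, ~ eqx m x y.
Proof.
move=> xy; apply: contrapT => H; apply: xy; have F m : eqx m x y.
  by apply: contrapT => H'; apply: H; exists m.
case: x y F {H} => c a [d b] F; have [/= -> _] := F 0%N; congr pair.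
by apply: eqs_eq => m; have [_] := F m.
Qed.

Lemma wcat_inj w : injective (wcat w : Y -> X).
Proof. by move=> x y [/prepend_inj]. Qed.

Lemma xlt_wcat w (x y : Y) : xlt (wcat w x) (wcat w y) <-> slt x y.
Proof.
split=> [[|[_ /slt_prepend //]]|xy]; first by rewrite ltnn.
by right; split=> //; apply/slt_prepend.
Qed.

Lemma xcone_lt w (a a' : Y) y : xlt (wcat w a) y -> ~ wprefix w y -> xlt (wcat w a') y.
Proof.
move=> [L|[E L]] H; first by left.
right; split=> //; apply: cone_lt L _ => -[z zE]; apply: H; exists z.
by case: y E zE => b y /= <- ->.
Qed.

Lemma xcone_gt w (a a' : Y) y : xlt y (wcat w a) -> ~ wprefix w y -> xlt y (wcat w a').
Proof.
move=> [L|[E L]] H; first by left.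
right; split=> //; apply: cone_gt L _ => -[z zE]; apply: H; exists z.
by case: y E zE => b y /= -> ->.
Qed.

Definition disj u v := forall (a b : Y), wcat u a <> wcat v b.

Lemma disjC u v : disj u v -> disj v u.
Proof. by move=> H a b /esym; exact: H. Qed.

Lemma disjN u v (a : Y) : disj u v -> ~ wprefix u (wcat v a).
Proof. by move=> H [b /esym]; exact: H. Qed.

Let z0 : Y := fun _ => ord0.

Lemma wlt_xlt u v (a b : Y) : (u < v)%O -> disj u v -> xlt (wcat u a) (wcat v b).
Proof.
case: u v => c s [d t] /=; rewrite ltEprodlexi /= => /andP[cd /implyP dc] H.
have [E|/eqP cd'] := @eqVneq _ c d; last first.
  left=> /=; rewrite ltn_neqAle; apply/andP; split; last by rewrite leEord in cd.
  by apply/eqP => /val_inj.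
subst d; right; split=> //; apply: lexi_slt => [|z tz]; first exact: dc.
by apply: (H (prepend z z0) z0); rewrite /= in tz; rewrite /wcat /= tz prepend_cat.
Qed.

Lemma xlt_wlt u v (a b : Y) : disj u v -> xlt (wcat u a) (wcat v b) -> (u < v)%O.
Proof.
move=> uv L; have [//|vu|E] := ltgtP u v.
  by case: (xlt_asym L); apply: wlt_xlt => //; apply: disjC.
by subst v; case: (uv z0 z0).
Qed.

Lemma complete_disj (A : seq W) u v : complete_antichain A ->
  u \in A -> v \in A -> u <> v -> disj u v.
Proof.
move=> cA uA vA uv a b E; apply: uv.
have [w [_ wP]] := cA (wcat u a).
by rewrite -(wP u) -1?(wP v) //; split=> //; [rewrite E|]; exact: wprefix_wcat.
Qed.

Lemma pre_disj u v : size u.2 = size v.2 -> u <> v -> disj u v.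
Proof.
move=> E uv a b F; apply: uv.
have /wprefixP -> := wprefix_wcat u a; have /wprefixP -> := wprefix_wcat v b.
by rewrite E F.
Qed.

Definition cyc x y z :=
  (xlt x y /\ xlt y z) \/ (xlt y z /\ xlt z x) \/ (xlt z x /\ xlt x y).

Lemma cyc_rot x y z : cyc x y z -> cyc y z x.
Proof. by rewrite /cyc; tauto. Qed.

Lemma cyc_total x y z : x <> y -> y <> z -> x <> z -> cyc x y z \/ cyc z y x.
Proof.
move=> /xlt_total xy /xlt_total yz /xlt_total xz; rewrite /cyc.
by case: xy; case: yz; case: xz; tauto.
Qed.

Lemma cyc_asym x y z : cyc x y z -> ~ cyc z y x.
Proof.
by rewrite /cyc => -[[]|[[]|[]]] A B [[]|[[]|[]]] C E;
  do ?[by case: (xlt_asym A C)|by case: (xlt_asym A E)|by case: (xlt_asym B C)|by case: (xlt_asym B E)].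
Qed.

Lemma cyc_neq x y z : cyc x y z -> x <> y /\ y <> z /\ x <> z.
Proof.
have N a b c : xlt a b -> xlt b c -> a <> b /\ b <> c /\ a <> c.
  move=> ab bc; have ac := xlt_trans ab bc.
  by split; [|split] => E; subst; [case: (xlt_irr ab)|case: (xlt_irr bc)|case: (xlt_irr ac)].
move=> [[/N /[apply]]|[[/N /[apply]]|[/N /[apply]]]] [A [B C]];
  by split; [|split]; congruence.
Qed.

Definition cycp (f : X -> X) := forall x y z, cyc x y z -> cyc (f x) (f y) (f z).
Definition monox (f : X -> X) := forall x y, xlt x y -> xlt (f x) (f y).

Lemma monox_cycp f : monox f -> cycp f.
Proof.
move=> m x y z; rewrite /cyc => -[[]|[[]|[]]] A B;
  by have := m _ _ A; have := m _ _ B; tauto.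
Qed.

(** The shape of a rotation: [f] is increasing on an initial segment and on the rest, and exchanges
    the order of these two parts. *)
Lemma cut_cycp (P : X -> Prop) (f : X -> X) :
  (forall x y, xlt x y -> P y -> P x) ->
  (forall x y, xlt x y -> (P x <-> P y) -> xlt (f x) (f y)) ->
  (forall x y, P x -> ~ P y -> xlt (f y) (f x)) -> cycp f.
Proof.
move=> dP m1 m2.
have N a b c : xlt a b -> xlt b c -> cyc (f a) (f b) (f c).
  move=> ab bc; have := dP _ _ ab; have := dP _ _ bc.
  have := m1 _ _ ab; have := m1 _ _ bc; have := m2 a c; have := m2 a b; have := m2 b c.
  rewrite /cyc; have [] := pselect (P a); have [] := pselect (P b);
  have [] := pselect (P c); tauto.
move=> x y z [[xy yz]|[[yz zx]|[zx xy]]].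
- exact: N.
- by apply/cyc_rot/cyc_rot; apply: N.
- by apply: cyc_rot; apply: N.
Qed.

(** Compactness as in König's lemma: a word whose cone meets every [M k] has a one-letter extension
    with the same property, and the resulting branch lies in every [M k] because these sets are
    closed. *)
Lemma compactx (M : nat -> X -> Prop) :
  (forall k x, M k.+1 x -> M k x) -> (forall k, exists x, M k x) ->
  (forall k x, (forall m, exists y, eqx m x y /\ M k y) -> M k x) ->
  exists x, forall k, M k x.
Proof.
move=> dM nM cM.
have dM' k l x : (k <= l)%N -> M l x -> M k x.
  by move=> /subnK <-; elim: (l - k)%N => // m IH; rewrite addSn => /dM.
pose good w := forall k, exists x, wprefix w x /\ M k x.
have max (I : finType) (Q : I -> nat -> Prop) : (forall i, exists k, Q i k) ->
    exists K : nat, forall i, exists k, Q i k /\ (k <= K)%N.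
  move=> /choice[k kQ]; exists (\max_i k i)%N => i.
  by exists (k i); split=> //; apply: leq_bigmax.
have [a ga] : exists a, good (a, [::]).
  apply: contrapT => H.
  have /max[K HK] : forall a : 'I_r.+1, exists k, forall x, wprefix (a, [::]) x -> ~ M k x.
    move=> a; apply: contrapT => H'; apply: H; exists a => k.
    apply: contrapT => H''; apply: H'; exists k => x xa Mx; apply: H''.
    by exists x.
  have [x Mx] := nM K; have [k [kH kK]] := HK x.1.
  apply: (kH x); last exact: dM' Mx.
  by exists x.2; case: (x).
have step w : exists j, good w -> good (wext w [:: j]).
  have [gw|] := pselect (good w); last by exists ord0.
  apply: contrapT => H.
  have /max[K HK] : forall j : D, exists k, forall x, wprefix (wext w [:: j]) x -> ~ M k x.
    move=> j; apply: contrapT => H'; apply: H; exists j => _ k.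
    apply: contrapT => H''; apply: H'; exists k => x xa Mx; apply: H''.
    by exists x.
  have [x [[y ->] Mx]] := gw K; have [k [kH kK]] := HK (y 0).
  apply: (kH (wcat w y)); last exact: dM' Mx.
  exists (sdrop 1 y); rewrite wcat_ext; congr wcat.
  by apply/funext => -[|i].
have [next nextP] := choice step.
pose ws := fix ws k := if k is k'.+1 then rcons (ws k') (next (a, ws k')) else [::].
pose y : Y := fun i => next (a, ws i).
have yE k : stake k y = ws k.
  by elim: k => //= k IH; rewrite /stake mkseqS -/(stake k y) IH.
have gk k : good (a, ws k).
  elim: k => //= k IH; rewrite -cats1; exact: (nextP (a, ws k)).
exists (a, y) => k; apply: cM => m.
have [x [/wprefixP px Mx]] := gk m k; exists x; split=> //.
by apply/pre_eqx; rewrite {1}/pre /= yE px /= -yE size_stake.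
Qed.

Definition ploc_at (f : X -> X) x := exists u v,
  wprefix u x /\ forall a, f (wcat u a) = wcat v a.

Definition ploc f := forall x, ploc_at f x.

Lemma wcat_wext w s (a : Y) : wcat (wext w s) a = wcat w (prepend s a) :> X.
Proof. exact: wcat_ext. Qed.

(** Otherwise the points at which depth [k] does not suffice form decreasing nonempty closed sets,
    and a common point contradicts local prefix replacement there. *)
Lemma ploc_unif f : ploc f -> exists k, forall w, size w.2 = k ->
  exists v, forall a, f (wcat w a) = wcat v a.
Proof.
move=> lf; apply: contrapT => H.
pose M k x := ~ exists v, forall a, f (wcat (pre k x) a) = wcat v a.
have [x xM] : exists x, forall k, M k x.
  apply: compactx => [k x|k|k x].
  - move=> H1 [v vP]; apply: H1; exists (wext v (stake 1 (sdrop k x.2))) => a.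
    have -> : pre k.+1 x = wext (pre k x) (stake 1 (sdrop k x.2)).
      by rewrite /pre /wext /= -stakeD addn1.
    by rewrite !wcat_wext vP.
  - apply: contrapT => H'; apply: H; exists k => w kw.
    apply: contrapT => H''; apply: H'; exists (wcat w (fun _ => ord0)).
    rewrite /M -kw.
    by have /wprefixP <- := wprefix_wcat w (fun _ => ord0).
  - by move=> /(_ k) [y [/pre_eqx E]]; rewrite /M -E.
have [u [v [/wprefixP uE uv]]] := lf x.
by apply: (xM (size u.2)); exists v; rewrite -uE.
Qed.

Lemma ploc_cont f : ploc f -> continuous f.
Proof.
move=> lf; apply/continuousP_eqx => x m.
have [u [v [/wprefixP uE uv]]] := lf x.
exists (size u.2 + m)%N => y E.
have /pre_eqx E1 := eqx_le (leq_addr m _) E.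
have {}E1 : u = pre (size u.2) y by rewrite -E1 -uE.
have xE : x = wcat u (sdrop (size u.2) x.2) by rewrite -[LHS](wcat_pre (size u.2)) -uE.
have yE : y = wcat u (sdrop (size u.2) y.2) by rewrite -[LHS](wcat_pre (size u.2)) -E1.
rewrite xE yE !uv; split=> //=; apply: eqs_le (leq_addl _ _) _.
apply: eqs_prepend => i im; apply: (proj2 E).
by rewrite ltn_add2l.
Qed.

Lemma ploc_at_comp f g x : ploc_at f x -> ploc_at g (f x) -> ploc_at (g \o f) x.
Proof.
move=> [u [v [[a xE] uv]]] [u' [v' [[a' xE'] uv']]].
have E : wcat v a = wcat u' a' by rewrite -uv -xE.
have [[p pE]|[p pE]] := wcat_comp E.
  subst u'; move: E; rewrite wcat_wext => /wcat_inj aE.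
  exists (wext u p), v'; split=> [|b] /=; first by exists a'; rewrite wcat_wext xE aE.
  by rewrite wcat_wext uv -wcat_wext uv'.
exists u, (wext v' p); split=> [|b] /=; first by exists a.
by rewrite uv pE !wcat_wext uv'.
Qed.

Lemma ploc_comp f g : ploc f -> ploc g -> ploc (g \o f).
Proof. by move=> lf lg x; apply: ploc_at_comp. Qed.

End Points.

(** * Monotone local stream maps *)

Section StreamMaps.

Variable n : nat.
Local Notation D := 'I_n.+2.
Local Notation Y := (cantor_seq n.+2).
Implicit Types (x y z : Y) (s t : seq D) (f g : Y -> Y).

Definition smono f := forall x y, slt x y -> slt (f x) (f y).
Definition sploc f := forall x, exists s t,
  incone s x /\ forall a, f (prepend s a) = prepend t a.

Lemma scons_eta x : scons (x 0) (sdrop 1 x) = x.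
Proof. by apply/funext => -[|i]. Qed.

Lemma slt_scons (c d : D) x y :
  slt (scons c x) (scons d y) <-> (c < d)%N \/ (c = d /\ slt x y).
Proof.
split=> [[[|i] [E L]]|[cd|[<- xy]]].
- by left.
- right; split; first exact: (E 0).
  by exists i; split=> // j ji; apply: (E j.+1).
- by exists 0.
- exact/(slt_prepend [:: c]).
Qed.

Lemma smono_can f g : cancel f g -> cancel g f -> smono f -> smono g.
Proof.
move=> fK gK m x y xy.
have [E|/slt_total[//|yx]] := pselect (g x = g y).
  by move: xy; rewrite -(gK x) E gK => /slt_irr.
by case: (slt_asym xy); rewrite -(gK x) -(gK y); apply: m.
Qed.

Definition lo : Y := fun _ => ord0.
Definition hi : Y := fun _ => ord_max.

Lemma lo_min x : x <> lo -> slt lo x.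
Proof.
move=> /slt_total[|//] [i [_]]; by rewrite /dig /= ltn0.
Qed.

Lemma hi_max x : x <> hi -> slt x hi.
Proof.
move=> /slt_total[//|] [i [_]]; rewrite /dig /= => L.
by have := ltn_ord (x i : D); rewrite ltnS leqNgt L.
Qed.

Lemma slt_hicons x : x <> hi -> slt x (scons ord_max x).
Proof.
move=> /neq_first[i [E F]]; exists i; split.
  move=> [|j] ji; first exact: E.
  by rewrite E // /= E // ltnW.
have -> : dig (scons ord_max x) i = n.+1.
  by case: i E F => [|i] E F //; rewrite /dig /= E.
rewrite /dig ltn_neqAle -ltnS ltn_ord andbT; apply/eqP => G; apply: F.
exact: val_inj.
Qed.

Lemma slt_locons x : x <> lo -> slt (scons ord0 x) x.
Proof.
move=> /neq_first[i [E F]]; exists i; split.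
  move=> [|j] ji; first by rewrite E.
  by rewrite [RHS]E //= E // ltnW.
have -> : dig (scons ord0 x) i = 0.
  by case: i E F => [|i] E F //; rewrite /dig /= E.
rewrite /dig lt0n; apply/eqP => G; apply: F.
exact: val_inj.
Qed.

(* Fixes both ends and pushes every other stream up. *)
Definition Amap y : Y :=
  if (y 0 : D) != ord0 then scons ord_max y
  else if (y 1 : D) == ord_max then scons ord_max (scons ord0 (sdrop 2 y))
  else sdrop 1 y.

Definition Ainv y : Y :=
  if (y 0 : D) != ord_max then scons ord0 y
  else if (y 1 : D) == ord0 then scons ord0 (scons ord_max (sdrop 2 y))
  else sdrop 1 y.

Lemma eta2 y : scons (y 0) (scons (y 1) (sdrop 2 y)) = y.
Proof. by apply/funext => -[|[|i]]. Qed.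

Lemma eta12 y : scons (y 1) (sdrop 2 y) = sdrop 1 y.
Proof. by apply/funext => -[|i]. Qed.

Lemma sdrop_scons (c : D) y : sdrop 1 (scons c y) = y.
Proof. by apply/funext. Qed.

Lemma sdrop_scons2 (c d : D) y : sdrop 2 (scons c (scons d y)) = y.
Proof. by apply/funext. Qed.

Lemma eta1 (c : D) y : (y 0 : D) = c -> scons c (sdrop 1 y) = y.
Proof. by move=> <-; exact: scons_eta. Qed.

Lemma AmapK : cancel Amap Ainv.
Proof.
move=> y; rewrite -[RHS]eta2 /Amap /Ainv.
have [y0|/= y0] := eqVneq (y 0 : D) ord0; last first.
  by rewrite /= eqxx /= (negbTE y0) sdrop_scons eta2.
rewrite /= y0; have [y1|/= y1] := eqVneq (y 1 : D) ord_max.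
  by rewrite /= eqxx sdrop_scons2 y1.
by rewrite /sdrop /= y1; congr scons; apply/funext => -[|i].
Qed.

Lemma AinvK : cancel Ainv Amap.
Proof.
move=> y; rewrite -[RHS]eta2 /Amap /Ainv.
have [y0|/= y0] := eqVneq (y 0 : D) ord_max; last first.
  by rewrite /= (negbTE y0) sdrop_scons eta2.
rewrite /= y0; have [y1|/= y1] := eqVneq (y 1 : D) ord0.
  by rewrite /= eqxx sdrop_scons2 y1.
by rewrite /sdrop /= y1; congr scons; apply/funext => -[|i].
Qed.

Lemma ltn_max (c : D) : c != ord_max -> (c < n.+1)%N.
Proof.
move=> H; rewrite ltn_neqAle -ltnS ltn_ord andbT.
by apply/eqP => E; case/eqP: H; apply: val_inj.
Qed.

Lemma gtn0 (c : D) : c != ord0 -> (0 < c)%N.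
Proof. by move=> H; rewrite lt0n. Qed.

Lemma Amap_mono : smono Amap.
Proof.
move=> x y; rewrite -{1}(eta2 x) -{1}(eta2 y) => xy; rewrite /Amap.
have [x0|/= x0] := eqVneq (x 0 : D) ord0;
have [y0|/= y0] := eqVneq (y 0 : D) ord0; rewrite /= ?x0 ?y0 in xy *.
- move/slt_scons: xy => [//|[_ xy]].
  have [x1|/= x1] := eqVneq (x 1 : D) ord_max;
  have [y1|/= y1] := eqVneq (y 1 : D) ord_max; rewrite ?x1 ?y1 in xy *.
  + move/slt_scons: xy => [|[_ xy]]; first by rewrite ltnn.
    by do 2![apply/slt_scons; right; split=> //].
  + move/slt_scons: xy => [|[E xy]]; last by rewrite E eqxx in y1.
    by rewrite ltnNge -ltnS ltn_ord.
  + by exists 0; split=> //; exact: ltn_max.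
  + rewrite -(scons_eta (sdrop 1 x)) -(scons_eta (sdrop 1 y)).
    by rewrite !sdropD.
- have [x1|/= x1] := eqVneq (x 1 : D) ord_max.
    apply/slt_scons; right; split=> //.
    by exists 0; split=> //; exact: gtn0.
  by exists 0; split=> //; exact: ltn_max.
- by move/slt_scons: xy => [|[E]]; rewrite ?ltn0 // E eqxx in x0.
- by apply/slt_scons; right; split=> //; move: xy; rewrite !eta2.
Qed.

Lemma Amap_up y : y <> lo -> y <> hi -> slt y (Amap y).
Proof.
move=> ylo yhi; rewrite /Amap.
have [y0|/= y0] := eqVneq (y 0 : D) ord0; last exact: slt_hicons.
rewrite /=; have [y1|/= y1] := eqVneq (y 1 : D) ord_max.
  by exists 0; split=> //; rewrite /dig y0.
rewrite -{1}(eta1 y0); apply: slt_locons => E; apply: ylo.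
rewrite -(eta1 y0) E; by apply/funext => -[|i].
Qed.

Lemma sploc_cases f k : (forall s, size s = k -> exists t, forall a, f (prepend s a) = prepend t a) ->
  sploc f.
Proof.
move=> H x; have [t tP] := H (stake k x) (size_stake k x).
by exists (stake k x), t; split=> //; exact: incone_stake.
Qed.

Lemma sploc2 f : (forall c d : D, exists t, forall a, f (scons c (scons d a)) = prepend t a) ->
  sploc f.
Proof.
by move=> H; apply: (@sploc_cases _ 2) => -[|c [|d [|e s]]] //= _.
Qed.

Lemma Amap_loc : sploc Amap.
Proof.
apply: sploc2 => c d; rewrite /Amap /=.
case: eqP => _ /=; last by exists [:: ord_max; c; d].
by case: eqP => _; [exists [:: ord_max; ord0]|exists [:: d]] => a; rewrite ?sdrop_scons2 ?sdrop_scons.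
Qed.

Lemma Ainv_loc : sploc Ainv.
Proof.
apply: sploc2 => c d; rewrite /Ainv /=.
case: eqP => _ /=; last by exists [:: ord0; c; d].
by case: eqP => _; [exists [:: ord0; ord_max]|exists [:: d]] => a; rewrite ?sdrop_scons2 ?sdrop_scons.
Qed.

Definition o1 : D := inord 1.
Lemma val_o1 : o1 = 1 :> nat. Proof. exact: inordK. Qed.
Lemma o1_gt0 : (0 < o1)%N. Proof. by rewrite val_o1. Qed.
Lemma o1_neq0 : o1 != ord0. Proof. by rewrite -(inj_eq val_inj) /= val_o1. Qed.

(** The prefix replacements [00 -> 0], [0c -> 1(c-1)] for [c > 0], and [1 -> 1 max]; other letters
    are left alone. It serves to compare a cone with its first and last subcones, and to cross the
    border from the cone of 0 to that of 1 through [01 -> 10]. *)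
Definition Cmap y : Y :=
  if (y 0 : D) == ord0 then
    if (y 1 : D) == ord0 then sdrop 1 y
    else scons o1 (scons (inord (y 1 : D).-1) (sdrop 2 y))
  else if (y 0 : D) == o1 then scons o1 (scons ord_max (sdrop 1 y)) else y.

Definition Cinv y : Y :=
  if (y 0 : D) == ord0 then scons ord0 y
  else if (y 0 : D) == o1 then
    if (y 1 : D) == ord_max then scons o1 (sdrop 2 y)
    else scons ord0 (scons (inord (y 1 : D).+1) (sdrop 2 y))
  else y.

Lemma inord_pred (c : D) : (inord c.-1 : D) = c.-1 :> nat.
Proof. by rewrite inordK // (leq_ltn_trans (leq_pred _) (ltn_ord _)). Qed.

Lemma inord_succ (c : D) : c != ord_max -> (inord c.+1 : D) = c.+1 :> nat.
Proof. by move=> /ltn_max H; rewrite inordK. Qed.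

Lemma CmapK : cancel Cmap Cinv.
Proof.
move=> y; rewrite -[RHS]eta2 /Cmap /Cinv.
have [y0|/= y0] := eqVneq (y 0 : D) ord0.
  have [y1|/= y1] := eqVneq (y 1 : D) ord0.
    rewrite /sdrop /= y1 eqxx y0; congr scons; apply/funext => -[|i] //.
  rewrite /= (negbTE o1_neq0) eqxx; have E := inord_pred (y 1).
  have H : (inord (y 1 : D).-1 : D) != ord_max.
    by rewrite -(inj_eq val_inj) /= E; have := ltn_ord (y 1 : D); have := gtn0 y1; lia.
  rewrite (negbTE H) sdrop_scons2 y0; congr (scons _ (scons _ _)).
  by apply: val_inj; rewrite /= inord_succ // E prednK // gtn0.
have [y1|/= y1] := eqVneq (y 0 : D) o1.
  rewrite /= (negbTE o1_neq0) !eqxx sdrop_scons2 y1; congr scons.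
  by apply/funext => -[|i].
by rewrite (negbTE y0) (negbTE y1) eta2.
Qed.

Lemma CinvK : cancel Cinv Cmap.
Proof.
move=> y; rewrite -[RHS]eta2 /Cmap /Cinv.
have [y0|/= y0] := eqVneq (y 0 : D) ord0.
  by rewrite /= y0 eqxx sdrop_scons -y0 eta2.
have [y1|/= y1] := eqVneq (y 0 : D) o1; last first.
  by rewrite (negbTE y0) (negbTE y1) eta2.
have [y2|/= y2] := eqVneq (y 1 : D) ord_max.
  by rewrite /= (negbTE o1_neq0) eqxx sdrop_scons y1 y2.
have E := inord_succ y2.
have H : (inord (y 1 : D).+1 : D) != ord0 by rewrite -(inj_eq val_inj) /= E.
rewrite /= (negbTE H) sdrop_scons2 y1; congr (scons _ (scons _ _)).
by apply: val_inj; rewrite /= inord_pred E.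
Qed.

Lemma Cmap_mono : smono Cmap.
Proof.
move=> x y; rewrite -{1}(eta2 x) -{1}(eta2 y) => xy; rewrite /Cmap.
have [x0|/= x0] := eqVneq (x 0 : D) ord0;
have [y0|/= y0] := eqVneq (y 0 : D) ord0; rewrite /= ?x0 ?y0 in xy *.
- move/slt_scons: xy => [//|[_ xy]].
  have [x1|/= x1] := eqVneq (x 1 : D) ord0;
  have [y1|/= y1] := eqVneq (y 1 : D) ord0; rewrite ?x1 ?y1 in xy *.
  + rewrite -(scons_eta (sdrop 1 x)) -(scons_eta (sdrop 1 y)) !sdropD.
    rewrite [sdrop 1 x 0]x1 [sdrop 1 y 0]y1 //.
  + by exists 0; split=> //; have -> : dig (sdrop 1 x) 0 = 0; [exact: (congr1 val x1)|exact: o1_gt0].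
  + by move/slt_scons: xy => [|[E]]; rewrite ?ltn0 // E eqxx in x1.
  + apply/slt_scons; right; split=> //; apply/slt_scons.
    move/slt_scons: xy => [L|[-> xy]]; [left|by right].
    by rewrite !inord_pred; have := gtn0 x1; lia.
- have [y1|/= y1] := eqVneq (y 0 : D) o1.
    have [x1|/= x1] := eqVneq (x 1 : D) ord0.
      by exists 0; split=> //; have -> : dig (sdrop 1 x) 0 = 0; [exact: (congr1 val x1)|exact: o1_gt0].
    apply/slt_scons; right; split=> //; apply/slt_scons; left.
    by rewrite inord_pred /=; have := gtn0 x1; have := ltn_ord (x 1 : D); lia.
  have y2 : (1 < (y 0 : D))%N.
    have := gtn0 y0; rewrite leq_eqVlt => /orP[/eqP E|//].
    by case/eqP: y1; apply: val_inj; rewrite /= val_o1.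
  case: eqP => x1; last by exists 0; split=> //; have -> : dig (scons o1 (scons (inord (x 1 : D).-1) (sdrop 2 x))) 0 = 1; [exact: val_o1|].
  by exists 0; split=> //; have -> : dig (sdrop 1 x) 0 = 0; [exact: (congr1 val x1)|exact: gtn0].
- by move/slt_scons: xy => [|[E]]; rewrite ?ltn0 // E eqxx in x0.
- have [x1|/= x1] := eqVneq (x 0 : D) o1; have [y1|/= y1] := eqVneq (y 0 : D) o1.
  + do 2![apply/slt_scons; right; split=> //].
    move/slt_scons: xy; rewrite x1 y1 ltnn => -[//|[_]].
    by rewrite !eta12.
  + move/slt_scons: xy; rewrite x1 => -[L|[E _]]; last by rewrite -E eqxx in y1.
    by exists 0.
  + move/slt_scons: xy; rewrite y1 => -[L|[E _]]; last by rewrite E eqxx in x1.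
    by exists 0.
  + by move: xy; rewrite !eta2.
Qed.

Lemma Cmap_loc : sploc Cmap.
Proof.
apply: sploc2 => c d; rewrite /Cmap /=.
case: eqP => _ /=; last case: eqP => _.
- case: eqP => _; [exists [:: d]|exists [:: o1; inord d.-1]] => a; by rewrite ?sdrop_scons2 ?sdrop_scons.
- by exists [:: o1; ord_max; d].
- by exists [:: c; d].
Qed.

Lemma Cinv_loc : sploc Cinv.
Proof.
apply: sploc2 => c d; rewrite /Cinv /=.
case: eqP => _ /=; last case: eqP => _.
- by exists [:: ord0; c; d].
- case: eqP => _; [exists [:: o1]|exists [:: ord0; inord d.+1]] => a; by rewrite ?sdrop_scons2 ?sdrop_scons.
- by exists [:: c; d].
Qed.

Definition Ats s f y : Y :=
  if stake (size s) y == s then prepend s (f (sdrop (size s) y)) else y.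

Lemma AtsE s f a : Ats s f (prepend s a) = prepend s (f a).
Proof. by rewrite /Ats stake_prepend eqxx sdrop_prepend. Qed.

Lemma Ats_out s f y : ~ incone s y -> Ats s f y = y.
Proof. by rewrite /Ats; case: eqP => // /inconeP. Qed.

Lemma AtsK s f g : cancel f g -> cancel (Ats s f) (Ats s g).
Proof.
move=> fK y; have [[a ->]|H] := pselect (incone s y).
  by rewrite !AtsE fK.
by rewrite !Ats_out.
Qed.

Lemma Ats_mono s f : smono f -> smono (Ats s f).
Proof.
move=> m x y; have [[a ->]|xs] := pselect (incone s x);
have [[b ->]|ys] := pselect (incone s y); rewrite ?AtsE ?(Ats_out _ xs) ?(Ats_out _ ys) //.
- by move=> /slt_prepend ab; apply/slt_prepend; exact: m.
- by move=> /cone_lt; exact.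
- by move=> /cone_gt; exact.
Qed.

Lemma Ats_loc s f : sploc f -> sploc (Ats s f).
Proof.
move=> lf x; have [[a ->]|xs] := pselect (incone s x).
  have [p [q [[b ->] pq]]] := lf a.
  exists (s ++ p), (s ++ q); split; first by exists b; rewrite prepend_cat.
  by move=> c; rewrite !prepend_cat AtsE pq.
exists (stake (size s) x), (stake (size s) x); split; first exact: incone_stake.
move=> a; rewrite Ats_out // => /inconeP; rewrite -{1}(size_stake (size s) x) stake_prepend.
by move=> E; apply: xs; apply/inconeP.
Qed.

End StreamMaps.

Section Extremes.

Variables n r : nat.
Local Notation X := (cantor n.+2 r.+1).
Implicit Types x : X.

Definition xmin : X := (ord0, @lo n).

Lemma xmin_lt x : x <> xmin -> xlt xmin x.
Proof.
case: x => d p H; have [d0|d0] := eqVneq d (ord0 : 'I_r.+1).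
  subst d; right; split=> //; apply: lo_min => F; apply: H.
  by move: F => /= ->.
by left; rewrite /= lt0n.
Qed.

Lemma xmin_min x : ~ xlt x xmin.
Proof.
have [-> /xlt_irr //|/xmin_lt H /(xlt_asym H)] := pselect (x = xmin).
exact.
Qed.

Definition xmax : X := (ord_max, @hi n).

Lemma xmax_gt x : x <> xmax -> xlt x xmax.
Proof.
case: x => d p H; have [d0|d0] := eqVneq d (ord_max : 'I_r.+1).
  subst d; right; split=> //; apply: hi_max => F; apply: H.
  by move: F => /= ->.
left; rewrite /= ltn_neqAle -ltnS ltn_ord andbT; apply/eqP => F.
by case/eqP: d0; apply: val_inj.
Qed.

Lemma xmax_max x : ~ xlt xmax x.
Proof. by have [->|/xmax_gt L] := pselect (x = xmax); [exact: xlt_irr|exact: xlt_asym]. Qed.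

End Extremes.

(** * Elements of T *)

Section Homeos.

Variables n r : nat.
Local Notation D := 'I_n.+2.
Local Notation Y := (cantor_seq n.+2).
Local Notation X := (cantor n.+2 r.+1).
Local Notation W := (word n.+2 r.+1).
Local Notation inT := (@is_HigmanThompsonT n.+2 r.+1).
Local Notation hom := (homeo X).
Implicit Types (x y z : X) (u v w : W) (g h : hom).

Local Open Scope group_scope.

Lemma hmulE g h x : (g * h) x = h (g x). Proof. by []. Qed.
Lemma hmulK g x : g^-1 (g x) = x. Proof. exact: homeo_funK. Qed.
Lemma hmulVK g x : g (g^-1 x) = x. Proof. exact: homeo_invK. Qed.
Lemma hinj g : injective g. Proof. exact: can_inj (hmulK g). Qed.

Lemma hconjE g h x : (g ^ h) x = h (g (h^-1 x)).
Proof. by []. Qed.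

Lemma homeo_ex (f f' : X -> X) : cancel f f' -> cancel f' f ->
  continuous f -> continuous f' -> exists g : hom, g =1 f.
Proof. by move=> fK f'K fc f'c; exists (Homeo fK f'K fc f'c). Qed.

Lemma hom_mod g x m : exists k, forall y, eqx k x y -> eqx m (g x) (g y).
Proof. by have /continuousP_eqx := @homeo_cont _ g; exact. Qed.

Lemma isT_mul g h : inT g -> inT h -> inT (g * h).
Proof. exact: T_mul. Qed.
Lemma isT_inv g : inT g -> inT g^-1.
Proof. exact: T_inv. Qed.
Lemma isT_one : inT 1. Proof. exact: T_one. Qed.
Lemma isT_conj g h : inT g -> inT h -> inT (g ^ h).
Proof. by move=> Tg Th; apply: isT_mul; [apply: isT_inv|apply: isT_mul]. Qed.
Lemma isT_exp g k : inT g -> inT (g ^+ k).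
Proof.
move=> Tg; elim: k => [|k IH]; first exact: isT_one.
by rewrite expgS; apply: isT_mul.
Qed.

Let z0 : Y := fun _ => ord0.

Lemma depth_list k : exists U : seq W, [/\ sorted <%O U, complete_antichain U &
  forall w, (w \in U) = (size w.2 == k)].
Proof.
pose U0 : seq W := [seq (p.1, tval p.2) | p <- enum {: 'I_r.+1 * k.-tuple D}].
have uU : uniq U0.
  rewrite map_inj_uniq ?enum_uniq // => -[a s] [b t] /= [-> E].
  by congr pair; apply: val_inj.
have mU w : (w \in U0) = (size w.2 == k).
  apply/mapP/eqP => [[[a s] _ ->] /=|E]; first exact: size_tuple.
  case: w E => a s /= /eqP sz.
  by exists ((a, Tuple sz) : 'I_r.+1 * k.-tuple D); rewrite ?mem_enum.
exists (sort <=%O U0); split.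
- by rewrite sort_lt_sorted; exact: uU.
- move=> x; exists (pre k x); split.
    by rewrite mem_sort mU /= size_stake eqxx; split=> //; exact: wprefix_pre.
  by move=> w [+ /wprefixP ->]; rewrite mem_sort mU => /eqP ->.
- by move=> w; rewrite mem_sort mU.
Qed.

(** At a uniform depth the images of the cones form the second antichain; it is already sorted
    because [g] is increasing, so no rotation is involved. *)
Lemma isT_mono g : ploc g -> monox g -> inT g.
Proof.
move=> /ploc_unif[k gk] mg; have [U [sU cU mU]] := depth_list k.
have /choice[b bP] : forall w, exists v, size w.2 = k -> forall a, g (wcat w a) = wcat v a.
  move=> w; have [E|E] := pselect (size w.2 = k); last by exists w.
  by have [v vP] := gk w E; exists v.
have bU w a : w \in U -> g (wcat w a) = wcat (b w) a.
  by rewrite mU => /eqP E; apply: bP.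
have bD u v : u \in U -> v \in U -> u <> v -> disj (b u) (b v).
  move=> uU vU uv a c; rewrite -!bU // => /hinj.
  exact: (complete_disj cU uU vU uv).
apply/(@T_mapsP n.+2 r.+1 isT isT); exists U, [seq b u | u <- U], 0%N; split=> //.
  split.
    rewrite sorted_map; apply: (sub_in_sorted (P := [in U])) sU; last exact/allP.
    move=> u v uU vU uv /=; have uv' : u <> v by move=> E; move: uv; rewrite E ltxx.
    apply: (@xlt_wlt _ _ (b u) (b v) z0 z0); first exact: bD.
    rewrite -!bU //; apply: mg; apply: wlt_xlt => //.
    exact: complete_disj uv'.
  move=> x; have [u [[uU [a xE]] uP]] := cU (g^-1 x).
  have xE' : x = wcat (b u) a by rewrite -bU // -xE hmulVK.
  exists (b u); split; first by split; [exact: map_f|exists a].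
  move=> _ [/mapP[v vU ->] [c xE'']]; congr b; apply: uP; split=> //; exists c.
  by apply: (@hinj g); rewrite hmulVK bU.
split=> [|i iU a]; first by rewrite size_rot size_map.
rewrite rot0 (nth_map (Ordinal (isT : (0 < r.+1)%N), [::])) //.
by apply: bU; exact: mem_nth.
Qed.

Lemma isT_ploc g : inT g -> ploc g.
Proof.
move=> [l [u [v [b [[_ cu] _ H]]]]] x.
have [w [[/tnthP[i wi] wx] _]] := cu x.
exists w, (tnth v (inord ((i + b) %% l.+1))); split=> // a.
by rewrite wi H.
Qed.

Lemma isT_unif g : inT g -> exists k, forall w, size w.2 = k ->
  exists v, forall a, g (wcat w a) = wcat v a.
Proof. by move=> /isT_ploc /ploc_unif. Qed.

(** [cut_cycp] applied to the cones whose shifted index does not wrap around modulo [l + 1]. *)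
Lemma isT_cycp g : inT g -> cycp g.
Proof.
move=> [l [u [v [b [[su cu] [sv cv] H]]]]].
have /choice[idx idxP] : forall x, exists i : 'I_l.+1, wprefix (tnth u i) x.
  by move=> x; have [w [[/tnthP[i ->] wx] _]] := cu x; exists i.
have lt_tnth (t : l.+1.-tuple W) (i j : 'I_l.+1) (a c : Y) : sorted <%O t ->
    complete_antichain t -> (i < j)%N -> xlt (wcat (tnth t i) a) (wcat (tnth t j) c).
  move=> st ct ij.
  have L : (tnth t i < tnth t j)%O.
    rewrite !(tnth_nth (tnth_default t i)).
    by apply: (sorted_ltn_nth lt_trans); rewrite ?inE ?size_tuple ?ltn_ord.
  apply: wlt_xlt => //; apply: (complete_disj ct); rewrite ?mem_tnth //.
  by move=> E; move: L; rewrite E ltxx.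
have idxE x : exists a, x = wcat (tnth u (idx x)) a by exact: idxP.
have idx_lt x y : xlt x y -> (idx x <= idx y)%N.
  move=> xy; rewrite leqNgt; apply/negP => L; apply: (xlt_asym xy).
  have [a ->] := idxE x; have [c ->] := idxE y; exact: lt_tnth.
pose P x := (idx x + b < l.+1)%N.
have vE x a (k : 'I_l.+1) : x = wcat (tnth u (idx x)) a ->
    k = (idx x + b) %% l.+1 :> nat -> g x = wcat (tnth v k) a.
  move=> xE kE; rewrite {1}xE H; congr (wcat (tnth v _) _).
  by apply: val_inj; rewrite /= inordK ?ltn_mod // kE.
pose K x : 'I_l.+1 := inord ((idx x + b) %% l.+1).
have KE x : K x = (idx x + b) %% l.+1 :> nat by rewrite inordK // ltn_mod.
have K1 x : P x -> K x = idx x + b :> nat by move=> Px; rewrite KE modn_small.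
have K2 x : ~ P x -> (K x + l.+1 = idx x + b)%N.
  move=> /negP; rewrite -leqNgt => h; rewrite KE.
  rewrite -{1}(subnK h) modnDr modn_small ?subnK //.
  by rewrite ltn_subLR //; have := ltn_ord (idx x); have := ltn_ord b; lia.
apply: (@cut_cycp _ _ P) => [x y /idx_lt xy|x y xy E|x y Px Py].
- by rewrite /P; apply: leq_trans; rewrite ltnS leq_add2r.
- have [a xa] := idxE x; have [c yc] := idxE y.
  rewrite (vE x a (K x)) // (vE y c (K y)) //.
  have := idx_lt _ _ xy; rewrite leq_eqVlt => /orP[/eqP/val_inj F|L].
    have -> : K x = K y by rewrite /K F.
    apply/xlt_wcat; move: xy; rewrite {1}xa {1}yc F => /xlt_wcat; exact.
  apply: lt_tnth => //; have [Px|Px] := pselect (P x).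
    by rewrite !K1 ?ltn_add2r //; apply/E.
  by rewrite -(ltn_add2r l.+1) !K2 ?ltn_add2r // -E.
- have [a xa] := idxE x; have [c yc] := idxE y.
  rewrite (vE x a (K x)) // (vE y c (K y)) //; apply: lt_tnth => //.
  have := K1 _ Px; have := K2 _ Py; have := ltn_ord (idx y); lia.
Qed.

Definition AtX u (f : Y -> Y) x : X :=
  if (x.1 : 'I_r.+1) == u.1 then (x.1, Ats u.2 f x.2) else x.

Lemma AtXE u f a : AtX u f (wcat u a) = wcat u (f a).
Proof. by rewrite /AtX /= eqxx AtsE. Qed.

Lemma AtX_out u f x : ~ wprefix u x -> AtX u f x = x.
Proof.
case: u x => b s [c x]; rewrite /AtX /=; case: eqP => // -> H.
by rewrite Ats_out // => -[a E]; apply: H; exists a; rewrite E.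
Qed.

Lemma AtXK u f f' : cancel f f' -> cancel (AtX u f) (AtX u f').
Proof.
move=> fK x; have [[a ->]|H] := pselect (wprefix u x); first by rewrite !AtXE fK.
by rewrite !AtX_out.
Qed.

Lemma AtX_mono u f : smono f -> monox (AtX u f).
Proof.
move=> m x y; have [[a ->]|xs] := pselect (wprefix u x);
have [[b ->]|ys] := pselect (wprefix u y); rewrite ?AtXE ?(AtX_out _ xs) ?(AtX_out _ ys) //.
- by move=> /xlt_wcat ab; apply/xlt_wcat; exact: m.
- by move=> L; exact: xcone_lt L ys.
- by move=> L; exact: xcone_gt L xs.
Qed.

Lemma AtX_ploc u f : sploc f -> ploc (AtX u f).
Proof.
move=> lf x; have [[a ->]|xs] := pselect (wprefix u x).
  have [p [q [[b ->] pq]]] := lf a.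
  exists (wext u p), (wext u q); split; first by exists b; rewrite wcat_wext.
  by move=> c; rewrite !wcat_wext AtXE pq.
exists (pre (size u.2) x), (pre (size u.2) x); split; first exact: wprefix_pre.
move=> a; rewrite AtX_out // => /wprefixP E; apply: xs; apply/wprefixP.
have /wprefixP := wprefix_wcat (pre (size u.2) x) a.
by rewrite /= size_stake -E.
Qed.

Lemma At_ex u f f' : cancel f f' -> cancel f' f -> smono f -> sploc f -> sploc f' ->
  exists g, [/\ inT g, forall a, g (wcat u a) = wcat u (f a) &
    forall x, ~ wprefix u x -> g x = x].
Proof.
move=> fK f'K m l l'.
have [g gE] := homeo_ex (AtXK u fK) (AtXK u f'K) (ploc_cont (AtX_ploc u l))
  (ploc_cont (AtX_ploc u l')).
have /funext gE' := gE.
exists g; split=> [|a|x xu]; rewrite ?gE ?AtXE ?AtX_out //.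
by apply: isT_mono; rewrite gE'; [exact: AtX_ploc|exact: AtX_mono].
Qed.

Definition supp u g := forall x, ~ wprefix u x -> g x = x.

Lemma A_ex u : exists g, [/\ inT g, forall a, g (wcat u a) = wcat u (Amap a) & supp u g].
Proof. exact: At_ex (@AmapK _) (@AinvK _) (@Amap_mono _) (@Amap_loc _) (@Ainv_loc _). Qed.

Lemma C_ex u : exists g, [/\ inT g, forall a, g (wcat u a) = wcat u (Cmap a) & supp u g].
Proof. exact: At_ex (@CmapK _) (@CinvK _) (@Cmap_mono _) (@Cmap_loc _) (@Cinv_loc _). Qed.

Definition hA u := projT1 (cid (A_ex u)).
Definition hC u := projT1 (cid (C_ex u)).

Lemma hA_T u : inT (hA u). Proof. by rewrite /hA; case: cid => g []. Qed.
Lemma hAE u a : hA u (wcat u a) = wcat u (Amap a).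
Proof. by rewrite /hA; case: cid => g []. Qed.
Lemma hA_supp u : supp u (hA u). Proof. by rewrite /hA; case: cid => g []. Qed.
Lemma hC_T u : inT (hC u). Proof. by rewrite /hC; case: cid => g []. Qed.
Lemma hCE u a : hC u (wcat u a) = wcat u (Cmap a).
Proof. by rewrite /hC; case: cid => g []. Qed.
Lemma hC_supp u : supp u (hC u). Proof. by rewrite /hC; case: cid => g []. Qed.

Lemma supp_inv u g : supp u g -> supp u g^-1.
Proof. by move=> H x /H E; rewrite -{1}E hmulK. Qed.

Lemma supp_mul u g h : supp u g -> supp u h -> supp u (g * h).
Proof. by move=> sg sh x ux; rewrite hmulE sg ?sh. Qed.

Lemma supp_stable u g x : supp u g -> wprefix u x -> wprefix u (g x).
Proof.
move=> sg ux; apply: contrapT => H; apply: (H).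
by rewrite -{1}(hmulK g x) in ux; rewrite (supp_inv sg H) in ux.
Qed.

Lemma hAVE u a : (hA u)^-1 (wcat u a) = wcat u (Ainv a).
Proof. by rewrite -[in LHS](AinvK a) -hAE hmulK. Qed.

Lemma hCVE u a : (hC u)^-1 (wcat u a) = wcat u (Cinv a).
Proof. by rewrite -[in LHS](CinvK a) -hCE hmulK. Qed.

Definition sends g u v := forall a, g (wcat u a) = wcat v a.

Lemma sends_mul g h u v w : sends g u v -> sends h v w -> sends (g * h) u w.
Proof. by move=> H K a; rewrite hmulE H K. Qed.

Lemma sends_inv g u v : sends g u v -> sends g^-1 v u.
Proof. by move=> H a; rewrite -H hmulK. Qed.

Lemma sends_ext g u v s : sends g u v -> sends g (wext u s) (wext v s).
Proof. by move=> H a; rewrite !wcat_wext. Qed.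

Lemma sends_supp g h u v : sends g u v -> supp u h -> supp v (h ^ g).
Proof.
move=> H sh x vx; rewrite hconjE sh ?hmulVK // => -[a E].
by apply: vx; exists a; rewrite -H -E hmulVK.
Qed.

(** [f j] advances every cone of depth [k] by [j] places in cyclic order, so [f 1] has inverse
    [f (M - 1)]. *)
Lemma rot_ex k : exists (c : hom) (U : seq W), [/\ inT c, sorted <%O U, complete_antichain U,
  forall w, (w \in U) = (size w.2 == k) &
  forall i w0, (i < size U)%N -> sends c (nth w0 U i) (nth w0 U ((i + 1) %% size U))].
Proof.
have [U [sU cU mU]] := depth_list k.
have uU : uniq U by exact: lt_sorted_uniq.
pose w0 : W := (ord0, [::]).
pose M := size U; have M0 : (0 < M)%N.
  have [w [[wU _] _]] := cU (ord0, z0).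
  by rewrite /M; case: (U) wU.
pose f j x : X := wcat (nth w0 U ((index (pre k x) U + j) %% M)) (sdrop k x.2).
have pU x : pre k x \in U by rewrite mU /= size_stake.
have preE w a : w \in U -> pre k (wcat w a) = w /\ sdrop k (wcat w a).2 = a.
  rewrite mU => /eqP E; have /wprefixP := wprefix_wcat w a; rewrite E => <-; split=> //.
  by rewrite /= -E sdrop_prepend.
have nU i : nth w0 U (i %% M) \in U by rewrite mem_nth // ltn_mod.
have fE j i a : (i < M)%N -> f j (wcat (nth w0 U i) a) = wcat (nth w0 U ((i + j) %% M)) a.
  move=> iM; have [E1 E2] := preE (nth w0 U i) a (mem_nth _ iM).
  by rewrite /f E1 E2 index_uniq.
have ff j j' x : f j (f j' x) = f (j' + j)%N x.
  by rewrite {2}/f fE ?ltn_mod // /f modnDml addnA.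
have f0 x : f M x = x.
  rewrite /f modnDr modn_small ?index_mem // nth_index // wcat_pre //.
have fl j : ploc (f j).
  move=> x; exists (pre k x), (nth w0 U ((index (pre k x) U + j) %% M)).
  split; first exact: wprefix_pre.
  move=> a; rewrite -{1}(nth_index w0 (pU x)) fE // index_mem //.
have K1 : cancel (f 1%N) (f M.-1) by move=> x; rewrite ff add1n prednK ?f0.
have K2 : cancel (f M.-1) (f 1%N) by move=> x; rewrite ff addn1 prednK ?f0.
have [c cE] := homeo_ex K1 K2 (ploc_cont (fl _)) (ploc_cont (fl _)).
exists c, U; split=> //.
  apply/(@T_mapsP n.+2 r.+1 isT isT); exists U, U, 1%N; split=> //.
  split=> [|i iU a]; first by rewrite size_rot.
  rewrite nth_rot // addnC cE (set_nth_default w0) // fE //.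
  by congr (wcat _ a); apply: set_nth_default; rewrite ltn_mod.
move=> i w1 iU a; rewrite cE (set_nth_default w0) // fE //.
by congr (wcat _ a); apply: set_nth_default; rewrite ltn_mod.
Qed.

Lemma sends_depth u v : size u.2 = size v.2 -> exists2 g, inT g & sends g u v.
Proof.
move=> E; have [c [U [Tc sU cU mU cE]]] := rot_ex (size u.2).
have uU : u \in U by rewrite mU.
have vU : v \in U by rewrite mU E.
pose M := size U; have M0 : (0 < M)%N by rewrite /M; case: (U) uU.
have H j i : (i < M)%N -> sends (c ^+ j) (nth u U i) (nth u U ((i + j) %% M)).
  move=> iM; elim: j => [|j IH] a.
    by rewrite expg0 addn0 modn_small.
  rewrite expgSr hmulE IH cE ?ltn_mod // modnDml.
  by rewrite -addnA addn1.
exists (c ^+ (index v U + (M - index u U))); first exact: isT_exp.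
have iu : (index u U < M)%N by rewrite index_mem.
have := H (index v U + (M - index u U))%N _ iu.
rewrite addnCA subnKC ?(ltnW iu) // modnDr modn_small ?index_mem //.
by rewrite !nth_index.
Qed.

Lemma sends_zeros k : exists2 g, inT g & sends g (ord0, nseq k.+1 ord0) (ord0, [:: ord0]).
Proof.
elim: k => [|k [g Tg gE]]; first by exists 1; [exact: isT_one|].
exists (hA (ord0, [::]) * g); first by apply: isT_mul => //; exact: hA_T.
apply: sends_mul gE => a.
have := hAE (ord0, [::]) (prepend (nseq k.+2 ord0) a); rewrite /wcat /= => ->.
by rewrite /Amap /=.
Qed.

(** A rotation carries a cone to the cone of zeros of the same depth, and [hA] then deletes zeros.
    Words with empty second component are excluded because such a cone is the whole space when there
    is a single dotted letter. *)
Lemma sends_ex u v : (0 < size u.2)%N -> (0 < size v.2)%N -> exists2 g, inT g & sends g u v.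
Proof.
move=> u0 v0; have H w : (0 < size w.2)%N -> exists2 g, inT g & sends g w (ord0, [:: ord0]).
  move=> w0; have [g Tg gE] := @sends_depth w (ord0, nseq (size w.2).-1.+1 ord0)
    ltac:(by rewrite /= size_nseq prednK).
  have [h Th hE] := sends_zeros (size w.2).-1.
  by exists (g * h); [exact: isT_mul|exact: sends_mul hE].
have [g Tg gE] := H u u0; have [h Th hE] := H v v0.
exists (g * h^-1); first by apply: isT_mul => //; exact: isT_inv.
exact: sends_mul (sends_inv hE).
Qed.

End Homeos.

(** * Supports and large normal subgroups *)

Section Supports.

Variables n r : nat.
Local Notation D := 'I_n.+2.
Local Notation Y := (cantor_seq n.+2).
Local Notation X := (cantor n.+2 r.+1).
Local Notation W := (word n.+2 r.+1).
Local Notation inT := (@is_HigmanThompsonT n.+2 r.+1).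
Local Notation hom := (homeo X).
Implicit Types (x y z : X) (u v w : W) (f g h : hom).

Local Open Scope group_scope.

Lemma Amap_lo : Amap (@lo n) = @lo n.
Proof. by rewrite /Amap /=; apply/funext. Qed.

Lemma Amap_hi : Amap (@hi n) = @hi n.
Proof. by rewrite /Amap /=; apply/funext => -[|i]. Qed.

Lemma Ainv_neq_lo (a : Y) : a <> @lo n -> Ainv a <> @lo n.
Proof. by move=> H E; apply: H; rewrite -[LHS](@AinvK n) E Amap_lo. Qed.

Lemma Ainv_neq_hi (a : Y) : a <> @hi n -> Ainv a <> @hi n.
Proof. by move=> H E; apply: H; rewrite -[LHS](@AinvK n) E Amap_hi. Qed.

Lemma Ainv_down (a : Y) : a <> @lo n -> a <> @hi n -> slt (Ainv a) a.
Proof.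
move=> lo hi; rewrite -[X in slt _ X](@AinvK n).
by apply: Amap_up; [exact: Ainv_neq_lo|exact: Ainv_neq_hi].
Qed.

Lemma wcat_injl u v : (forall a : Y, wcat u a = wcat v a) -> u = v.
Proof.
have key (s : W) t : (forall a : Y, wcat (wext s t) a = wcat s a) -> wext s t = s.
  case: t => [|c t] H; first by case: (s) => b p; rewrite /wext /= cats0.
  have [d cd] : exists d : D, d <> c.
    have [->|/eqP H0] := eqVneq c ord0; first by exists ord_max.
    by exists ord0 => E; apply: H0.
  have := H (fun _ => d); rewrite wcat_wext => /wcat_inj /(congr1 (@^~ 0%N)) /= E.
  by case: cd.
move=> H; have [[p E]|[p E]] := wcat_comp (H (@lo n)).
  by rewrite E key // => a; rewrite -E.
by rewrite E key // => a; rewrite -E.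
Qed.

Definition suppP (P : X -> Prop) g := forall x, ~ P x -> g x = x.

Lemma suppP_stable P g x : suppP P g -> P x -> P (g x).
Proof.
move=> sg Px; apply: contrapT => H; apply: (H).
by have := sg _ H => /hinj ->.
Qed.

Lemma comm_disj P Q f g : suppP P f -> suppP Q g ->
  (forall x, P x -> Q x -> False) -> f * g = g * f.
Proof.
move=> sf sg PQ; apply: homeo_ext => x; rewrite !hmulE.
have [Px|Px] := pselect (P x).
  rewrite (sg x); last exact: PQ.
  by rewrite sg //; apply: PQ; exact: suppP_stable.
rewrite (sf x) //; have [Qx|Qx] := pselect (Q x); last by rewrite sg // sf.
by rewrite sf // => /PQ; apply; exact: suppP_stable.
Qed.

Lemma suppP_inv P f : suppP P f -> suppP P f^-1.
Proof. by move=> s x /s E; rewrite -{1}E hmulK. Qed.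

Lemma suppP_mul P f g : suppP P f -> suppP P g -> suppP P (f * g).
Proof. by move=> sf sg x Px; rewrite hmulE sf ?sg. Qed.

Lemma suppP_conj P f h : suppP P f -> suppP (fun x => P (h^-1 x)) (f ^ h).
Proof. by move=> s x Px; rewrite hconjE s // hmulVK. Qed.

Lemma suppP_le (P Q : X -> Prop) f : (forall x, P x -> Q x) -> suppP P f -> suppP Q f.
Proof. by move=> PQ s x Qx; apply: s => /PQ. Qed.

(** The closure of the set of points moved by [g]. *)
Definition cl g x := forall m, exists y, eqx m x y /\ g y <> y.

Lemma cl_moved g x : g x <> x -> cl g x.
Proof. by move=> H m; exists x; split. Qed.

Lemma moved_disj g x : g x <> x -> exists m, forall y z, eqx m x y -> eqx m x z -> g y <> z.
Proof.
move=> /nesym/neq_eqx[k kP]; have [m mP] := hom_mod g x k.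
exists (maxn k m) => y z E E' F; apply: kP.
have /pre_eqx E1 := eqx_le (leq_maxl k m) E'.
have /mP/pre_eqx E2 := eqx_le (leq_maxr k m) E.
by apply/pre_eqx; rewrite E1 E2 F.
Qed.

Lemma moved_near g x : g x <> x -> exists m, forall y, eqx m x y -> g y <> y.
Proof. by move=> /moved_disj[m mP]; exists m => y E; exact: mP. Qed.

(** Near [x] the map replaces a prefix by another one. The two prefixes differ, since some nearby
    point is moved, and then no smaller cone is fixed pointwise. *)
Lemma cl_open g x : inT g -> cl g x -> exists k, forall y, eqx k x y -> cl g y.
Proof.
move=> /isT_unif[k kP] gx; exists k => y /pre_eqx E m.
have [v vP] := kP (pre k x) (size_stake k x.2).
have xv : pre k x <> v.
  move=> Exv; have [z [/pre_eqx Exz]] := gx k; apply.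
  by rewrite -(wcat_pre k z) -Exz vP -Exv.
pose p := stake m (sdrop k y.2).
have pE : pre (k + m) y = wext (pre k x) p by rewrite E /pre /wext /= -stakeD.
have [a aE] : exists a, wcat (wext v p) a <> wcat (wext (pre k x) p) a.
  apply: contrapT => H; apply: xv.
  have /wcat_injl [E1 /eqP] : forall a, wcat (wext v p) a = wcat (wext (pre k x) p) a.
    by move=> a; apply: contrapT => H'; apply: H; exists a.
  have E2 : size v.2 = k.
    have /wcat_injl [_ /(congr1 (@size _))] : forall a, wcat (wext v p) a = wcat (wext (pre k x) p) a.
      by move=> a; apply: contrapT => H'; apply: H; exists a.
    by rewrite !size_cat /= size_stake => /addIn.
  rewrite eqseq_cat; last by rewrite E2 size_stake.
  by case: (v) E1 => /= b s -> /andP[/eqP -> _].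
exists (wcat (pre (k + m) y) a); split.
  apply: (@eqx_le _ _ _ (k + m)); first exact: leq_addl.
  apply/pre_eqx; have /wprefixP := wprefix_wcat (pre (k + m) y) a.
  by rewrite /= size_stake.
rewrite pE; have -> : g (wcat (wext (pre k x) p) a) = wcat (wext v p) a; last exact: aE.
by rewrite !wcat_wext vP.
Qed.

Lemma cl_closed g x : (forall m, exists y, eqx m x y /\ cl g y) -> cl g x.
Proof.
move=> H m; have [y [/pre_eqx E /(_ m)[z [/pre_eqx E' gz]]]] := H m.
by exists z; split=> //; apply/pre_eqx; rewrite E.
Qed.

Lemma inner_point w m x : wprefix w x -> exists a : Y,
  [/\ eqx m x (wcat w a), a <> @lo n & a <> @hi n].
Proof.
move=> /wprefixP; move: (size w.2) => k ->; pose p := stake m (sdrop k x.2).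
exists (prepend (p ++ [:: ord0; ord_max]) (@lo n)); split.
- apply: (@eqx_le _ _ _ (k + m)); first exact: leq_addl.
  apply/pre_eqx; rewrite prepend_cat -wcat_wext.
  have -> : wext (pre k x) p = pre (k + m) x by rewrite /pre /wext /= -stakeD.
  have /wprefixP := wprefix_wcat (pre (k + m) x) (prepend [:: ord0; ord_max] (@lo n)).
  by rewrite /= size_stake.
- move/(congr1 (@^~ (size p).+1)); rewrite prepend_cat prependE.
  by rewrite ltnNge leqnSn /= subSnn.
- move/(congr1 (@^~ (size p))); rewrite prepend_cat prependE.
  by rewrite ltnn /= subnn.
Qed.

End Supports.

(** * Elements of a large subgroup supported in a cone *)

Section NormalPart.

Variables n r : nat.
Local Notation Y := (cantor_seq n.+2).
Local Notation X := (cantor n.+2 r.+1).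
Local Notation W := (word n.+2 r.+1).
Local Notation inT := (@is_HigmanThompsonT n.+2 r.+1).
Local Notation hom := (homeo X).
Implicit Types (x y z : X) (u v w : W) (f g h s t : hom).

Local Open Scope group_scope.

(* Abstracts the intersection of all nontrivial normal subgroups of Aut T.         *)
Record large (S : hom -> Prop) : Prop := Large {
  large_T : forall s, S s -> inT s;
  large_mul : forall s t, S s -> S t -> S (s * t);
  large_inv : forall s, S s -> S s^-1;
  large_conj : forall s t, S s -> inT t -> S (s ^ t);
  large_comm : forall u f g, (0 < size u.2)%N -> inT f -> inT g ->
    supp u f -> supp u g -> S [~ f, g] }.

Variable S : hom -> Prop.
Hypothesis SL : large S.

Let SJ := large_conj SL.
Let SC := large_comm SL.

(** The words [u 0^(i+1) 1]: disjoint cones accumulating at the lower end of the cone of [u],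
    shifted by the powers of [(hA u)^-1]. *)
Definition zcone u i : W := wext u (nseq i.+1 (@ord0 n.+1) ++ [:: @o1 n]).

Lemma zcone_disj u i j : (i < j)%N -> disj (zcone u i) (zcone u j).
Proof.
move=> ij a b; rewrite !wcat_wext => /wcat_inj.
move/(congr1 (@^~ i.+1)); rewrite !prepend_cat !prependE !size_nseq ltnn subnn ltnS ij.
rewrite nth_nseq ltnS ij => E.
by have := o1_neq0 n; rewrite [o1 n]E eqxx.
Qed.

Lemma zcone_send u i : sends ((hA u)^-1 ^+ i) (zcone u 0) (zcone u i).
Proof.
elim: i => [|i IH] a; first by rewrite expg0.
by rewrite expgSr hmulE IH !wcat_wext hAVE.
Qed.

(* A commutator [f * (f^-1) ^ z], where [z] moves the support of [f] away from   *)
(* two given points.                                                             *)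
Lemma large_agree u f x y : (0 < size u.2)%N -> inT f -> supp (zcone u 0) f ->
  exists s, [/\ S s, forall z, wprefix (zcone u 0) z -> s z = f z, s x = f x & s y = f y].
Proof.
move=> u0 Tf sf; pose z i := (hA u)^-1 ^+ i; pose s i := [~ f^-1, z i].
have su : supp u f.
  by move=> p pu; apply: sf => -[a E]; apply: pu; rewrite E wcat_wext; eexists.
have sz i : supp u (z i).
  rewrite /z; elim: i => [|i IH]; first by rewrite expg0.
  rewrite expgS; apply: supp_mul => //; apply: supp_inv; exact: hA_supp.
have Ss i : S (s i).
  apply: (SC u0) => //; first exact: isT_inv.
  - by apply: isT_exp; apply: isT_inv; exact: hA_T.
  - exact: supp_inv.
have sE i p : ~ wprefix (zcone u i) (f p) -> s i p = f p.
  move=> H; rewrite /s /commg invgK hmulE.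
  exact: (sends_supp (@zcone_send u i) (supp_inv sf) H).
have E0 i p : (0 < i)%N -> wprefix (zcone u 0) p -> s i p = f p.
  move=> i0 /(supp_stable sf) [a E]; apply: sE; rewrite E.
  by apply: disjN; apply: disjC; exact: zcone_disj.
(* Each of the two points lies in at most one of the disjoint cones, so one of the indices 1, 2, 3
   avoids both. *)
have [i [i0 ix iy]] : exists i, [/\ (0 < i)%N, ~ wprefix (zcone u i) (f x) & ~ wprefix (zcone u i) (f y)].
  have N p i j : (i < j)%N -> wprefix (zcone u i) p -> wprefix (zcone u j) p -> False.
    by move=> ij [a ->] [b /(zcone_disj ij)].
  have Nx i j := @N (f x) i j; have Ny i j := @N (f y) i j.
  have [x1|x1] := pselect (wprefix (zcone u 1) (f x)).
    have [y2|y2] := pselect (wprefix (zcone u 2) (f y)).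
      by exists 3%N; split=> // H; [exact: Nx x1 H|exact: Ny y2 H].
    by exists 2%N; split=> // H; exact: Nx x1 H.
  have [y1|y1] := pselect (wprefix (zcone u 1) (f y)); last by exists 1%N.
  have [x2|x2] := pselect (wprefix (zcone u 2) (f x)).
    by exists 3%N; split=> // H; [exact: Nx x2 H|exact: Ny y1 H].
  by exists 2%N; split=> // H; exact: Ny y1 H.
by exists (s i); split=> //; [move=> p; exact: E0|exact: sE|exact: sE].
Qed.

Definition wa : W := (ord0, [:: ord0; @o1 n; ord0]).

(** Let [z] carry the cone of [wa] onto that of [wa 0 max], inside a cone where [large_comm]
    applies. The commutator of [hA wa] and [z] acts on the cone of [wa] as [Ainv] followed by [Amap]
    on the subcone [0 max]. It still lowers every point but the two ends: what [Ainv] sends into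
    [0 max] comes from [max 0], and the correction keeps it in [0 max]. So no positive power fixes
    such a point. *)
Lemma large_cone_base : exists s, [/\ S s, supp wa s &
  forall (a : Y) k, a <> @lo n -> a <> @hi n ->
  exists b : Y, b <> a /\ (s ^+ k.+1) (wcat wa a) = wcat wa b].
Proof.
pose u : W := (ord0, [:: ord0]).
(* After the prefix [u], the four factors act on the cone of [wa] as
   [10 -> 01 -> 01 max -> 10 max -> 100 max]. *)
pose z := (hC u)^-1 * hC (wext u [:: ord0]) * hC u * (hC (wext u [:: @o1 n]))^-1.
have o0 := negbTE (o1_neq0 n).
have zE : sends z wa (wext wa [:: ord0; ord_max]).
  move=> a; rewrite /z !hmulE.
  have H1 : (hC u)^-1 (wcat wa a) = wcat u (prepend [:: ord0; @o1 n] a).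
    rewrite -[LHS]/((hC u)^-1 (wcat u (prepend [:: @o1 n; ord0] a))) hCVE.
    rewrite /Cinv /= o0 eqxx sdrop_scons2 /=; congr (wcat u (scons _ (scons _ _))).
  have H2 : hC (wext u [:: ord0]) (wcat u (prepend [:: ord0; o1 n] a)) =
      wcat u (prepend [:: ord0; o1 n; ord_max] a).
    rewrite -[LHS]/(hC (wext u [:: ord0]) (wcat (wext u [:: ord0]) (prepend [:: o1 n] a))).
    by rewrite hCE /Cmap /= o0 eqxx.
  have H3 : hC u (wcat u (prepend [:: ord0; o1 n; ord_max] a)) =
      wcat u (prepend [:: o1 n; ord0; ord_max] a).
    rewrite hCE /Cmap /= o0 sdrop_scons2; congr (wcat u (scons _ (scons _ _))).
    by apply: ord_inj; rewrite inord_pred val_o1.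
  rewrite H1 H2 H3.
  rewrite -[LHS]/((hC (wext u [:: o1 n]))^-1 (wcat (wext u [:: o1 n]) (prepend [:: ord0; ord_max] a))).
  by rewrite hCVE /Cinv /=.
have sx c : supp u (hC (wext u [:: c])).
  move=> x xu; apply: hC_supp => -[a E]; apply: xu.
  by rewrite E wcat_wext; eexists.
have sz : supp u z.
  apply: supp_mul; [apply: supp_mul; [apply: supp_mul|]|].
  - by apply: supp_inv; exact: hC_supp.
  - exact: sx.
  - exact: hC_supp.
  - by apply: supp_inv; exact: sx.
have Tz : inT z.
  apply: isT_mul; [apply: isT_mul; [apply: isT_mul|]|].
  - by apply: isT_inv; exact: hC_T.
  - exact: hC_T.
  - exact: hC_T.
  - by apply: isT_inv; exact: hC_T.
pose f := hA wa; pose s := [~ f, z].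
have sf : supp u f.
  move=> x xu; apply: hA_supp => -[a E]; apply: xu.
  by exists (prepend [:: @o1 n; ord0] a); rewrite E.
pose w' := wext wa [:: ord0; ord_max].
have fz : forall a, (f ^ z) (wcat w' a) = wcat w' (Amap a).
  by move=> a; rewrite hconjE -zE hmulK hAE zE.
have fz' : supp w' (f ^ z) by apply: sends_supp zE _; exact: hA_supp.
pose m a := Ats [:: ord0; ord_max] (@Amap n) (Ainv a).
have sE a : s (wcat wa a) = wcat wa (m a).
  rewrite /s /commg hmulE hAVE /m.
  have [[b ->]|H] := pselect (incone [:: ord0; ord_max] (Ainv a)).
    by rewrite -wcat_wext fz AtsE wcat_wext.
  rewrite fz' ?Ats_out // => -[b]; rewrite wcat_wext => /wcat_inj E.
  by apply: H; exists b.
have mlt a : a <> @lo n -> a <> @hi n -> slt (m a) a.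
  move=> alo ahi; rewrite /m.
  have [[b E]|H] := pselect (incone [:: ord0; ord_max] (Ainv a)); last first.
    by rewrite Ats_out //; exact: Ainv_down.
  rewrite E AtsE -[a](@AinvK n) E; exists 0%N; split=> //.
  by rewrite /Amap /= eqxx.
have mlo : m (@lo n) = @lo n.
  rewrite /m -{1}Amap_lo AmapK Ats_out // => -[b].
  by move=> /(congr1 (@^~ 1%N)).
have minj : injective m.
  move=> a b E; apply: (@wcat_inj _ _ wa); apply: (@hinj _ _ s).
  by rewrite !sE E.
exists s; split.
- by apply: (SC (u := u)) => //; exact: hA_T.
- move=> x xw; rewrite /s /commg hmulE.
  rewrite (supp_inv (@hA_supp _ _ wa)) // fz' // => -[a E].
  by apply: xw; rewrite E wcat_wext; eexists.
- move=> a k alo ahi.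
  suff [b [L [_ E]]] : exists b, slt b a /\ b <> @lo n /\ (s ^+ k.+1) (wcat wa a) = wcat wa b.
    by exists b; split=> // ba; move: L; rewrite ba => /slt_irr.
  have nlo b : b <> @lo n -> m b <> @lo n.
    by move=> H E; apply: H; apply: minj; rewrite mlo.
  elim: k => [|k [b [L [blo E]]]].
    by exists (m a); split; [exact: mlt|split; [exact: nlo|rewrite expg1 sE]].
  exists (m b); rewrite expgSr hmulE E sE; split; last by split=> //; exact: nlo.
  apply: slt_trans (L); apply: mlt => // bhi.
  by case: (slt_asym L); rewrite bhi; exact: hi_max.
Qed.

Lemma large_cone w : (0 < size w.2)%N -> exists s, [/\ S s, supp w s &
  forall (a : Y) k, a <> @lo n -> a <> @hi n ->
  exists b : Y, b <> a /\ (s ^+ k.+1) (wcat w a) = wcat w b].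
Proof.
move=> w0; have [s [Ss ss sm]] := large_cone_base.
have [g Tg gE] := @sends_ex _ _ wa w isT w0.
exists (s ^ g); split; [exact: SJ|exact: sends_supp ss|].
move=> a k alo ahi; have [b [ba E]] := sm a k alo ahi.
exists b; split=> //; rewrite -conjXg hconjE -gE hmulK E.
exact: gE.
Qed.

End NormalPart.

(** * Spatial reconstruction *)

Section Reconstruction.

Variables n r : nat.
Local Notation X := (cantor n.+2 r.+1).
Local Notation W := (word n.+2 r.+1).
Local Notation hom := (homeo X).
Implicit Types (x y z : X) (u v w : W) (f g h k s t : hom).

Local Open Scope group_scope.

Variable S : hom -> Prop.
Hypothesis SL : large S.

Let ST := large_T SL.
Let SM := large_mul SL.
Let SV := large_inv SL.
Let SJ := large_conj SL.

Lemma large_one : S 1.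
Proof.
have [s [Ss _ _]] := @large_cone _ _ _ SL (ord0, [:: ord0]) isT.
by rewrite -(mulgV s); apply: SM => //; exact: SV.
Qed.

Lemma large_exp s i : S s -> S (s ^+ i).
Proof.
move=> Ss; elim: i => [|i IH]; first exact: large_one.
by rewrite expgS; apply: SM.
Qed.

Lemma large_commg s t : S s -> S t -> S [~ s, t].
Proof. by move=> Ss St; apply: SM; [exact: SV|apply: SJ => //; exact: ST]. Qed.

Lemma cone_at x m : exists w, [/\ (0 < size w.2)%N, wprefix w x &
  forall y, wprefix w y -> eqx m x y].
Proof.
exists (pre m.+1 x); split=> //; first exact: wprefix_pre.
move=> y /wprefixP; rewrite -[size _]/(size (stake m.+1 x.2)) size_stake => E.
by apply: (@eqx_le _ _ _ m.+1) => //; apply/pre_eqx.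
Qed.

(* Rubin's first-order substitute for disjointness of supports. It only yields     *)
(* disjointness from the support of [g ^+ 12]: by pigeonhole, each point moved by  *)
(* [f] is fixed by some [g ^+ k] with [0 < k < 5], hence by [g ^+ 12].             *)
Definition algdisj f g := forall h, S h -> f * h <> h * f -> exists f1 f2,
  [/\ S f1, S f2, f1 * g = g * f1, f2 * g = g * f2 &
      [~ f1, [~ f2, h]] <> 1 /\ [~ f1, [~ f2, h]] * g = g * [~ f1, [~ f2, h]]].

(** Some cone [w] consists of points moved by [f], so that [g] is the identity on it, and is moved
    off itself by [h]. Take [f2] supported in [w], and [f1] supported in a smaller cone that [f2]
    moves off itself. As [[~ f2, h]] is [f2^-1] times a map supported outside [w], the double
    commutator equals [[~ f1, f2^-1]], which is nontrivial and supported in [w]. *)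
Lemma disj_algdisj f g : (forall x, f x <> x -> g x = x) -> algdisj f g.
Proof.
move=> fg h Sh fh.
have [x [fx hx]] : exists x, f x <> x /\ h x <> x.
  apply: contrapT => H; apply: fh.
  apply: (@comm_disj _ _ (fun x => f x <> x) (fun x => h x <> x)) => [x|x|x fx hx].
  - exact: contrapT.
  - exact: contrapT.
  - by apply: H; exists x.
have [m mP] := moved_near fx; have [l lP] := moved_disj hx.
have [w [w0 wx wP]] := cone_at x (maxn m l).
have wf y : wprefix w y -> f y <> y.
  by move=> /wP /(eqx_le (leq_maxl m l)); exact: mP.
have wh y z : wprefix w y -> wprefix w z -> h y <> z.
  by move=> /wP /(eqx_le (leq_maxr m l)) yx /wP /(eqx_le (leq_maxr m l)); exact: lP.
have wg k : supp w k -> k * g = g * k.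
  move=> sk; apply: (@comm_disj _ _ (wprefix w) (fun x => g x <> x)) => // [y|y /wf fy gy].
    exact: contrapT.
  by apply: gy; exact: fg.
have [f2 [Sf2 sf2 mf2]] := large_cone SL w0.
have [a [_ alo ahi]] := inner_point 0 wx.
have [b [ba E]] := mf2 a 0%N alo ahi; rewrite expg1 in E.
have f2a : f2 (wcat w a) <> wcat w a by rewrite E => /wcat_inj.
have [q qP] := moved_disj f2a.
have [u [u0 ua uP]] := cone_at (wcat w a) (maxn q (size w.2)).
have uw y : wprefix u y -> wprefix w y.
  move=> /uP /(eqx_le (leq_maxr _ _)) /pre_eqx E'; apply/wprefixP; rewrite -E'.
  by apply/wprefixP; exact: wprefix_wcat.
have uf2 y z : wprefix u y -> wprefix u z -> f2 y <> z.
  by move=> /uP /(eqx_le (leq_maxl _ _)) yx /uP /(eqx_le (leq_maxl _ _)); exact: qP.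
have [f1 [Sf1 sf1 mf1]] := large_cone SL u0.
have sf1w : supp w f1 by move=> y wy; apply: sf1 => /uw.
exists f1, f2; split=> //; [exact: wg|exact: wg|].
have -> : [~ f1, [~ f2, h]] = [~ f1, f2^-1].
  rewrite /commg; congr (_ * _).
  rewrite -/(commg f2 h) /commg conjgM /conjg.
  set c := f2^-1^-1 * _.
  have -> : c * ((h^-1 * (f2 * h))) = (f2 ^ h) * c.
    rewrite -/(f2 ^ h); apply: (@comm_disj _ _ (wprefix w) (fun y => wprefix w (h^-1 y))).
    - rewrite /c; apply: supp_mul; first by rewrite invgK.
      by apply: supp_mul => //; exact: supp_inv.
    - exact: suppP_conj.
    - by move=> y wy why; apply: (wh _ _ why wy); rewrite hmulVK.
  by rewrite mulgA mulVg mul1g.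
split; last first.
  apply: wg; apply: supp_mul; first exact: supp_inv.
  apply: supp_mul; first by rewrite invgK.
  by apply: supp_mul => //; exact: supp_inv.
move=> /eqP /commgP; rewrite /commute => C.
have [a' [_ alo' ahi']] := inner_point 0 ua.
have ua' := wprefix_wcat u a'.
have [b' [ba' E']] := mf1 a' 0%N alo' ahi'; rewrite expg1 in E'.
have : f1 (f2^-1 (wcat u a')) = f2^-1 (f1 (wcat u a')) by have := congr1 (@^~ (wcat u a')) (congr1 (@homeo_fun _) C).
rewrite E' sf1 => [/hinj/esym/wcat_inj //|].
by move=> H; apply: (uf2 _ _ H ua'); rewrite hmulVK.
Qed.

(** The double commutator [k] is supported in the images of [w] under the four maps listed in [p],
    all commuting with [g]. As [k] commutes with [g], a point [z] moved by [k] and its images under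
    [g], ..., [g ^+ 4] all lie in these four sets; two of them share one set, so a power of [g]
    below the fifth does not move [w] off itself. *)
Lemma algdisj_power f g x : algdisj f g -> f x <> x -> (g ^+ 12) x = x.
Proof.
move=> fg fx; apply: contrapT => g12.
(* All of 1, 2, 3, 4 divide 12, so none of these powers of [g] fixes [x]. *)
have gE i j : (g ^+ (i * j)) x <> x -> (g ^+ i) x <> x.
  move=> H E; apply: H; rewrite expgnA; elim: j => [|j IH]; first by rewrite expg0.
  by rewrite expgS hmulE E.
have g1 : g x <> x by rewrite -[g]expg1; exact: (gE 1%N 12%N).
have g2 : (g ^+ 2) x <> x by exact: (gE 2%N 6%N).
have g3 : (g ^+ 3) x <> x by exact: (gE 3%N 4%N).
have g4 : (g ^+ 4) x <> x by exact: (gE 4%N 3%N).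
have [m0 m0P] := moved_disj fx.
have [m1 m1P] := moved_disj g1; have [m2 m2P] := moved_disj g2.
have [m3 m3P] := moved_disj g3; have [m4 m4P] := moved_disj g4.
have [w [w0 wx wP]] := cone_at x (m0 + m1 + m2 + m3 + m4).
have wf y z : wprefix w y -> wprefix w z -> f y <> z.
  by move=> /wP E /wP E'; apply: m0P; apply: eqx_le E || apply: eqx_le E'; lia.
have wg i y z : (0 < i < 5)%N -> wprefix w y -> wprefix w z -> (g ^+ i) y <> z.
  case: i => [|[|[|[|[|i]]]]] // _ /wP E /wP E'.
  - by rewrite expg1; apply: m1P; apply: eqx_le E || apply: eqx_le E'; lia.
  - by apply: m2P; apply: eqx_le E || apply: eqx_le E'; lia.
  - by apply: m3P; apply: eqx_le E || apply: eqx_le E'; lia.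
  - by apply: m4P; apply: eqx_le E || apply: eqx_le E'; lia.
have [h [Sh sh mh]] := large_cone SL w0.
have [a [_ alo ahi]] := inner_point 0 wx.
have [b [ba E]] := mh a 0%N alo ahi; rewrite expg1 in E.
have fh : f * h <> h * f.
  move=> C; have := congr1 (@^~ (wcat w a)) (congr1 (@homeo_fun _) C).
  rewrite !hmulE E sh => [/hinj/esym/wcat_inj //|] H.
  by apply: (wf _ _ (wprefix_wcat w a) H).
have [f1 [f2 [Sf1 Sf2 f1g f2g [k1 kg]]]] := fg h Sh fh.
set k := [~ f1, _] in k1 kg.
have [z kz] : exists z, k z <> z.
  apply: contrapT => H; apply: k1; apply: homeo_ext => z; apply: contrapT => H'.
  by apply: H; exists z.
pose Q (p : seq hom) x := exists c : hom, c \in p /\ wprefix w (c^-1 x).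
pose p := [:: 1; f2; f1; f2 * f1] : seq hom.
have sk : suppP (Q p) k.
  have se : suppP (Q [:: 1; f2]) [~ f2, h].
    rewrite /commg /conjg !mulgA; apply: suppP_mul.
      have -> : f2^-1 * h^-1 * f2 = (h^-1) ^ f2 by rewrite /conjg mulgA.
      apply: suppP_le (suppP_conj (supp_inv sh)) => y wy.
      by exists f2; rewrite !inE eqxx orbT.
    by apply: suppP_le sh => y wy; exists 1; rewrite mem_head invg1.
  rewrite /k; move: [~ f2, h] se => e se.
  rewrite /commg /conjg !mulgA; apply: suppP_mul.
    have -> : f1^-1 * e^-1 * f1 = (e^-1) ^ f1 by rewrite /conjg mulgA.
    apply: suppP_le (suppP_conj (suppP_inv se)) => y [c [cp wy]].
    exists (c * f1); rewrite invgM hmulE; split=> //.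
    by move: cp; rewrite !inE => /orP[] /eqP ->; rewrite ?mul1g eqxx ?orbT.
  apply: suppP_le se => y [c [cp wy]]; exists c; split=> //.
  by move: cp; rewrite !inE => /orP[] /eqP ->; rewrite eqxx ?orbT.
have cg c : c \in p -> c * g = g * c.
  rewrite !inE => /or4P[] /eqP -> //; first by rewrite mulg1 mul1g.
  by rewrite -mulgA f1g mulgA f2g mulgA.
have gk i : Q p ((g ^+ i) z).
  apply: contrapT => /sk H; apply: kz; apply: (@hinj _ _ (g ^+ i)).
  rewrite -[RHS]H -!hmulE; congr (homeo_fun _ z).
  exact: (commuteX i kg).
have /choice[c cP] := gk.
have [i [j [ij j5 cij]]] : exists i j, [/\ (i < j)%N, (j < 5)%N & c i = c j].
  have /(uniqPn (1 : hom))[i [j [ij]]] : ~~ uniq [seq c i | i <- iota 0 5].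
    apply/negP => /uniq_leq_size H.
    have sub : {subset [seq c i | i <- iota 0 5] <= p}.
      by move=> d /mapP[i _ ->]; case: (cP i).
    by have := H p sub; rewrite size_map size_iota.
  rewrite size_map size_iota => j5; rewrite !(nth_map 0%N) ?size_iota ?(ltn_trans ij) //.
  by rewrite !nth_iota ?(ltn_trans ij) // => E'; exists i, j.
have [cp wi] := cP i; have [_ wj] := cP j.
apply: (@wg (j - i)%N _ _ _ wi wj); first lia.
have C : commute (c i)^-1 (g ^+ (j - i)).
  apply: commute_sym; apply: commuteV; apply: commute_sym; apply: commuteX.
  exact: cg.
have E' : g ^+ i * (c i)^-1 * g ^+ (j - i) = g ^+ j * (c i)^-1.
  by rewrite -mulgA C mulgA -expgnDr subnKC // ltnW.
rewrite -cij; exact: (congr1 (fun q : hom => q z) E').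
Qed.

Definition below f f' := forall g, S g -> algdisj f' g -> f * g ^+ 12 = g ^+ 12 * f.

(** If [f] moves a point outside [cl f'], an element of [S] supported in a small cone there is
    disjoint from [f'], yet its twelfth power does not commute with [f]. Conversely, [algdisj_power]
    keeps the support of [g ^+ 12] away from [cl f']. *)
Lemma belowP f f' : S f -> S f' -> below f f' <-> (forall x, f x <> x -> cl f' x).
Proof.
move=> Sf Sf'; split=> [H x fx|H g Sg f'g].
  apply: contrapT => f'x.
  have [m mP] : exists m, forall y, eqx m x y -> f' y = y.
    apply: contrapT => H1; apply: f'x => m; apply: contrapT => H2; apply: H1.
    by exists m => y xy; apply: contrapT => f'y; apply: H2; exists y.
  have [l lP] := moved_disj fx.
  have [w [w0 wx wP]] := cone_at x (maxn m l).
  have wf' y : wprefix w y -> f' y = y.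
    by move=> /wP /(eqx_le (leq_maxl m l)); exact: mP.
  have wf y z : wprefix w y -> wprefix w z -> f y <> z.
    by move=> /wP /(eqx_le (leq_maxr m l)) yx /wP /(eqx_le (leq_maxr m l)); exact: lP.
  have [g [Sg sg mg]] := large_cone SL w0.
  have [a [_ alo ahi]] := inner_point 0 wx.
  have [b [ba E]] := mg a 11%N alo ahi.
  have f'g : algdisj f' g.
    by apply: disj_algdisj => y f'y; apply: sg => /wf'.
  have sg12 : supp w (g ^+ 12).
    by elim: {b ba E} 12%N => [|i IH] //; rewrite expgS; apply: supp_mul.
  have Hc := H g Sg f'g; move: (g ^+ 12) Hc sg12 E => G Hc sG E.
  have := congr1 (fun q : hom => q (wcat w a)) Hc.
  rewrite /= E sG => [/hinj/esym/wcat_inj //|] H1.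
  exact: (wf _ _ (wprefix_wcat w a) H1).
apply: (@comm_disj _ _ (cl f') (fun x => (g ^+ 12) x <> x)) => [x|x|x f'x gx].
- by move=> f'x; apply: contrapT => /H.
- exact: contrapT.
- have [m mP] := moved_near gx; have [y [xy f'y]] := f'x m.
  by apply: (mP y xy); exact: algdisj_power f'g f'y.
Qed.

End Reconstruction.

(** * Automorphisms of a large subgroup are conjugations *)

Section Spatial.

Variables n r : nat.
Local Notation X := (cantor n.+2 r.+1).
Local Notation W := (word n.+2 r.+1).
Local Notation hom := (homeo X).
Implicit Types (x y z : X) (u v w : W) (f g h k s t : hom).

Local Open Scope group_scope.

Variable S : hom -> Prop.
Hypothesis SL : large S.

Let ST := large_T SL.
Let SM := large_mul SL.
Let SV := large_inv SL.
Let SJ := large_conj SL.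

(** An automorphism of [S] and its inverse, given by functions on all homeomorphisms because [S] is
    only a predicate. *)
Record autS (sg tu : hom -> hom) : Prop := AutS {
  autS_in : forall s, S s -> S (sg s);
  autS_inV : forall s, S s -> S (tu s);
  autS_mul : forall s t, S s -> S t -> sg (s * t) = sg s * sg t;
  autS_K : forall s, S s -> tu (sg s) = s;
  autS_VK : forall s, S s -> sg (tu s) = s }.

Lemma autS_sym sg tu : autS sg tu -> autS tu sg.
Proof.
case=> sS tS sM sK tK; split=> // s t Ss St.
by rewrite -{1}(tK s Ss) -{1}(tK t St) -sM ?sK //; [apply: SM|..]; exact: tS.
Qed.

Lemma cone_cl w : (0 < size w.2)%N -> exists s, S s /\ forall x, cl s x <-> wprefix w x.
Proof.
move=> w0; have [s [Ss ss ms]] := large_cone SL w0.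
exists s; split=> // x; split=> [sx|wx m].
  apply: contrapT => wx; have [y [/pre_eqx E]] := sx (size w.2); apply; apply: ss.
  by move=> /wprefixP wy; apply: wx; apply/wprefixP; rewrite E.
have [a [E alo ahi]] := inner_point m wx; exists (wcat w a); split=> //.
have [b [ba]] := ms a 0%N alo ahi; rewrite expg1 => -> /wcat_inj.
exact: ba.
Qed.

Lemma cl_conj f g x : cl f x -> cl (f ^ g) (g x).
Proof.
move=> fx m; have [l lP] := hom_mod g x m; have [y [/lP xy fy]] := fx l.
by exists (g y); split=> //; rewrite hconjE hmulK => /hinj.
Qed.

(** A homeomorphism that commutes with [S] preserves the closures of supports of its elements, among
    which are all small cones. *)
Lemma centralizer1 k : (forall s, S s -> k * s = s * k) -> k = 1.
Proof.
move=> kS; apply: homeo_ext => x; apply: contrapT => kx.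
have [m mP] := moved_disj kx.
have [w [w0 wx wP]] := cone_at x m; have [s [Ss ws]] := cone_cl w0.
have /wP xk : wprefix w (k x).
  apply/ws; have -> : s = s ^ k by rewrite /conjg -kS // mulKg.
  by apply: cl_conj; apply/ws.
by apply: (mP x (k x)) => //; apply: wP.
Qed.

Section Aut.

Variables sg tu : hom -> hom.
Hypothesis sgA : autS sg tu.

Let sgS := autS_in sgA.
Let tuS := autS_inV sgA.
Let sgM := autS_mul sgA.
Let sgK := autS_K sgA.
Let tuK := autS_VK sgA.

Lemma autS_one : sg 1 = 1.
Proof.
have S1 := large_one SL; apply: (@mulgI _ (sg 1)).
by rewrite -sgM // !mulg1.
Qed.

Lemma autS_invg s : S s -> sg s^-1 = (sg s)^-1.
Proof.
move=> Ss; apply: (@mulgI _ (sg s)); rewrite mulgV -sgM ?mulgV ?autS_one //.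
exact: SV.
Qed.

Lemma autS_exp s i : S s -> sg (s ^+ i) = sg s ^+ i.
Proof.
move=> Ss; elim: i => [|i IH]; first exact: autS_one.
by rewrite !expgS sgM ?IH //; exact: large_exp.
Qed.

Lemma autS_conj s t : S s -> S t -> sg (s ^ t) = sg s ^ sg t.
Proof.
by move=> Ss St; rewrite /conjg !sgM ?autS_invg //; (exact: SM || exact: SV).
Qed.

Lemma autS_commg s t : S s -> S t -> sg [~ s, t] = [~ sg s, sg t].
Proof.
move=> Ss St; rewrite /commg sgM ?autS_invg ?autS_conj //; first exact: SV.
by apply: SJ => //; exact: ST.
Qed.

Lemma autS_inj s t : S s -> S t -> sg s = sg t -> s = t.
Proof. by move=> Ss St E; rewrite -(sgK Ss) E sgK. Qed.

Lemma algdisj_aut f g : S f -> S g -> algdisj S f g -> algdisj S (sg f) (sg g).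
Proof.
move=> Sf Sg fg h Sh fh; have Sh' := tuS Sh.
have fh' : f * tu h <> tu h * f.
  by move=> E; apply: fh; rewrite -(tuK Sh) -!sgM // E.
have [f1 [f2 [Sf1 Sf2 f1g f2g [k1 kg]]]] := fg _ Sh' fh'.
have Sk : S [~ f1, [~ f2, tu h]] by do 2?[apply: large_commg => //].
have E : [~ sg f1, [~ sg f2, h]] = sg [~ f1, [~ f2, tu h]].
  rewrite autS_commg //; last exact: large_commg.
  by rewrite autS_commg // tuK.
exists (sg f1), (sg f2); rewrite E -!sgM // f1g f2g kg; split=> //; try exact: sgS.
split=> // F; apply: k1; apply: autS_inj => //; first exact: large_one.
by rewrite F autS_one.
Qed.

End Aut.

Section Below.

Variables sg tu : hom -> hom.
Hypothesis sgA : autS sg tu.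

Let sgS := autS_in sgA.
Let tuS := autS_inV sgA.

Lemma below_aut f f' : S f -> S f' -> below S f f' -> below S (sg f) (sg f').
Proof.
move=> Sf Sf' ff' g Sg f'g; have Sg' := tuS Sg.
have H : algdisj S f' (tu g).
  by rewrite -(autS_K sgA Sf'); apply: (algdisj_aut (autS_sym sgA)) => //; exact: sgS.
have E := ff' _ Sg' H.
have S12 := large_exp SL 12 Sg'.
rewrite -{1 2}(autS_VK sgA Sg) -(autS_exp sgA) //.
by rewrite -!(autS_mul sgA) // E.
Qed.

Lemma below_cl f f' : S f -> S f' -> below S f f' <-> (forall x, cl f x -> cl f' x).
Proof.
move=> Sf Sf'; rewrite belowP //; split=> H x.
  move=> fx; apply: cl_closed => m; have [y [xy fy]] := fx m.
  by exists y; split=> //; apply: H.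
by move=> /cl_moved /H.
Qed.

Lemma cl_aut f f' : S f -> S f' -> (forall x, cl f x -> cl f' x) ->
  forall x, cl (sg f) x -> cl (sg f') x.
Proof.
move=> Sf Sf' H; apply/below_cl; try exact: sgS.
by apply: below_aut => //; apply/below_cl.
Qed.

End Below.

Section Point.

Variables sg tu : hom -> hom.
Hypothesis sgA : autS sg tu.

Let sgS := autS_in sgA.
Let tuS := autS_inV sgA.
Let sgK := autS_K sgA.
Let tuK := autS_VK sgA.

(** The graph of the homeomorphism to be built. *)
Definition image_point x z := forall f, S f -> cl f x -> cl (sg f) z.

(** Elements of [S] whose supports shrink to [x] have images with nested nonempty closed supports,
    which share a point by compactness. This point works for every [f] because [cl f] is open: once
    it contains [x] it contains one of the shrinking cones. *)
Lemma image_point_ex x : exists z, image_point x z.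
Proof.
have /choice[F FP] : forall i, exists s, S s /\ forall y, cl s y <-> wprefix (pre i.+1 x) y.
  by move=> i; exact: cone_cl.
have [z zP] : exists z, forall i, cl (sg (F i)) z.
  apply: compactx => [i y|i|i y H].
  - apply: (cl_aut sgA) => [||p /(proj2 (FP _)) /wprefixP E]; try exact: (FP _).1.
    apply/(proj2 (FP _))/wprefixP; rewrite -[size _]/(size (stake i.+1 x.2)) size_stake.
    apply/pre_eqx; apply: (@eqx_le _ _ _ i.+2) => //; apply/pre_eqx.
    by move: E; rewrite -[size _]/(size (stake i.+2 x.2)) size_stake.
  - apply: contrapT => H; have SF := (FP i).1.
    have E : sg (F i) = 1.
      apply: homeo_ext => y; apply: contrapT => H'; apply: H.
      by exists y; exact: cl_moved.
    have FE : F i = 1.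
      by apply: (autS_inj sgA) => //; [exact: large_one|rewrite E (autS_one sgA)].
    have /(_ 0%N)[y [_]] : cl (F i) x by apply/(proj2 (FP i)); exact: wprefix_pre.
    by rewrite FE.
  - by apply: cl_closed => m; have [y1 [xy Hy]] := H m; exists y1.
exists z => f Sf fx; have [i iP] := cl_open (ST Sf) fx.
apply: (cl_aut sgA (f := F i)) => //; first exact: (FP i).1.
move=> y /(proj2 (FP _)) /wprefixP E; apply: iP.
apply: (@eqx_le _ _ _ i.+1) => //; apply/pre_eqx.
by move: E; rewrite -[size _]/(size (stake i.+1 x.2)) size_stake.
Qed.

End Point.

Section Homeo.

Variables sg tu : hom -> hom.
Hypothesis sgA : autS sg tu.

Let sgS := autS_in sgA.
Let tuS := autS_inV sgA.
Let sgK := autS_K sgA.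
Let tuK := autS_VK sgA.

(** Separate [z] from [z'] by a cone [u]. The preimage [e] of an element with support [u] stays away
    from [x], since otherwise [z'] would lie in [u]. But a small cone around [z] pulls back to a
    nonempty support that lies both in [cl e] and in a cone around [x] missing [cl e]. *)
Lemma image_point_uniq x z z' : image_point sg x z -> image_point sg x z' -> z = z'.
Proof.
move=> xz xz'; apply: contrapT => zz'.
have [m mP] := neq_eqx zz'.
have [u [u0 uz uP]] := cone_at z m; have [fu [Sfu fuP]] := cone_cl u0.
have zu' : ~ wprefix u z' by move=> /uP.
pose e := tu fu; have Se : S e by exact: tuS.
have ex : ~ cl e x by move=> /(xz' _ Se); rewrite tuK // => /fuP.
have [i iP] : exists i, forall y, eqx i x y -> ~ cl e y.
  apply: contrapT => H; apply: ex; apply: cl_closed => i; apply: contrapT => H'.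
  by apply: H; exists i => y xy ey; apply: H'; exists y.
have [w [w0 wx wP]] := cone_at x i; have [fw [Sfw fwP]] := cone_cl w0.
have wz : cl (sg fw) z by apply: xz => //; apply/fwP.
have [j jP] := cl_open (ST (sgS Sfw)) wz.
have [v [v0 vz vP]] := cone_at z (maxn j (size u.2)).
have [fv [Sfv fvP]] := cone_cl v0.
have Stv := tuS Sfv.
have H1 y : cl (tu fv) y -> cl fw y.
  rewrite -(sgK Sfw); apply: (cl_aut (autS_sym sgA)) => //; first exact: sgS.
  by move=> p /fvP /vP /(eqx_le (leq_maxl _ _)); exact: jP.
have H2 y : cl (tu fv) y -> cl e y.
  apply: (cl_aut (autS_sym sgA)) => // p /fvP /vP /(eqx_le (leq_maxr _ _)) /pre_eqx E.
  by apply/fuP/wprefixP; rewrite -E; apply/wprefixP.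
have [y yP] : exists y, cl (tu fv) y.
  have [y [vy _]] : exists y, image_point tu z y /\ True.
    by have [y] := image_point_ex (autS_sym sgA) z; exists y.
  by exists y; apply: vy => //; apply/fvP.
by apply: (iP y); [apply: wP; apply/fwP; exact: H1|exact: H2].
Qed.

End Homeo.

Lemma autS_homeo sg tu : autS sg tu -> exists h, forall s, S s -> sg s = s ^ h.
Proof.
move=> sgA; have tuA := autS_sym sgA.
have /choice[h hP] := image_point_ex sgA; have /choice[h' h'P] := image_point_ex tuA.
have K (sg' tu' : hom -> hom) (f f' : X -> X) : autS sg' tu' ->
    (forall x, image_point sg' x (f x)) -> (forall x, image_point tu' x (f' x)) -> cancel f f'.
  move=> A fP f'P x; apply: contrapT => /nesym/neq_eqx[m mP].
  have [w [w0 wx wP]] := cone_at x m; have [s [Ss sP]] := cone_cl w0.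
  have sx : cl s x by apply/sP.
  have := f'P _ _ (autS_in A Ss) (fP x s Ss sx).
  by rewrite (autS_K A) // => /sP /wP.
have C (sg' tu' : hom -> hom) (f f' : X -> X) : autS sg' tu' ->
    (forall x, image_point sg' x (f x)) -> (forall x, image_point tu' x (f' x)) -> continuous f.
  move=> A fP f'P; apply/continuousP_eqx => x m.
  have [w [w0 wx wP]] := cone_at (f x) m; have [s [Ss sP]] := cone_cl w0.
  have Ss' := autS_inV A Ss.
  have ex : cl (tu' s) x.
    by rewrite -(K _ _ f f' A fP f'P x); apply: f'P => //; apply/sP.
  have [k kP] := cl_open (ST Ss') ex; exists k => y /kP ey.
  by apply/wP/sP; rewrite -(autS_VK A Ss); exact: fP.
have hK := K _ _ _ _ sgA hP h'P; have h'K := K _ _ _ _ tuA h'P hP.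
have [H HE] := homeo_ex hK h'K (C _ _ _ _ sgA hP h'P) (C _ _ _ _ tuA h'P hP).
exists H => s Ss; apply: homeo_ext => z; rewrite hconjE.
set x := H^-1 z; have -> : z = h x by rewrite -HE hmulVK.
(* Both [h (s x)] and [sg s (h x)] are image points of [s x]; for the second, conjugate by [s]. *)
rewrite HE; apply/esym; apply: (image_point_uniq sgA (x := s x)) => // f Sf fx.
have -> : sg f = (sg (f ^ s^-1)) ^ sg s.
  by rewrite -(autS_conj sgA) ?conjgKV //; apply: SJ => //; apply: ST; exact: SV.
apply: cl_conj; apply: hP; first by apply: SJ => //; apply: ST; exact: SV.
by have := cl_conj s^-1 fx; rewrite hmulK.
Qed.

End Spatial.

(** * Orientation *)

Section Orientation.

Variables n r : nat.
Local Notation D := 'I_n.+2.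
Local Notation Y := (cantor_seq n.+2).
Local Notation X := (cantor n.+2 r.+1).
Local Notation W := (word n.+2 r.+1).
Local Notation inT := (@is_HigmanThompsonT n.+2 r.+1).
Local Notation hom := (homeo X).
Implicit Types (a b c x y z : X) (u v w : W) (f g h s t : hom).

Local Open Scope group_scope.

(** Leading zeros are consumed until the first letter is nonzero; from then on each step prefixes
    [max]. *)
Lemma Amap_iter_hi (x : Y) m : x <> @lo n -> exists j, eqs m (iter j (@Amap n) x) (@hi n).
Proof.
move=> /neq_first[p [_ xp]].
have [j jP] : exists j, (iter j (@Amap n) x 0%N : D) != ord0.
  have {}xp : exists i, (i <= p)%N /\ (x i : D) != ord0 by exists p; split=> //; apply/eqP.
  elim: p x xp => [|p IH] x [i [ip xi]].
    by exists 0%N; move: ip xi; rewrite leqn0 => /eqP ->.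
  have [x0|x0] := eqVneq (x 0%N : D) ord0; last by exists 0%N.
  have [x1|x1] := eqVneq (x 1%N : D) ord_max.
    by exists 1%N; rewrite /= /Amap x0 x1 /= eqxx.
  have AE : Amap x = sdrop 1 x by rewrite /Amap x0 eqxx (negbTE x1).
  have [|j jP] := IH (sdrop 1 x).
    case: i ip xi => [|i] ip xi; first by rewrite x0 eqxx in xi.
    by exists i.
  by exists j.+1; rewrite iterSr AE.
move: jP; set y := iter j _ x => y0; exists (m + j)%N; rewrite iterD -/y.
have H i : (iter i (@Amap n) y 0%N : D) != ord0 /\ eqs i (iter i (@Amap n) y) (@hi n).
  elim: i => [|i [IH1 IH2]] //=; rewrite {1 3}/Amap IH1; split=> // -[|l] //=.
  exact: IH2.
by have [] := H m.
Qed.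

Variable S : hom -> Prop.
Hypothesis SL : large S.

Let SJ := large_conj SL.

(** A rotation carries some [zcone v 0] of the same depth to [u]; its depth is two more than that of
    the nonempty [v], whence the bound. *)
Lemma large_agree_cone u f x y : (2 < size u.2)%N -> inT f -> supp u f ->
  exists s, [/\ S s, forall z, wprefix u z -> s z = f z, s x = f x & s y = f y].
Proof.
move=> u2 Tf sf.
pose v : W := (ord0, nseq (size u.2).-2 (@ord0 n.+1)).
have zs : size (zcone v 0).2 = size u.2.
  have -> : size (zcone v 0).2 = ((size u.2).-2 + 2)%N by rewrite /zcone /= size_cat size_nseq.
  by move: u2; case: (size _) => [|[|k]] //= _; rewrite addn2.
have [g Tg gE] := sends_depth (esym zs).
have Tf' : inT (f ^ g) by exact: isT_conj.
have sf' : supp (zcone v 0) (f ^ g) by exact: sends_supp gE sf.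
have v0 : (0 < size v.2)%N by move: u2; rewrite /= size_nseq; case: (size _) => [|[|[|k]]].
have [s [Ss su sx sy]] := large_agree SL (g x) (g y) v0 Tf' sf'.
exists (s ^ g^-1); split.
- by apply: SJ => //; exact: isT_inv.
- move=> z [p ->]; rewrite hconjE invgK gE su; last exact: wprefix_wcat.
  by rewrite hconjE -gE !hmulK.
- by rewrite hconjE invgK sx hconjE !hmulK.
- by rewrite hconjE invgK sy hconjE !hmulK.
Qed.

Definition good h := forall s, S s -> inT (s ^ h).

Lemma good_mul g h : inT g -> good h -> good (g * h).
Proof. by move=> Tg hS s Ss; rewrite conjgM; apply: hS; exact: SJ. Qed.

Definition hcyc h a b c := cyc (h a) (h b) (h c).

Lemma cycp_iff g a b c : inT g -> cyc (g a) (g b) (g c) <-> cyc a b c.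
Proof.
move=> Tg; split=> [H|]; last exact: isT_cycp.
by have := isT_cycp (isT_inv Tg) H; rewrite !hmulK.
Qed.

Lemma hcyc_inv h s a b c : good h -> S s -> hcyc h (s a) (s b) (s c) <-> hcyc h a b c.
Proof.
move=> hS Ss; have E1 x : h (s x) = (s ^ h) (h x) by rewrite hconjE hmulK.
by rewrite /hcyc !E1; apply: cycp_iff; exact: hS.
Qed.

Lemma xlt_near x y : x <> y -> exists m, forall z, eqx m y z ->
  (xlt x z <-> xlt x y) /\ (xlt z x <-> xlt y x).
Proof.
move=> /neq_eqx[m mP]; exists m => z yz; pose w := pre m y.
have wx : ~ wprefix w x.
  move=> /wprefixP; rewrite -[size _]/(size (stake m y.2)) size_stake => F.
  by apply: mP; apply/pre_eqx.
have [p yE] : wprefix w y by exact: wprefix_pre.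
have [q zE] : wprefix w z.
  apply/wprefixP; rewrite -[size _]/(size (stake m y.2)) size_stake.
  exact/pre_eqx.
by rewrite yE zE; split; split=> L; (exact: xcone_gt L wx || exact: xcone_lt L wx).
Qed.

Lemma hcyc_near h a b c : a <> c -> b <> c -> exists m, forall z, eqx m c z ->
  (hcyc h a b z <-> hcyc h a b c).
Proof.
move=> ac bc; have [m mP] := @xlt_near (h a) (h c) (fun F => ac (hinj F)).
have [l lP] := @xlt_near (h b) (h c) (fun F => bc (hinj F)).
have [i iP] := hom_mod h c (maxn m l); exists i => z /iP cz.
have [A B] := mP _ (eqx_le (leq_maxl _ _) cz).
have [A' B'] := lP _ (eqx_le (leq_maxr _ _) cz).
by rewrite /hcyc /cyc; tauto.
Qed.

(** Elements of [S] that act as [hA u] on the cone and fix [a] and [b] push [c] to the upper end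
    without changing the orientation of the images; continuity of [h] concludes. The lower end,
    fixed by [hA u], is first replaced by a nearby point. *)
Lemma hcyc_cone h u a b c : good h -> (2 < size u.2)%N -> ~ wprefix u a -> ~ wprefix u b ->
  wprefix u c -> hcyc h a b c <-> hcyc h a b (wcat u (@hi n)).
Proof.
move=> hS u2 ua ub.
have [s [Ss su sa sb]] := large_agree_cone a b u2 (@hA_T _ _ u) (@hA_supp _ _ u).
rewrite (hA_supp ua) in sa; rewrite (hA_supp ub) in sb.
have ac p : a <> wcat u p by move=> F; apply: ua; exists p.
have bc p : b <> wcat u p by move=> F; apply: ub; exists p.
have step j p : hcyc h a b (wcat u (iter j (@Amap n) p)) <-> hcyc h a b (wcat u p).
  elim: j => //= j <-; rewrite -hAE -su; last exact: wprefix_wcat.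
  by rewrite -[X in hcyc _ X _ _]sa -[X in hcyc _ _ X _]sb; apply: hcyc_inv.
have [m mP] := hcyc_near h (ac (@hi n)) (bc (@hi n)).
have H p : p <> @lo n -> hcyc h a b (wcat u p) <-> hcyc h a b (wcat u (@hi n)).
  move=> /(@Amap_iter_hi _ m)[j jP]; rewrite -(step j) mP //; split=> //=.
  by apply: eqs_le (leq_addl _ _) _; apply: eqs_prepend; exact: eqs_sym jP.
move=> [p ->]; have [pE|pE] := pselect (p = @lo n); last exact: H.
have [l lP] := hcyc_near h (ac p) (bc p).
have [q [qE qlo qhi]] := inner_point l (wprefix_wcat u p).
by rewrite -(lP _ qE); exact: H.
Qed.

Lemma first_words k (U : seq W) w0 : sorted <%O U ->
  (forall w, (w \in U) = (size w.2 == k.+1)) -> (1 < size U)%N ->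
  nth w0 U 0 = (ord0, nseq k.+1 ord0) /\ nth w0 U 1 = (ord0, rcons (nseq k ord0) (@o1 n)).
Proof.
move=> sU mU U1; have U0 := ltnW U1.
have sU' i j : (i < j < size U)%N -> (nth w0 U i < nth w0 U j)%O.
  move=> /andP[ij jU]; apply: (sorted_ltn_nth lt_trans) => //; rewrite inE //.
  exact: ltn_trans jU.
have nU i : (i < size U)%N -> size (nth w0 U i).2 = k.+1.
  by move=> iU; apply/eqP; rewrite -mU mem_nth.
pose p : W := (ord0, nseq k.+1 ord0); pose q : W := (ord0, rcons (nseq k ord0) (@o1 n)).
have pU : p \in U by rewrite mU size_nseq.
have qU : q \in U by rewrite mU size_rcons size_nseq.
have sp w : size w.2 = k.+1 -> ~ (w < p)%O.
  move=> wk wp; have wpD : disj w p.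
    apply: pre_disj; first by rewrite wk size_nseq.
    by move=> F; move: wp; rewrite F ltxx.
  have := @wlt_xlt _ _ _ _ (@lo n) (@lo n) wp wpD.
  have -> : wcat p (@lo n) = (ord0, @lo n).
    rewrite /wcat /=; congr pair; apply/funext => -[|i] //=.
    by rewrite prependE nth_nseq !if_same.
  by move=> [//|[_ [i [_]]]].
have E0 : nth w0 U 0 = p.
  have := index_mem p U; rewrite pU; case: (posnP (index p U)) => [F _|F pi].
    by rewrite -F nth_index.
  have := sU' 0%N (index p U); rewrite F nth_index // => /(_ pi) L.
  by case: (sp _ (nU _ U0)).
split=> //.
have pq : p <> q.
  move=> [/(congr1 (fun l : seq D => nth (@ord0 n.+1) l k))].
  rewrite -[ord0 :: nseq k ord0]/(nseq k.+1 ord0) nth_nseq ltnSn nth_rcons size_nseq ltnn eqxx => F.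
  by have := o1_neq0 n; rewrite -F eqxx.
have qi : (0 < index q U)%N.
  rewrite lt0n; apply/eqP => F; apply: pq; rewrite -E0 -F.
  by rewrite nth_index.
have [F|F] := eqVneq (index q U) 1%N; first by rewrite -F nth_index.
have L : (nth w0 U 1 < q)%O.
  by rewrite -(nth_index w0 qU); apply: sU'; rewrite index_mem qU; lia.
have H := sU' 0%N 1%N U1; have n1 := nU _ U1; move: L H n1.
set w := nth w0 U 1; rewrite E0 => wq pw wk; exfalso.
have wqD : disj w q.
  apply: pre_disj; first by rewrite wk size_rcons size_nseq.
  by move=> G; move: wq; rewrite G ltxx.
have := @wlt_xlt _ _ _ _ (@lo n) (@lo n) wq wqD.
case=> [//|[/= w1 [i [E1 L1]]]].
suff G : w = p by move: pw; rewrite G ltxx.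
have qE j : prepend (rcons (nseq k (@ord0 n.+1)) (@o1 n)) (@lo n) j = if j == k then @o1 n else ord0.
  rewrite prependE size_rcons size_nseq nth_rcons size_nseq nth_nseq.
  by rewrite ltnS if_same; case: ltngtP.
have ik : i = k.
  apply: contrapT => /eqP ik; move: L1; rewrite /dig /= qE (negbTE ik).
  by rewrite ltn0.
subst i; case: w wk w1 E1 L1 {wq pw wqD} => e s /= sk -> E1 L1.
congr pair; apply: (@eq_from_nth _ ord0); first by rewrite sk size_nseq.
move=> j; rewrite sk => jk; rewrite nth_nseq jk; move: jk; rewrite ltnS => jk.
move: jk; rewrite leq_eqVlt => /orP[/eqP ->|jk].
  move: L1; rewrite /dig /= qE eqxx prependE sk ltnSn => L1.
  by apply: ord_inj; move: L1; rewrite val_o1; case: (nat_of_ord _).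
by have := E1 j jk; rewrite qE (ltn_eqF jk) prependE sk ltnS (ltnW jk).
Qed.

Lemma rot_power k : exists g (U : seq W), [/\ inT g, sorted <%O U, complete_antichain U,
  forall w, (w \in U) = (size w.2 == k) &
  forall i j w0, (i < size U)%N -> sends (g ^+ j) (nth w0 U i) (nth w0 U ((i + j) %% size U))].
Proof.
have [g [U [Tg sU cU mU gE]]] := rot_ex n r k; exists g, U; split=> // i j w0 iU.
elim: j => [|j IH] p; first by rewrite expg0 addn0 modn_small.
have M0 : (0 < size U)%N by exact: leq_ltn_trans iU.
by rewrite expgSr hmulE IH gE ?ltn_mod // modnDml -addnA addn1.
Qed.

(** By [hcyc_cone] the orientation only depends on the cone of [c] at a fixed depth. A conjugate of
    an element of [S] acting as [hC v] fixes [a] and [b] and carries a point of one cone of the arc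
    into the next one, so the orientation is constant along the arc. *)
Lemma hcyc_arc h a b c c' : good h -> cyc a b c -> cyc a b c' -> hcyc h a b c <-> hcyc h a b c'.
Proof.
have [m0 dist] : exists m0, forall m, (m0 <= m)%N -> cyc a b c -> cyc a b c' ->
    [/\ pre m a <> pre m b, pre m a <> pre m c, pre m b <> pre m c,
        pre m a <> pre m c' & pre m b <> pre m c'].
  have N x y : exists m0, forall m, (m0 <= m)%N -> x <> y -> pre m x <> pre m y.
    have [->|/neq_eqx[m mP]] := pselect (x = y); first by exists 0%N.
    by exists m => l ml _ /pre_eqx /(eqx_le ml).
  have [m1 H1] := N a b; have [m2 H2] := N a c; have [m3 H3] := N b c.
  have [m4 H4] := N a c'; have [m5 H5] := N b c'.
  exists (m1 + m2 + m3 + m4 + m5)%N => m mm /cyc_neq[ab [bc ac]] /cyc_neq[_ [bc' ac']].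
  by split; [apply: H1|apply: H2|apply: H3|apply: H4|apply: H5] => //; lia.
(* The summand 4 makes words of length [k] and [k - 1] long enough for [large_agree_cone]. *)
move=> hS abc abc'; pose k := (m0 + 4)%N.
have [ab ac bc ac' bc'] := dist k (leq_addr _ _) abc abc'.
have [g [U [Tg sU cU mU gE]]] := rot_power k.
pose w0 : W := (ord0, [::]); pose M := size U.
have pU x : pre k x \in U by rewrite mU /= size_stake.
have M0 : (0 < M)%N by have := pU a; rewrite /M; case: (U).
(* Once [b] is rotated into the first cone, the arc from [b] to [a] is an interval of indices; [h]
   becomes [G^-1 * h], which is still good. *)
wlog ib : h a b c c' hS abc abc' ab ac bc ac' bc' {dist} / index (pre k b) U = 0%N.
  move=> H; pose j := (M - index (pre k b) U)%N; pose G := g ^+ j.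
  have TG : inT G by exact: isT_exp.
  have idx x : index (pre k (G x)) U = ((index (pre k x) U + j) %% M)%N.
    have iM : (index (pre k x) U < M)%N by rewrite index_mem.
    have := gE _ j w0 iM (sdrop k x.2); rewrite nth_index // wcat_pre => ->.
    set v := nth w0 U _; have vU : v \in U by rewrite mem_nth // ltn_mod.
    have -> : pre k (wcat v (sdrop k x.2)) = v.
      have /wprefixP := wprefix_wcat v (sdrop k x.2).
      by move: vU; rewrite mU => /eqP ->.
    by rewrite index_uniq ?ltn_mod //; exact: lt_sorted_uniq.
  have ne x y : pre k x <> pre k y -> pre k (G x) <> pre k (G y).
    move=> xy F; apply: xy; rewrite -(nth_index w0 (pU x)) -(nth_index w0 (pU y)).
    congr nth; have := idx x; rewrite F idx => /eqP; rewrite eqn_modDr.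
    by rewrite !modn_small ?index_mem // => /eqP.
  have hG : good (G^-1 * h) by apply: good_mul => //; exact: isT_inv.
  have EG x y z : hcyc (G^-1 * h) (G x) (G y) (G z) <-> hcyc h x y z.
    by rewrite /hcyc !hmulE !hmulK.
  rewrite -EG -(EG a b c'); apply: H => //; try exact: isT_cycp; try exact: ne.
  by rewrite idx /j subnKC ?modnn // ltnW // index_mem.
pose i x := index (pre k x) U.
have xE x : x = wcat (nth w0 U (i x)) (sdrop k x.2) by rewrite nth_index // wcat_pre.
have iM x : (i x < M)%N by rewrite index_mem.
have ilt x y : (i x < i y)%N -> xlt x y.
  move=> L; rewrite (xE x) (xE y).
  have L' : (nth w0 U (i x) < nth w0 U (i y))%O.
    by apply: (sorted_ltn_nth lt_trans) => //; rewrite inE; exact: iM.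
  apply: wlt_xlt => //; apply: (complete_disj cU); rewrite ?mem_nth ?iM //.
  by move=> F; move: L'; rewrite F ltxx.
have ine x y : pre k x <> pre k y -> i x <> i y.
  by move=> xy F; apply: xy; rewrite -(nth_index w0 (pU x)) -(nth_index w0 (pU y)) -/(i x) F.
have pos x : cyc a b x -> pre k a <> pre k x -> pre k b <> pre k x -> (0 < i x < i a)%N.
  move=> abx ax bx; have ix : (0 < i x)%N by have := ine _ _ bx; rewrite {1}/i ib; lia.
  have ia : (0 < i a)%N by have := ine _ _ ab; rewrite {2}/i ib; lia.
  rewrite ix /= ltn_neqAle; apply/andP; split; first by apply/eqP => F; exact: (ine _ _ ax).
  have ba : xlt b a by apply: ilt; rewrite {1}/i ib.
  have bx' : xlt b x by apply: ilt; rewrite {1}/i ib.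
  rewrite leqNgt; apply/negP => /ilt L.
  have [[A _]|[[_ A]|[_ A]]] := abx.
  - exact: xlt_asym ba A.
  - exact: xlt_asym L A.
  - exact: xlt_asym ba A.
pose R j := wcat (nth w0 U j) (@hi n).
have sz j : (j < M)%N -> size (nth w0 U j).2 = k by move=> jM; apply/eqP; rewrite -mU mem_nth.
have out j x : (j < M)%N -> i x <> j -> ~ wprefix (nth w0 U j) x.
  move=> jM F /wprefixP; rewrite sz // => G; apply: F.
  by rewrite /i -G index_uniq //; exact: lt_sorted_uniq.
have k2 j : (j < M)%N -> (2 < size (nth w0 U j).2)%N by move=> /sz ->; rewrite /k; lia.
have toR x : (0 < i x < i a)%N -> hcyc h a b x <-> hcyc h a b (R (i x)).
  move=> /andP[x0 xa]; apply: hcyc_cone => //; first exact: k2.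
  - by apply: out => //; lia.
  - by apply: out => //; rewrite {1}/i ib; lia.
  - by exists (sdrop k x.2).
have step j : (0 < j)%N -> (j.+1 < i a)%N -> hcyc h a b (R j) <-> hcyc h a b (R j.+1).
  move=> j0 ja; have jM : (j.+1 < M)%N by apply: ltn_trans ja _.
  have M1 : (1 < M)%N by lia.
  have [k' kE] : exists k', k = k'.+1 by exists k.-1; rewrite prednK // /k addn4.
  have mU' w : (w \in U) = (size w.2 == k'.+1) by rewrite mU kE.
  have [U0E U1E] := first_words w0 sU mU' M1.
  pose v : W := (ord0, nseq k' ord0).
  have v0E : nth w0 U 0 = wext v [:: ord0].
    by rewrite U0E /wext -[X in nseq X]addn1 nseqD.
  have v1E : nth w0 U 1 = wext v [:: @o1 n] by rewrite U1E /wext /= cats1.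
  pose G := g ^+ j.
  have G0 : sends G (wext v [:: ord0]) (nth w0 U j).
    by have := gE 0%N j w0 M0; rewrite v0E add0n modn_small // ltnW.
  have G1 : sends G (wext v [:: @o1 n]) (nth w0 U j.+1).
    by have := gE 1%N j w0 M1; rewrite v1E add1n modn_small.
  have TG : inT G by exact: isT_exp.
  have v2 : (2 < size v.2)%N by rewrite /= size_nseq; rewrite /k in kE; lia.
  have [s [Ss sv sa sb]] := large_agree_cone (G^-1 a) (G^-1 b) v2 (@hC_T _ _ v) (@hC_supp _ _ v).
  have fixC x : i x <> j -> i x <> j.+1 -> hC v (G^-1 x) = G^-1 x.
    move=> xj xj1; have [[p pE]|/hC_supp //] := pselect (wprefix v (G^-1 x)).
    rewrite pE hCE; congr wcat; rewrite /Cmap.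
    have [p0|p0] := eqVneq (p 0%N : D) ord0.
      case: (@out j x) => //; first exact: ltnW.
      exists (sdrop 1 p); rewrite -(hmulVK G x) pE -G0 wcat_wext; congr (G (wcat v _)).
      by rewrite -{1}(scons_eta p) [X in scons X]p0.
    have [p1|//] := eqVneq (p 0%N : D) (@o1 n).
    case: (@out j.+1 x) => //.
    exists (sdrop 1 p); rewrite -(hmulVK G x) pE -G1 wcat_wext; congr (G (wcat v _)).
    by rewrite -{1}(scons_eta p) [X in scons X]p1.
  have ia' : i a <> j /\ i a <> j.+1 by lia.
  have ib' : i b <> j /\ i b <> j.+1 by rewrite /i ib; lia.
  pose t := s ^ G; have St : S t by exact: SJ.
  have ta : t a = a by rewrite /t hconjE sa fixC ?hmulVK; tauto.
  have tb : t b = b by rewrite /t hconjE sb fixC ?hmulVK; tauto.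
  (* Seen through [G], this is the passage from [v 01 hi] to [v 10 hi], across the border between
     the cones of [v 0] and [v 1]. *)
  pose p := wcat (nth w0 U j) (scons (@o1 n) (@hi n)).
  have tp : t p = wcat (nth w0 U j.+1) (scons ord0 (@hi n)).
    rewrite /t /p hconjE -G0 hmulK wcat_wext sv; last exact: wprefix_wcat.
    rewrite hCE /Cmap /= (negbTE (o1_neq0 n)) -G1 wcat_wext; congr (G (wcat v (scons _ (scons _ _)))).
    by apply: ord_inj; rewrite inord_pred val_o1.
  have ip : i p = j.
    rewrite /i; have /wprefixP := wprefix_wcat (nth w0 U j) (scons (@o1 n) (@hi n)).
    by rewrite sz ?(ltnW jM) // -/p => <-; rewrite index_uniq ?(ltnW jM) //; exact: lt_sorted_uniq.
  have itp : i (t p) = j.+1.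
    rewrite /i tp; have /wprefixP := wprefix_wcat (nth w0 U j.+1) (scons ord0 (@hi n)).
    by rewrite sz // => <-; rewrite index_uniq //; exact: lt_sorted_uniq.
  rewrite -ip -toR ?ip; last lia.
  have -> : R j.+1 = R (i (t p)) by rewrite itp.
  rewrite -toR ?itp; last lia.
  by rewrite -{2}ta -{2}tb hcyc_inv.
have all j l : (0 < j)%N -> (j + l < i a)%N -> hcyc h a b (R j) <-> hcyc h a b (R (j + l)).
  move=> j0; elim: l => [|l IH] jl; first by rewrite addn0.
  rewrite IH; last lia.
  by rewrite addnS; apply: step; lia.
have c1 := pos _ abc ac bc; have c2 := pos _ abc' ac' bc'.
rewrite (toR _ c1) (toR _ c2).
case: (leqP (i c) (i c')) => L.
  by rewrite -(subnKC L); apply: all; lia.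
by rewrite -(subnKC (ltnW L)); apply: iff_sym; apply: all; lia.
Qed.

Definition revp h := forall a b c, cyc a b c -> cyc (h c) (h b) (h a).

(** By [hcyc_arc] the points of a positively oriented triple can be moved one at a time to the
    reference triple [q], [m], [e], so [h] treats all such triples alike. *)
Lemma orientation h : good h -> cycp h \/ revp h.
Proof.
move=> hS; pose q : X := @xmin n r; pose e : X := @xmax n r.
have qmin x : x <> q -> xlt q x by exact: xmin_lt.
have emax x : x <> e -> xlt x e by exact: xmax_gt.
pose m : X := (ord0, scons ord0 (@hi n)).
have qm : xlt q m.
  apply: qmin => -[/(congr1 (@^~ 1%N))] //.
have me : xlt m e.
  by apply: emax => -[_ /(congr1 (@^~ 0%N))].
have Erot a b c : hcyc h a b c <-> hcyc h b c a.
  by split; [exact: cyc_rot|move=> H; do 2?[apply: cyc_rot]].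
have key a b c : xlt a b -> xlt b c -> hcyc h a b c <-> hcyc h q m e.
  move=> ab bc.
  have qb : xlt q b by have [<- //|/qmin aq] := pselect (a = q); exact: xlt_trans ab.
  have -> : hcyc h a b c <-> hcyc h q b c.
    have [-> //|aq] := pselect (a = q).
    rewrite Erot (Erot q); apply: hcyc_arc => //; rewrite /cyc; first by tauto.
    by tauto.
  have be : xlt b e by have [<- //|/emax ce] := pselect (c = e); exact: xlt_trans ce.
  have -> : hcyc h q b c <-> hcyc h q b e.
    have [-> //|ce] := pselect (c = e).
    by apply: hcyc_arc => //; rewrite /cyc; tauto.
  rewrite -(Erot e q b) -(Erot e q m).
  by apply: hcyc_arc => //; rewrite /cyc; tauto.
have keyc a b c : cyc a b c -> hcyc h a b c <-> hcyc h q m e.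
  move=> [[A B]|[[A B]|[A B]]]; first exact: key.
    by rewrite Erot; exact: key.
  by rewrite -Erot; exact: key.
have [P|P] := pselect (hcyc h q m e); [left|right] => a b c abc.
  by apply/keyc.
have [ab [bc ac]] := cyc_neq abc.
have [H|//] := @cyc_total _ _ (h a) (h b) (h c) (fun F => ab (hinj F))
  (fun F => bc (hinj F)) (fun F => ac (hinj F)).
by case: P; apply/(keyc a b c).
Qed.

End Orientation.

(** * T modulo a large normal subgroup *)

Section Classes.

Variables n r : nat.
Local Notation X := (cantor n.+2 r.+1).
Local Notation W := (word n.+2 r.+1).
Local Notation inT := (@is_HigmanThompsonT n.+2 r.+1).
Local Notation hom := (homeo X).
Implicit Types (x y z : X) (u v w : W) (f g h s t : hom).

Local Open Scope group_scope.

Variable S : hom -> Prop.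
Hypothesis SL : large S.

Let SM := large_mul SL.
Let SV := large_inv SL.
Let SJ := large_conj SL.

(** Equivalence of cones under [S]. Since [T] normalizes [S], elements of [T] respect it
    ([weq_sends]). *)
Definition weq w v := exists s, S s /\ sends s w v.

Lemma weq_refl w : weq w w.
Proof. by exists 1; split; [exact: large_one|]. Qed.

Lemma weq_sym w v : weq w v -> weq v w.
Proof. by move=> [s [Ss sE]]; exists s^-1; split; [exact: SV|exact: sends_inv]. Qed.

Lemma weq_trans v u w : weq u v -> weq v w -> weq u w.
Proof.
by move=> [s [Ss sE]] [t [St tE]]; exists (s * t); split; [exact: SM|exact: sends_mul tE].
Qed.

Lemma weq_ext w v p : weq w v -> weq (wext w p) (wext v p).
Proof. by move=> [s [Ss sE]]; exists s; split=> //; exact: sends_ext. Qed.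

Lemma weq_sends g w w' v v' : inT g -> sends g w w' -> sends g v v' ->
  weq w v -> weq w' v'.
Proof.
move=> Tg gw gv [s [Ss sE]]; exists (s ^ g); split; first exact: SJ.
by move=> a; rewrite hconjE -gw hmulK sE gv.
Qed.

Let e : W := (ord0, nseq 3 ord0).

(** [Cmap] replaces [00] by [0], and transitivity of [T] on cones carries this to every [w];
    [weq_top] exploits [1 -> 1 max] in the same way. *)
Lemma weq_zero w : (0 < size w.2)%N -> weq (wext w [:: ord0]) w.
Proof.
move=> w0; have [g Tg gE] := @sends_ex _ _ (wext e [:: ord0]) w isT w0.
have [s [Ss sE _ _]] := large_agree_cone SL (wcat e (@lo n)) (wcat e (@lo n)) (isT : 2 < size e.2)
  (@hC_T _ _ e) (@hC_supp _ _ e).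
apply: (weq_sends Tg (sends_ext [:: ord0] gE) gE); exists s; split=> // a.
by rewrite !wcat_wext sE ?hCE //; exact: wprefix_wcat.
Qed.

Lemma weq_top w : (0 < size w.2)%N -> weq w (wext w [:: ord_max]).
Proof.
move=> w0; have [g Tg gE] := @sends_ex _ _ (wext e [:: @o1 n]) w isT w0.
have [s [Ss sE _ _]] := large_agree_cone SL (wcat e (@lo n)) (wcat e (@lo n)) (isT : 2 < size e.2)
  (@hC_T _ _ e) (@hC_supp _ _ e).
apply: (weq_sends Tg gE (sends_ext [:: ord_max] gE)); exists s; split=> // a.
rewrite !wcat_wext sE ?hCE; last exact: wprefix_wcat.
by rewrite /Cmap /= (negbTE (o1_neq0 n)) eqxx.
Qed.

Definition zw k : W := (ord0, nseq k (@ord0 n.+1)).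
Definition ones w i : W := wext w (nseq i (@o1 n)).

Lemma weq_zw k l : (0 < k)%N -> weq (zw (k + l)) (zw k).
Proof.
move=> k0; elim: l => [|l IH]; first by rewrite addn0; exact: weq_refl.
apply: weq_trans IH; rewrite addnS.
have -> : zw (k + l).+1 = wext (zw (k + l)) [:: ord0].
  by rewrite /zw /wext -[X in nseq X]addn1 nseqD.
by apply: weq_zero; rewrite /= size_nseq ltn_addr.
Qed.

Lemma ones_add w i j : ones (ones w i) j = ones w (i + j).
Proof. by rewrite /ones wextA -nseqD. Qed.

(** [Cmap] turns [v 01] into [v 10], so a word of the list followed by 1 is equivalent to the next
    word followed by 0, hence to the next word. Going once around the list returns to the first word
    with as many ones as there are words. *)
Lemma depth_classes k : (3 < k)%N -> exists c (U : seq W), [/\ inT c, c ^+ size U = 1,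
  forall w, (w \in U) = (size w.2 == k),
  forall i w0, (i < size U)%N -> sends c (nth w0 U i) (nth w0 U ((i + 1) %% size U)) &
  [/\ (1 < size U)%N, nth (zw k) U 0 = zw k,
   weq (ones (zw k) (size U)) (zw k) &
  forall i w0, (i < size U)%N -> weq (nth w0 U i) (ones (zw k) i)]].
Proof.
move=> k3; have [g [U [Tg sU cU mU gE]]] := rot_power n r k.
have [k' kE] : exists k', k = k'.+1 by exists k.-1; case: (k) k3.
have uU : uniq U by exact: lt_sorted_uniq.
pose w0 : W := zw k; pose M := size U.
have M1 : (1 < M)%N.
  pose p : W := zw k; pose q : W := (ord0, nseq k ord_max).
  have /uniq_leq_size H : uniq [:: p; q].
    by rewrite /= inE andbT /p /q /zw kE; apply/eqP => -[].
  apply: (H U) => v; rewrite !inE mU => /orP[] /eqP ->; by rewrite size_nseq.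
have M0 := ltnW M1.
have mU' w : (w \in U) = (size w.2 == k'.+1) by rewrite mU kE.
have [U0E U1E] := first_words w0 sU mU' M1.
pose v : W := zw k'.
have v0E : nth w0 U 0 = wext v [:: ord0].
  by rewrite U0E /wext -[X in nseq X]addn1 nseqD.
have v1E : nth w0 U 1 = wext v [:: @o1 n] by rewrite U1E /wext /= cats1.
have zv : wext v [:: ord0] = zw k by rewrite -v0E U0E kE.
have v2 : (2 < size v.2)%N by rewrite /= size_nseq -ltnS -kE.
have [s [Ss sE _ _]] := large_agree_cone SL (wcat v (@lo n)) (wcat v (@lo n)) v2
  (@hC_T _ _ v) (@hC_supp _ _ v).
have v01 : weq (wext (wext v [:: ord0]) [:: @o1 n]) (wext (wext v [:: @o1 n]) [:: ord0]).
  exists s; split=> // a; rewrite !wcat_wext sE ?hCE; last exact: wprefix_wcat.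
  rewrite /Cmap /= (negbTE (o1_neq0 n)) sdrop_scons2; congr (wcat v (scons _ (scons _ _))).
  by apply: ord_inj; rewrite inord_pred val_o1.
have sz i w1 : (i < M)%N -> (0 < size (nth w1 U i).2)%N.
  by move=> iM; move: (mem_nth w1 iM); rewrite mU => /eqP ->; rewrite kE.
have step i : (i < M)%N -> weq (nth w0 U ((1 + i) %% M)) (ones (nth w0 U i) 1).
  move=> iM; apply: weq_sym.
  have G0 := gE 0%N i w0 M0; have G1 := gE 1%N i w0 M1.
  rewrite v0E add0n modn_small // in G0; rewrite v1E in G1.
  apply: (@weq_trans (wext (nth w0 U ((1 + i) %% M)) [:: ord0])); last first.
    by apply: weq_zero; apply: sz; rewrite ltn_mod.
  have Tgi := isT_exp i Tg.
  exact: (weq_sends Tgi (sends_ext _ G0) (sends_ext _ G1) v01).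
have iE i : (i < M)%N -> weq (nth w0 U i) (ones (zw k) i).
  elim: i => [|i IH] iM.
    by rewrite U0E -kE /ones /wext cats0; exact: weq_refl.
  have := step i (ltnW iM); rewrite add1n modn_small // => H; apply: weq_trans H _.
  have -> : ones (zw k) i.+1 = ones (ones (zw k) i) 1 by rewrite ones_add addn1.
  by apply: weq_ext; exact: IH (ltnW iM).
exists g, U; split=> //.
- apply: homeo_ext => x; have [u [[uU' [a ->]] _]] := cU x.
  have iu : (index u U < M)%N by rewrite index_mem.
  have := gE _ M w0 iu a; rewrite nth_index // modnDr modn_small // nth_index //.
- by move=> i w1 iM; have := gE i 1%N w1 iM; rewrite expg1.
split=> //; first by rewrite -[zw k]/w0 U0E /w0 kE.
- have M' : (M.-1 < M)%N by rewrite prednK.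
  have := step _ M'; rewrite add1n prednK // modnn v0E zv => /weq_sym; apply: weq_trans.
  have -> : ones (zw k) M = ones (ones (zw k) M.-1) 1 by rewrite ones_add addn1 prednK.
  by apply: weq_ext; apply: weq_sym; exact: iE.
- by move=> i w1 iM; rewrite (set_nth_default w0) //; exact: iE.
Qed.

Definition locS t := forall x, exists s m, S s /\ forall y, eqx m x y -> t y = s y.

(* All deep words are equivalent to some [zw 4] followed by ones; both the       *)
(* rotation of depth 4 and the extension by a letter one shift this exponent.    *)
Lemma T_mod : exists c M, [/\ inT c, (0 < M)%N, c ^+ M = 1 &
  forall t, inT t -> exists i, locS (t * c ^+ i) /\ (n = 0%N -> locS t)].
Proof.
have [c [U [Tc cM mU cE [M1 U0 UM UE]]]] := depth_classes (isT : 3 < 4).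
pose a := zw 4; pose M := size U; have M0 : (0 < M)%N by exact: ltnW.
have mod i j : weq (ones a (i + j * M)) (ones a i).
  elim: j => [|j IH]; first by rewrite addn0; exact: weq_refl.
  apply: weq_trans IH; rewrite mulSn addnCA -(ones_add a M); exact: weq_ext UM.
have deep w : (3 < size w.2)%N -> exists i, weq w (ones a i).
  move=> w3; have [c' [U' [_ _ mU' _ [_ _ _ UE']]]] := depth_classes w3.
  have wU' : w \in U' by rewrite mU'.
  exists (index w U'); have := UE' (index w U') w; rewrite index_mem wU' nth_index // => /(_ isT).
  move=> H; apply: weq_trans H _; apply: weq_ext.
  by rewrite -(subnKC w3); apply: weq_zw.
have one w i : weq w (ones a i) -> weq (ones w 1) (ones a (i + 1)).
  by move=> H; rewrite -ones_add; exact: weq_ext.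
have csends w : (3 < size w.2)%N -> exists w', sends c w w' /\ size w'.2 = size w.2.
  move=> w3; pose u : W := (w.1, take 4 w.2).
  have wE : w = wext u (drop 4 w.2) by rewrite /wext /= cat_take_drop; case: (w).
  have su : size u.2 = 4 by rewrite size_takel.
  have uU : u \in U by rewrite mU su.
  have iu : (index u U < M)%N by rewrite index_mem.
  have := cE _ u iu; rewrite nth_index // => H.
  exists (wext (nth u U ((index u U + 1) %% M)) (drop 4 w.2)); split.
    by rewrite {1}wE; exact: sends_ext.
  have : nth u U ((index u U + 1) %% M) \in U by rewrite mem_nth // ltn_mod.
  by rewrite mU => /eqP E; rewrite [in RHS]wE /= !size_cat E su.
have ca : sends c a (nth a U (1 %% M)).
  by have := cE 0%N a M0; rewrite U0 add0n.
have cshift w w' i : (3 < size w.2)%N -> sends c w w' -> weq w (ones a i) ->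
    weq w' (ones a (i + 1)).
  move=> w3 ww' wi.
  have H := weq_sends Tc ww' (sends_ext (nseq i (@o1 n)) ca) wi; apply: weq_trans H _.
  rewrite addnC -ones_add; apply: weq_ext; rewrite modn_small //.
  exact: UE.
have cshifts w i j : (3 < size w.2)%N -> weq w (ones a i) ->
    exists w', sends (c ^+ j) w w' /\ weq w' (ones a (i + j)) /\ (3 < size w'.2)%N.
  move=> w3 wi; elim: j => [|j [w' [H1 [H2 H3]]]].
    by exists w; rewrite addn0; split.
  have [w2 [H4 H5]] := csends w' H3; exists w2; rewrite H5; split.
    by rewrite expgSr; exact: sends_mul H4.
  by split=> //; rewrite addnS -addn1; apply: cshift H4 H2.
have reach i j : exists l, weq (ones a (i + l)) (ones a j).
  exists (j + i * M.-1)%N; suff -> : (i + (j + i * M.-1) = j + i * M)%N by exact: mod.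
  by rewrite -{2}(prednK M0) mulnS; lia.
have near t x : inT t -> exists u v, [/\ wprefix u x, sends t u v, (3 < size u.2)%N & (3 < size v.2)%N].
  move=> Tt; have [u [v [[b xE] uv]]] := isT_ploc Tt x.
  exists (wext u (stake 4 b)), (wext v (stake 4 b)); split.
  - by exists (sdrop 4 b); rewrite wcat_wext prepend_stake.
  - exact: sends_ext.
  - by rewrite size_cat size_stake addnS ltnS addnC leq_addr.
  - by rewrite size_cat size_stake addnS ltnS addnC leq_addr.
(* One deep prefix replaced by an equivalent one decides for all: every deep word is equivalent to
   [u] followed by ones, and [t] transports this equivalence to the images. *)
have local t u v : inT t -> sends t u v -> (3 < size u.2)%N -> weq v u -> locS t.
  move=> Tt uv u3 uv'E x; have [i ui] := deep u u3.
  have [u2 [v2 [[b ->] uv2 u23 v23]]] := near t x Tt.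
  have [i2 ui2] := deep u2 u23; have [l lE] := reach i i2.
  have E : weq u2 (ones u l).
    apply: weq_trans ui2 _; apply: weq_trans (weq_sym lE) _.
    by rewrite -ones_add; apply: weq_ext; exact: weq_sym.
  have F := weq_sends Tt uv2 (sends_ext (nseq l (@o1 n)) uv) E.
  have [s [Ss sE]] : weq u2 v2.
    apply: weq_trans E _; apply: weq_sym; apply: weq_trans F _.
    exact: weq_ext.
  exists s, (size u2.2); split=> // y /pre_eqx.
  have /wprefixP <- := wprefix_wcat u2 b => /esym /esym yE.
  have /wprefixP [p ->] : u2 = pre (size u2.2) y by [].
  by rewrite uv2 sE.
exists c, M; split=> // t Tt.
have [u [v [_ uv u3 v3]]] := near t (wcat a (@lo n)) Tt.
have [i ui] := deep u u3; have [j vj] := deep v v3.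
have [k fE] := reach j i; exists k; split.
  have [v' [H1 [H2 _]]] := cshifts v j k v3 vj.
  apply: (local _ u v') => //.
  - by apply: isT_mul => //; exact: isT_exp.
  - exact: sends_mul H1.
  - by apply: weq_trans H2 _; apply: weq_trans fE _; exact: weq_sym.
(* With two letters 1 is the largest letter, so by [weq_top] appending it does not change the class,
   and deep words form one class. *)
move=> n0; have aE l : weq (ones a l) a.
  elim: l => [|l IH]; first by rewrite /ones /wext cats0; exact: weq_refl.
  have -> : ones a l.+1 = ones (ones a l) 1 by rewrite ones_add addn1.
  apply: weq_trans IH; apply: weq_sym.
  have -> : ones (ones a l) 1 = wext (ones a l) [:: ord_max].
    by rewrite /ones; congr (wext _ [:: _]); apply: ord_inj; rewrite val_o1 /= n0.
  by apply: weq_top; rewrite size_cat size_nseq.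
apply: (local _ u v) => //; apply: weq_trans vj _; apply: weq_trans (aE _) _.
by apply: weq_sym; apply: weq_trans ui _; exact: aE.
Qed.

End Classes.

(** * Membership in T: local prefix replacement and cyclic order *)

Section Criterion.

Variables n r : nat.
Local Notation X := (cantor n.+2 r.+1).
Local Notation W := (word n.+2 r.+1).
Local Notation inT := (@is_HigmanThompsonT n.+2 r.+1).
Local Notation hom := (homeo X).
Local Notation xmin := (@xmin n r).
Implicit Types (x y z : X) (u v w : W) (f g h s t : hom).

Local Open Scope group_scope.

Lemma cycp_fix_mono g : cycp g -> g xmin = xmin -> monox g.
Proof.
move=> cg g0 x y xy; have [E|nx] := pselect (x = xmin).
  rewrite E g0; apply: xmin_lt => F; apply: (@xlt_irr _ _ x); rewrite {2}E -F.
  have : y = xmin by apply: (@hinj _ _ g); rewrite F g0.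
  by move=> F'; move: xy; rewrite F' => /xmin_min.
have /cg : cyc xmin x y by left; split=> //; exact: xmin_lt.
rewrite g0 => -[[]|[[_ /xmin_min]|[/xmin_min]]] //.
Qed.

Lemma cycp_comp (f g : X -> X) : cycp f -> cycp g -> cycp (g \o f).
Proof. by move=> cf cg x y z /cf /cg. Qed.

Lemma hom_cyc_total g x y z : cyc x y z -> cyc (g x) (g y) (g z) \/ cyc (g z) (g y) (g x).
Proof.
move=> /cyc_neq[xy [yz xz]]; apply: cyc_total => /hinj; [exact: xy|exact: yz|exact: xz].
Qed.

Lemma cycp_inv g : cycp g -> cycp g^-1.
Proof.
move=> cg x y z H; have [//|/cg] := hom_cyc_total g^-1 H.
by rewrite !hmulVK => /cyc_asym /(_ H).
Qed.

Lemma revp_inv g : revp g -> revp g^-1.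
Proof.
move=> cg x y z H; have [/cg|//] := hom_cyc_total g^-1 H.
by rewrite !hmulVK => /cyc_asym /(_ H).
Qed.

Lemma cycp_conj h g : cycp h \/ revp h -> cycp g -> cycp (g ^ h).
Proof.
move=> [ch|ch] cg x y z H; rewrite !hconjE.
  by apply: (ch); apply: cg; exact: (cycp_inv ch H).
by apply: (ch); apply: cg; exact: (revp_inv ch H).
Qed.

Lemma sends_xmin (w : W) : w.2 <> [::] -> exists t, inT t /\ t (wcat w (@lo n)) = xmin.
Proof.
move=> w0; have [|t Tt tE] := @sends_ex _ _ w (ord0, [:: ord0]) _ isT.
  by case: w w0 => a [].
exists t; split=> //; rewrite tE /wcat /=; congr pair.
by apply/funext => -[|i].
Qed.

Lemma lo_eta : @lo n = prepend [:: ord0] (@lo n).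
Proof. by apply/funext => -[|i]. Qed.

(** Prefix replacement keeps the tail of zeros of the minimum, so composing with an element of [T]
    makes [g] fix the minimum; preserving the cyclic order then means being increasing, and
    [isT_mono] applies. *)
Lemma T_crit g : ploc g -> cycp g -> inT g.
Proof.
move=> lg cg; have [u [v [[a E] uv]]] := lg xmin.
have aE : a = @lo n.
  have := congr1 (fun x : X => sdrop (size u.2) x.2) E.
  by rewrite /= sdrop_prepend => <-.
have [t [Tt tE]] : exists t, inT t /\ t (g xmin) = xmin.
  rewrite {1}E uv aE lo_eta -wcat_wext; apply: sends_xmin.
  by rewrite /=; case: (v.2).
suff H : inT (g * t) by rewrite -(mulgK t g); apply: isT_mul => //; exact: isT_inv.
apply: isT_mono; first by apply: (ploc_comp lg); exact: isT_ploc.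
by apply: cycp_fix_mono => //; apply: cycp_comp => //; exact: isT_cycp.
Qed.

Variable S : hom -> Prop.
Hypothesis SL : large S.

(** Locally [f ^ h] coincides with some [s ^ h], which is in [T]; conjugation by [h] respects the
    cyclic order whether [h] preserves or reverses it. *)
Lemma locS_conj h f : good S h -> inT f -> locS S f -> inT (f ^ h).
Proof.
move=> gh Tf lf; apply: T_crit; last first.
  by apply: cycp_conj; [exact: (orientation SL)|exact: isT_cycp].
move=> x; have [s [m [Ss sE]]] := lf (h^-1 x).
have [k kP] := hom_mod h^-1 x m.
have [u [v [[a xE] uv]]] := isT_ploc (gh _ Ss) x.
exists (wext u (stake k a)), (wext v (stake k a)); split.
  by exists (sdrop k a); rewrite wcat_wext prepend_stake.
move=> b; rewrite !wcat_wext -uv !hconjE; congr (h _); apply: sE; apply: kP.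
rewrite xE; split=> //=; apply: (@eqs_le _ _ (size u.2 + k)); first exact: leq_addl.
by apply: eqs_prepend; apply/eqs_stake; rewrite -{2}(size_stake k a) stake_prepend.
Qed.

End Criterion.

(** * Exotic stream maps *)

Section Blocks.

Variable n : nat.
Local Notation D := 'I_n.+2.
Local Notation Y := (cantor_seq n.+2).
Local Notation o1 := (@o1 n).
Implicit Types (x y z : Y) (s t w : seq D) (f g : Y -> Y).

Definition blk w x : Y := prepend w (scons o1 x).
Definition no1 x := forall i, (x i : D) <> o1.

Lemma dec1 x : no1 x \/ exists p : seq D * Y, o1 \notin p.1 /\ x = blk p.1 p.2.
Proof.
have [H|H] := pselect (exists i, (x i : D) == o1); last first.
  by left=> i E; apply: H; exists i; apply/eqP.
right; case: (ex_minnP H) => i /eqP xi imin.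
exists (stake i x, sdrop i.+1 x); split=> /=.
  apply/mapP => -[j]; rewrite mem_iota /= add0n => ji E.
  by have := imin j; rewrite -E eqxx => /(_ isT); rewrite leqNgt ji.
rewrite /blk -[LHS](prepend_stake i) -[in LHS](scons_eta (sdrop i x)).
by rewrite sdropD addn1 /sdrop /= addn0 xi.
Qed.

Lemma blk_incone w u x : o1 \notin w -> o1 \notin u -> incone (rcons w o1) (blk u x) -> w = u.
Proof.
rewrite /incone => wN uN [z]; elim: w u wN uN => [|c w IH] [|d u] //=.
- by rewrite inE negb_or => _ /andP[/eqP H _] /scons_inj[/esym].
- by rewrite inE negb_or => /andP[/eqP H _] _ /scons_inj[].
rewrite !inE !negb_or => /andP[_ wN] /andP[_ uN] /scons_inj[-> E].
by rewrite (IH u).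
Qed.

Lemma blkE w x : blk w x = prepend (rcons w o1) x.
Proof. by rewrite /blk -cats1 prepend_cat. Qed.

Lemma blk_inj w u x y : o1 \notin w -> o1 \notin u -> blk w x = blk u y -> w = u /\ x = y.
Proof.
move=> wN uN E; have Ew : w = u.
  by apply: (blk_incone wN uN (x := y)); rewrite -E blkE; exact: incone_prepend.
split=> //; move: E; rewrite Ew => /prepend_inj /scons_inj [] //.
Qed.

Lemma no1_incone w x : no1 x -> ~ incone (rcons w o1) x.
Proof.
move=> xN [z E]; apply: (xN (size w)); rewrite E prependE size_rcons ltnSn.
by rewrite nth_rcons ltnn eqxx.
Qed.

(* Applies [g] to the tail after the first letter 1, if there is one. *)
Definition sub1 g x : Y :=
  if pselect (exists p : seq D * Y, o1 \notin p.1 /\ x = blk p.1 p.2) is left E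
  then let p := projT1 (cid E) in blk p.1 (g p.2) else x.

Lemma sub1_blk g w x : o1 \notin w -> sub1 g (blk w x) = blk w (g x).
Proof.
move=> wN; rewrite /sub1; case: pselect => [E|[]]; last by exists (w, x).
by case: cid => -[u y] /= [uN /(blk_inj wN uN) [<- <-]].
Qed.

Lemma sub1_no1 g x : no1 x -> sub1 g x = x.
Proof.
move=> xN; rewrite /sub1; case: pselect => // -[[w y] /= [wN E]].
by case: (no1_incone (w := w) xN); exists y; rewrite -blkE.
Qed.

Lemma sub1K g g' : cancel g g' -> cancel (sub1 g) (sub1 g').
Proof.
move=> gK x; have [xN|[[w y] /= [wN ->]]] := dec1 x; first by rewrite !sub1_no1.
by rewrite !sub1_blk // gK.
Qed.

Lemma sub1_mono g : smono g -> smono (sub1 g).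
Proof.
move=> gM x y; have [xN|[[w a] /= [wN ->]]] := dec1 x;
have [yN|[[u b] /= [uN ->]]] := dec1 y; rewrite ?(sub1_no1 _ xN) ?(sub1_no1 _ yN) ?sub1_blk //.
- by rewrite !blkE => /cone_gt; apply; exact: no1_incone.
- by rewrite !blkE => /cone_lt; apply; exact: no1_incone.
have [<-|wu] := eqVneq w u.
  by rewrite !blkE => /slt_prepend/gM L; apply/slt_prepend.
have N c : ~ incone (rcons w o1) (blk u c) by move=> /(blk_incone wN uN)/eqP; rewrite (negbTE wu).
have N' c : ~ incone (rcons u o1) (blk w c).
  by move=> /(blk_incone uN wN)/eqP; rewrite eq_sym (negbTE wu).
move=> L; have {}L : slt (blk w (g a)) (blk u b).
  by move: (N b) L; rewrite [blk w _]blkE [blk w _]blkE => H /cone_lt; exact.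
by move: (N' (g a)) L; rewrite [blk u _]blkE [blk u _]blkE => H /cone_gt; exact.
Qed.

(** Maps that rewrite the first block only: the letter 1 that ends it and the tail behind it
    survive. *)
Record inert f : Prop := Inert {
  inert_blk : forall w, o1 \notin w -> exists2 w', o1 \notin w' & forall x, f (blk w x) = blk w' x;
  inert_no1 : forall x, no1 x -> no1 (f x) }.

(* [lev f] applies [f] to every block between consecutive letters 1; its first     *)
(* [k + 1] letters are those of [lev_ f k].                                        *)
Fixpoint lev_ f k x : Y := f (if k is k'.+1 then sub1 (lev_ f k') x else x).
Definition lev f x : Y := fun i => lev_ f i x i.

Lemma eqs_blk k w x y : eqs k x y -> eqs k.+1 (blk w x) (blk w y).
Proof.
move=> E; rewrite !blkE; apply: (@eqs_le _ _ (size (rcons w o1) + k)).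
  by rewrite size_rcons addSn ltnS leq_addl.
exact: eqs_prepend.
Qed.

Section Lev.

Variable f : Y -> Y.
Hypothesis fI : inert f.

Lemma lev_stable k l x : (k <= l)%N -> eqs k.+1 (lev_ f k x) (lev_ f l x).
Proof.
have [xN|] := pselect (no1 x).
  by case: k l => [|k] [|l] //= _; rewrite ?sub1_no1.
elim: k l x => [|k IH] l x xN; (have [//|[[w y] /= [wN xE]]] := dec1 x);
  have [w' w'N fw] := inert_blk fI wN; rewrite xE.
  by case: l => [|l] //= _; rewrite ?sub1_blk // !fw; exact: eqs_blk.
case: l => [|l] //=; rewrite ltnS => kl; rewrite !sub1_blk // !fw; apply: eqs_blk.
have [yN|yN] := pselect (no1 y); last exact: IH.
by case: (k) (l) => [|k'] [|l'] //=; rewrite ?sub1_no1.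
Qed.

Lemma lev_eqs k x : eqs k.+1 (lev f x) (lev_ f k x).
Proof. by move=> i ik; apply: (@lev_stable i k x). Qed.

Lemma lev_no1 x : no1 x -> lev f x = f x.
Proof.
move=> xN; apply/funext => i; rewrite /lev.
by case: i => [|i] //=; rewrite sub1_no1.
Qed.

Lemma lev_blk w x : o1 \notin w -> lev f (blk w x) = f (blk w (lev f x)).
Proof.
move=> wN; have [w' w'N fw] := inert_blk fI wN; rewrite fw.
apply: eqs_eq => k; apply: (@eqs_trans _ _ (lev_ f k.+1 (blk w x))).
  exact: (eqs_le (leqW (leqnSn k)) (@lev_eqs k.+1 _)).
rewrite /= sub1_blk // fw; apply: (eqs_le (leqnSn k)); apply: eqs_blk.
by apply: eqs_sym; exact: (eqs_le (leqnSn k) (@lev_eqs k _)).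
Qed.

End Lev.

Lemma levK f f' : inert f -> inert f' -> cancel f f' -> cancel (lev f) (lev f').
Proof.
move=> fI f'I fK x; apply: eqs_eq => k; elim: k x => [|k IH] x //.
have [xN|[[w y] /= [wN ->]]] := dec1 x.
  by rewrite (lev_no1 _ xN) lev_no1 ?fK //; exact: inert_no1.
have [w' w'N fw] := inert_blk fI wN.
have f'w z : f' (blk w' z) = blk w z by rewrite -fw fK.
by rewrite lev_blk // fw lev_blk // f'w; apply: eqs_blk.
Qed.

(** As a limit of increasing maps, [lev f] is weakly increasing; injectivity makes it strictly
    so. *)
Lemma lev_mono f g : inert f -> smono f -> cancel (lev f) g -> smono (lev f).
Proof.
move=> fI fM fK x y xy; have Lk k : slt (lev_ f k x) (lev_ f k y).
  elim: k x y xy => [|k IH] x y xy /=; first exact: fM.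
  by apply: fM; apply: sub1_mono => // a b; exact: IH.
have [E|/slt_total[//|[i [E L]]]] := pselect (lev f x = lev f y).
  by case: (@slt_irr _ x); rewrite -{2}(fK x) E fK.
have Ex := @lev_eqs _ fI i x; have Ey := @lev_eqs _ fI i y.
case: (slt_asym (Lk i)); exists i; split; last by rewrite /dig -Ex // -Ey.
by move=> j ji; rewrite -Ex ?(ltnW ji) ?ltnS ?(ltnW ji) // -Ey ?ltnS ?(ltnW ji) //; exact: E.
Qed.

End Blocks.

(** * Gaps between fixed points *)

Section Gaps.

Variable n : nat.
Local Notation D := 'I_n.+2.
Local Notation Y := (cantor_seq n.+2).
Local Notation lo := (@lo n).
Local Notation hi := (@hi n).
Implicit Types (x y z : Y) (a s w : seq D) (t k : Y -> Y).

Lemma cone_convex a x y z : slt (prepend a y) x -> slt x (prepend a z) -> incone a x.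
Proof.
move=> L L'; apply: contrapT => H.
exact: (slt_asym L (cone_gt _ L' H)).
Qed.

Lemma lo_le x : ~ slt x lo.
Proof.
by have [-> /slt_irr|/lo_min L /(slt_asym L)] := pselect (x = lo).
Qed.

Lemma hi_ge x : ~ slt hi x.
Proof.
by have [-> /slt_irr|/hi_max L /(slt_asym L)] := pselect (x = hi).
Qed.

Lemma smono_lo t t' : cancel t t' -> cancel t' t -> smono t -> t lo = lo.
Proof.
move=> tK t'K tM; apply: contrapT => /lo_min.
by move=> /(smono_can tK t'K tM); rewrite tK => /lo_le.
Qed.

Lemma smono_hi t t' : cancel t t' -> cancel t' t -> smono t -> t hi = hi.
Proof.
move=> tK t'K tM; apply: contrapT => /hi_max.
by move=> /(smono_can tK t'K tM); rewrite tK => /hi_ge.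
Qed.

(** [t] and its inverse permute the fixed points of [k]. If one end of the gap were fixed and the
    other moved, one of them would bring a fixed point of [k] inside the gap. *)
Lemma gap_fix t t' k x y : cancel t t' -> cancel t' t -> smono t ->
  (forall z, t (k z) = k (t z)) -> k x = x -> k y = y -> slt x y ->
  (forall z, slt x z -> slt z y -> k z <> z) -> t x = x <-> t y = y.
Proof.
move=> tK t'K tM tk kx ky xy gap.
have t'M := smono_can tK t'K tM.
have ft z : k z = z -> k (t z) = t z by move=> E; rewrite -tk E.
have ft' z : k z = z -> k (t' z) = t' z by move=> E; rewrite -{2}E -{2}(t'K z) -tk tK.
split=> E; apply: contrapT => /slt_total[L|L].
- by apply: (gap (t y)) => //; [rewrite -E; exact: tM|exact: ft].
- apply: (gap (t' y)); last exact: ft'.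
  + by rewrite -(tK x) E; exact: t'M.
  + by rewrite -{2}(tK y); exact: t'M.
- apply: (gap (t' x)); last exact: ft'.
  + by rewrite -{1}(tK x); exact: t'M.
  + by rewrite -(tK y) E; exact: t'M.
- by apply: (gap (t x)) => //; [rewrite -E; exact: tM|exact: ft].
Qed.

Lemma adjacent a (c d : D) z : d = c.+1 :> nat ->
  slt (prepend (rcons a c) hi) z -> slt z (prepend (rcons a d) lo) -> False.
Proof.
move=> dc; rewrite -!cats1 !prepend_cat => L1 L2.
have [y zE] := cone_convex L1 L2; move: L1 L2; rewrite zE => /slt_prepend L1 /slt_prepend.
rewrite -(scons_eta y) /= in L1 *; move: L1 => /slt_scons[L1|[E /hi_ge //]].
by move=> /slt_scons[L2|[E /lo_le //]]; lia.
Qed.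

Lemma adjacent_lt a (c d : D) : d = c.+1 :> nat ->
  slt (prepend (rcons a c) hi) (prepend (rcons a d) lo).
Proof.
move=> dc; rewrite -!cats1 !prepend_cat; apply/slt_prepend/slt_scons.
by left; rewrite dc.
Qed.

Lemma adjacent_fix t t' a (c d : D) : cancel t t' -> cancel t' t -> smono t -> d = c.+1 :> nat ->
  t (prepend (rcons a c) hi) = prepend (rcons a c) hi <->
  t (prepend (rcons a d) lo) = prepend (rcons a d) lo.
Proof.
(* With [k] the identity, a gap is a pair of points with nothing in between. *)
move=> tK t'K tM dc; apply: (gap_fix (k := id) tK t'K tM) => //.
  exact: adjacent_lt.
by move=> z L1 /(adjacent dc L1).
Qed.

Lemma lo_rcons a : prepend (rcons a ord0) lo = prepend a lo.
Proof. by rewrite -cats1 prepend_cat; congr prepend; apply/funext => -[|i]. Qed.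

Lemma hi_rcons a : prepend (rcons a ord_max) hi = prepend a hi.
Proof. by rewrite -cats1 prepend_cat; congr prepend; apply/funext => -[|i]. Qed.

Lemma lo_hi : slt lo hi.
Proof. by exists 0%N. Qed.

Lemma cone_fix t t' a : cancel t t' -> cancel t' t -> smono t ->
  t (prepend a lo) = prepend a lo -> t (prepend a hi) = prepend a hi ->
  exists s s' : Y -> Y, [/\ cancel s s', cancel s' s, smono s & forall x, t (prepend a x) = prepend a (s x)].
Proof.
move=> tK t'K tM tlo thi.
have key (u u' : Y -> Y) : cancel u u' -> cancel u' u -> smono u ->
    u (prepend a lo) = prepend a lo -> u (prepend a hi) = prepend a hi ->
    forall x, exists y, u (prepend a x) = prepend a y.
  move=> uK u'K uM ulo uhi x; have [->|xlo] := pselect (x = lo); first by exists lo.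
  have [->|xhi] := pselect (x = hi); first by exists hi.
  suff [y ->] : incone a (u (prepend a x)) by exists y.
  apply: (@cone_convex a _ lo hi); first by rewrite -ulo; apply/uM/slt_prepend; exact: lo_min.
  by rewrite -uhi; apply/uM/slt_prepend; exact: hi_max.
have /choice[s sE] := key t t' tK t'K tM tlo thi.
have /choice[s' s'E] := key t' t t'K tK (smono_can tK t'K tM)
  ltac:(by rewrite -{1}tlo tK) ltac:(by rewrite -{1}thi tK).
exists s, s'; split=> //.
- by move=> x; apply: (@prepend_inj _ a); rewrite -s'E -sE tK.
- by move=> x; apply: (@prepend_inj _ a); rewrite -sE -s'E t'K.
- by move=> x y /(slt_prepend a)/tM; rewrite !sE => /slt_prepend.
Qed.

End Gaps.

(** * Exotic maps and their rigidity, for at least three letters *)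

Section Exotic.

Variable n : nat.
Hypothesis n0 : (0 < n)%N.
Local Notation D := 'I_n.+2.
Local Notation Y := (cantor_seq n.+2).
Local Notation o1 := (@o1 n).
Local Notation lo := (@lo n).
Local Notation hi := (@hi n).
Implicit Types (x y z : Y) (a p s u v w : seq D) (f t : Y -> Y).

Lemma o1_max : o1 != ord_max.
Proof. by apply/eqP => /(congr1 val); rewrite /= val_o1; lia. Qed.

Let o10 := negbTE (o1_neq0 n).
Let o1m := negbTE o1_max.

Lemma max_o1 : (ord_max == o1) = false. Proof. by rewrite eq_sym. Qed.
Lemma zero_o1 : (@ord0 n.+1 == o1) = false. Proof. by rewrite eq_sym. Qed.

Lemma no1_scons (c : D) x : c <> o1 -> no1 x -> no1 (scons c x).
Proof. by move=> H xN [|i] //=. Qed.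

Lemma no1_sdrop k x : no1 x -> no1 (sdrop k x).
Proof. by move=> xN i; exact: xN. Qed.

Lemma no1_prepend w x : o1 \notin w -> no1 x -> no1 (prepend w x).
Proof.
elim: w => //= c w IH; rewrite inE negb_or => /andP[/eqP cN wN] xN.
by apply: no1_scons; [apply: nesym|exact: IH].
Qed.

Lemma no1_lo : no1 lo. Proof. by move=> i /eqP; rewrite zero_o1. Qed.
Lemma no1_hi : no1 hi. Proof. by move=> i /eqP; rewrite max_o1. Qed.

Let max1 : @ord_max n.+1 <> o1. Proof. by apply/eqP; rewrite max_o1. Qed.
Let zero1 : @ord0 n.+1 <> o1. Proof. by apply/eqP; rewrite zero_o1. Qed.

Lemma Amap_inert : inert (@Amap n).
Proof.
split=> [w|x xN]; last first.
  rewrite /Amap; case: ifP => _; first exact: no1_scons.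
  case: ifP => _; last exact: no1_sdrop.
  by do 2?[apply: no1_scons => //]; exact: no1_sdrop.
case: w => [|c [|d w]].
- by move=> _; exists [:: ord_max] => [|x]; rewrite ?inE /blk /Amap /= ?o10 ?o1m.
- rewrite inE => cN; have [c0|c0] := eqVneq c ord0.
    by exists [::] => // x; rewrite /blk /Amap /= c0 eqxx /= o1m sdrop_scons.
  by exists [:: ord_max; c] => [|x]; rewrite ?inE ?negb_or ?o1m /blk /Amap /= ?c0.
rewrite !inE !negb_or => /and3P[cN dN wN]; have [c0|c0] := eqVneq c ord0; last first.
  by exists [:: ord_max, c, d & w] => [|x]; rewrite ?inE ?negb_or ?o1m ?cN ?dN // /blk /Amap /= ?c0.
have [dm|dm] := eqVneq d ord_max.
  exists [:: ord_max, ord0 & w] => [|x]; first by rewrite !inE o1m o10.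
  by rewrite /blk /Amap /= c0 eqxx /= dm eqxx sdrop_scons2.
exists (d :: w) => [|x]; first by rewrite inE negb_or dN.
by rewrite /blk /Amap /= c0 eqxx /= (negbTE dm) sdrop_scons.
Qed.

Lemma Ainv_inert : inert (@Ainv n).
Proof.
split=> [w|x xN]; last first.
  rewrite /Ainv; case: ifP => _; first exact: no1_scons.
  case: ifP => _; last exact: no1_sdrop.
  by do 2?[apply: no1_scons => //]; exact: no1_sdrop.
case: w => [|c [|d w]].
- by move=> _; exists [:: ord0] => [|x]; rewrite ?inE /blk /Ainv /= ?o10 ?o1m.
- rewrite inE => cN; have [c0|c0] := eqVneq c ord_max.
    by exists [::] => // x; rewrite /blk /Ainv /= c0 eqxx /= o10 sdrop_scons.
  by exists [:: ord0; c] => [|x]; rewrite ?inE ?negb_or ?o10 /blk /Ainv /= ?c0.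
rewrite !inE !negb_or => /and3P[cN dN wN]; have [c0|c0] := eqVneq c ord_max; last first.
  by exists [:: ord0, c, d & w] => [|x]; rewrite ?inE ?negb_or ?o10 ?cN ?dN // /blk /Ainv /= ?c0.
have [dm|dm] := eqVneq d ord0.
  exists [:: ord0, ord_max & w] => [|x]; first by rewrite !inE o1m o10.
  by rewrite /blk /Ainv /= c0 eqxx /= dm eqxx sdrop_scons2.
exists (d :: w) => [|x]; first by rewrite inE negb_or dN.
by rewrite /blk /Ainv /= c0 eqxx /= (negbTE dm) sdrop_scons.
Qed.

Lemma incone_blk v w x : o1 \notin v -> incone v (blk w x) <-> prefix v w.
Proof.
move=> vN; split=> [[z]|/prefixP[u ->]]; last first.
  by exists (blk u x); rewrite /blk prepend_cat.
rewrite /blk => E; case: (prepend_comp E) => -[q qE]; last by rewrite qE prefix_prefix.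
case: q qE => [|c q] qE; first by rewrite qE cats0 prefix_refl.
move: E; rewrite qE prepend_cat => /prepend_inj /scons_inj[cE _].
by case/negP: vN; rewrite qE mem_cat inE cE eqxx orbT.
Qed.

Lemma Ats_inert v f : o1 \notin v -> inert f -> inert (Ats v f).
Proof.
move=> vN [fB fN]; split=> [w wN|x xN].
  have [/prefixP[u uE]|H] := boolP (prefix v w); last first.
    by exists w => // x; rewrite Ats_out // => /incone_blk; rewrite (negbTE H) => /(_ vN).
  have uN : o1 \notin u by apply: contra wN; rewrite uE mem_cat => ->; rewrite orbT.
  have [u' u'N fu] := fB u uN; exists (v ++ u') => [|x].
    by rewrite mem_cat negb_or vN.
  by rewrite uE /blk !prepend_cat AtsE fu.
have [[y E]|/Ats_out -> //] := pselect (incone v x).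
rewrite E AtsE; apply: no1_prepend => //; apply: fN => i.
by have := xN (size v + i)%N; rewrite E prependE (leq_gtF (leq_addr _ _)) addKn.
Qed.

Definition exotic v : Y -> Y := lev (Ats v (@Amap n)).
Definition exotic_inv v : Y -> Y := lev (Ats v (@Ainv n)).

Section One.

Variable v : seq D.
Hypothesis vN : o1 \notin v.

Let fI : inert (Ats v (@Amap n)). Proof. exact: Ats_inert Amap_inert. Qed.
Let fI' : inert (Ats v (@Ainv n)). Proof. exact: Ats_inert Ainv_inert. Qed.

Lemma exoticK : cancel (exotic v) (exotic_inv v).
Proof. by apply: levK => //; apply: AtsK; exact: AmapK. Qed.

Lemma exotic_invK : cancel (exotic_inv v) (exotic v).
Proof. by apply: levK => //; apply: AtsK; exact: AinvK. Qed.

Lemma exotic_mono : smono (exotic v).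
Proof. by apply: (lev_mono (g := exotic_inv v)) => //; [apply: Ats_mono; exact: Amap_mono|exact: exoticK]. Qed.

Lemma exotic_blk w x : o1 \notin w -> ~~ prefix v w -> exotic v (blk w x) = blk w (exotic v x).
Proof.
move=> wN H; rewrite /exotic lev_blk // Ats_out // => /incone_blk -/(_ vN).
by rewrite (negbTE H).
Qed.

Lemma exotic_lo : exotic v (prepend v lo) = prepend v lo.
Proof. by rewrite /exotic lev_no1 ?AtsE ?Amap_lo //; apply: no1_prepend => //; exact: no1_lo. Qed.

Lemma exotic_hi : exotic v (prepend v hi) = prepend v hi.
Proof. by rewrite /exotic lev_no1 ?AtsE ?Amap_hi //; apply: no1_prepend => //; exact: no1_hi. Qed.

(** If a letter 1 occurs, the change of the first block settles the comparison: distinct blocks have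
    disjoint cones, so later changes do not matter. *)
Lemma exotic_up x : x <> lo -> x <> hi -> slt (prepend v x) (exotic v (prepend v x)).
Proof.
move=> xlo xhi; have [xN|[[w y] /= [wN xE]]] := dec1 x.
  rewrite /exotic lev_no1 ?AtsE; last exact: no1_prepend.
  by apply/slt_prepend; exact: Amap_up.
have E u z : blk (v ++ u) z = prepend v (blk u z) by rewrite /blk prepend_cat.
have vwN : o1 \notin v ++ w by rewrite mem_cat negb_or vN.
rewrite xE -E /exotic lev_blk // !E AtsE; apply/slt_prepend.
have [w' w'N Aw] := inert_blk Amap_inert wN; rewrite Aw.
have L : slt (blk w y) (blk w' y) by rewrite -Aw -xE; exact: Amap_up.
have ww' : w <> w' by move=> F; move: L; rewrite -F => /slt_irr.
have N z : ~ incone (rcons w o1) (blk w' z) by move=> /(blk_incone wN w'N).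
have N' z : ~ incone (rcons w' o1) (blk w z) by move=> /(blk_incone w'N wN)/nesym.
by move: L; rewrite [blk w' _]blkE [blk w' _]blkE => /cone_gt; apply; exact: N'.
Qed.

End One.

(** Words that are empty or end with the letter 1, presented block by block to follow the recursion
    of [lev]. *)
Inductive blocks : seq D -> Prop :=
| blocks0 : blocks [::]
| blocksS w p : o1 \notin w -> blocks p -> blocks (w ++ o1 :: p).

Lemma blocks_dec a : exists p c, [/\ a = p ++ c, blocks p & o1 \notin c].
Proof.
elim: a => [|d a [p [c [-> pB cN]]]].
  by exists [::], [::]; split=> //; exact: blocks0.
have [->|do1] := eqVneq d o1.
  exists (o1 :: p), c; split=> //; exact: (@blocksS [::]).
case: pB => [|w q wN qB].
  exists [::], (d :: c); split=> //; first exact: blocks0.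
  by rewrite inE negb_or eq_sym do1.
exists ((d :: w) ++ o1 :: q), c; split=> //; apply: blocksS => //.
by rewrite inE negb_or eq_sym do1.
Qed.

(** Every block of [p] is too short to begin with [v], so it is left unchanged. *)
Lemma exotic_blocks v p x : o1 \notin v -> blocks p -> (size p <= size v)%N ->
  exotic v (prepend p x) = prepend p (exotic v x).
Proof.
move=> vN; elim=> // w q wN qB IH; rewrite size_cat /= addnS => sv.
have E z : prepend (w ++ o1 :: q) z = blk w (prepend q z) by rewrite prepend_cat.
rewrite !E exotic_blk // ?IH //.
  by apply: leq_trans (ltnW sv); rewrite leq_addl.
apply/negP => /size_prefix; rewrite leqNgt => /negP; apply.
by apply: leq_ltn_trans sv; rewrite leq_addr.
Qed.

Lemma exotic_iter_blocks v p N x : o1 \notin v -> blocks p -> (size p <= size v)%N ->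
  iter N (exotic v) (prepend p x) = prepend p (iter N (exotic v) x).
Proof. by move=> vN pB sp; elim: N => //= N ->; rewrite exotic_blocks. Qed.

Lemma iter_up v x N : o1 \notin v -> slt x (exotic v x) -> (0 < N)%N -> slt x (iter N (exotic v) x).
Proof.
move=> vN L; case: N => // N _; elim: N => [|N IH] //=.
by apply: (slt_trans L); apply: exotic_mono.
Qed.

Lemma exotic_gap v p N : o1 \notin v -> blocks p -> (size p <= size v)%N -> (0 < N)%N ->
  [/\ iter N (exotic v) (prepend (p ++ v) lo) = prepend (p ++ v) lo,
      iter N (exotic v) (prepend (p ++ v) hi) = prepend (p ++ v) hi &
      forall z, slt (prepend (p ++ v) lo) z -> slt z (prepend (p ++ v) hi) ->
        iter N (exotic v) z <> z].
Proof.
move=> vN pB sp N0; split.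
- rewrite prepend_cat exotic_iter_blocks //; congr prepend.
  by elim: N {N0} => //= N ->; exact: exotic_lo.
- rewrite prepend_cat exotic_iter_blocks //; congr prepend.
  by elim: N {N0} => //= N ->; exact: exotic_hi.
move=> z L1 L2; have [x zE] := cone_convex L1 L2.
rewrite zE prepend_cat exotic_iter_blocks // => /prepend_inj E.
have := @iter_up v (prepend v x) N vN; rewrite E => H.
apply: (@slt_irr _ (prepend v x)); apply: H => //; apply: exotic_up => // F.
  by move: L1; rewrite zE F => /slt_irr.
by move: L2; rewrite zE F => /slt_irr.
Qed.

Lemma blk_ind t : (forall x, no1 x -> t x = x) ->
  (forall w x, o1 \notin w -> t (blk w x) = blk w (t x)) -> t =1 id.
Proof.
move=> tN tB x; apply: eqs_eq => k; elim: k x => [|k IH] x //.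
have [xN|[[w y] /= [wN ->]]] := dec1 x; first by rewrite tN.
by rewrite tB //; exact: eqs_blk.
Qed.

Lemma zeros_eq q m : prepend q lo = lo ->
  prepend q (prepend (nseq m ord0) hi) = prepend (nseq m ord0) hi -> q = [::].
Proof.
move=> qlo; case: q qlo => // c q qlo /(congr1 (@^~ m)).
rewrite [RHS]prependE size_nseq ltnn -prepend_cat prependE size_cat size_nseq.
rewrite addSn ltnS leq_addl => E; have : nth ord0 ((c :: q) ++ nseq m ord0) m = (@ord0 n.+1).
  rewrite nth_cat nth_nseq if_same; case: ifP => // mq.
  by have := congr1 (@^~ m) qlo; rewrite prependE mq.
by rewrite E => /(congr1 val).
Qed.

Lemma prepend_rcons a (c : D) x : prepend (rcons a c) x = prepend a (scons c x).
Proof. by rewrite -cats1 prepend_cat. Qed.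

Section Rigidity.

Variable N : seq D -> nat.
Hypothesis N0 : forall v, (0 < N v)%N.

(* By induction on the codimension of the cone of [a], using that the successive *)
(* cones of length [size a + 1] are adjacent; on cones of length [d], the gap     *)
(* between the ends of the cone of [a 0^m] pins down the replacing prefix.        *)
Lemma local_rigid t t' L d : cancel t t' -> cancel t' t -> smono t ->
  (forall v, o1 \notin v -> (L < size v)%N ->
    forall x, t (iter (N v) (exotic v) x) = iter (N v) (exotic v) (t x)) ->
  (forall a, size a = d -> exists a', forall x, t (prepend a x) = prepend a' x) ->
  t =1 id.
Proof.
move=> tK t'K tM tE td.
suff H k a : (size a + k = d)%N -> t (prepend a lo) = prepend a lo ->
    forall x, t (prepend a x) = prepend a x.
  by move=> x; apply: (H d [::]) => //; exact: smono_lo tK t'K tM.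
elim: k a => [|k IH] a ak tlo.
  rewrite addn0 in ak; have [a' a'E] := td a ak.
  suff E : a = a' by move=> x; rewrite a'E -E.
  have [p [c [aE pB cN]]] := blocks_dec a.
  (* Padding with zeros keeps the lower end of the cone of [a] and makes [v] longer than both [p]
     and [L]. *)
  pose m := (size p + L).+1; pose v := c ++ nseq m ord0.
  have vN : o1 \notin v.
    by rewrite mem_cat negb_or cN mem_nseq o10 andbF.
  have sv : (size p + L < size v)%N by rewrite size_cat size_nseq; lia.
  have [klo khi gap] := @exotic_gap v p (N v) vN pB ltac:(lia) (N0 v).
  have lov : prepend (p ++ v) lo = prepend a lo.
    rewrite catA -aE prepend_cat; congr prepend.
    by apply/funext => i; rewrite prependE nth_nseq !if_same.
  have hiv : prepend (p ++ v) hi = prepend a (prepend (nseq m ord0) hi).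
    by rewrite catA -aE prepend_cat.
  have [H _] := gap_fix tK t'K tM (tE v vN ltac:(lia)) klo khi
    (proj2 (slt_prepend (p ++ v) lo hi) (@lo_hi n)) gap.
  rewrite lov hiv in H; have := H tlo; move: tlo; rewrite !a'E => E1 E2.
  case: (prepend_comp E1) => -[q qE]; last first.
    move: E1 E2; rewrite qE !prepend_cat => /prepend_inj E1 /prepend_inj E2.
    by rewrite (zeros_eq E1 E2) cats0.
  move: E1 E2; rewrite qE !prepend_cat => /prepend_inj/esym E1 /prepend_inj/esym E2.
  by rewrite (zeros_eq E1 E2) cats0.
have clo (j : D) : t (prepend (rcons a j) lo) = prepend (rcons a j) lo.
  case: j => j jD; elim: j jD => [|j IHj] jD.
    by have -> : Ordinal jD = ord0 :> D by [apply: ord_inj]; rewrite lo_rcons.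
  have jD' := ltnW jD; apply: (proj1 (@adjacent_fix _ t t' a (Ordinal jD') (Ordinal jD) tK t'K tM erefl)).
  by apply: IH => //; rewrite size_rcons addSnnS.
move=> x; rewrite -(scons_eta x) -!prepend_rcons; apply: IH => //.
by rewrite size_rcons addSnnS.
Qed.

(** A child other than 1 has its ends linked by the gap of its own exotic map, and neighbouring
    children are linked by adjacency. So the upper end of [v] controls the children down to 2, the
    lower end controls the child 0, and these two enclose the child 1. *)
Lemma children_fix t t' : cancel t t' -> cancel t' t -> smono t ->
  (forall v, o1 \notin v -> forall x, t (iter (N v) (exotic v) x) = iter (N v) (exotic v) (t x)) ->
  forall v, o1 \notin v -> t (prepend v lo) = prepend v lo -> t (prepend v hi) = prepend v hi ->
  forall j, t (prepend (rcons v j) lo) = prepend (rcons v j) lo /\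
            t (prepend (rcons v j) hi) = prepend (rcons v j) hi.
Proof.
move=> tK t'K tM tE v vN vlo vhi.
have gap (j : D) : j != o1 -> t (prepend (rcons v j) lo) = prepend (rcons v j) lo <->
    t (prepend (rcons v j) hi) = prepend (rcons v j) hi.
  move=> jo; have jN : o1 \notin rcons v j by rewrite mem_rcons inE negb_or eq_sym jo.
  have [klo khi g] := exotic_gap jN blocks0 (leq0n _) (N0 (rcons v j)).
  exact: (gap_fix tK t'K tM (tE _ jN) klo khi (proj2 (slt_prepend (rcons v j) lo hi) (@lo_hi n)) g).
have o0D : (1 < n.+2)%N by [].
have up k : (k < n)%N -> t (prepend (rcons v (inord (n.+1 - k))) lo) = prepend (rcons v (inord (n.+1 - k))) lo
    /\ t (prepend (rcons v (inord (n.+1 - k))) hi) = prepend (rcons v (inord (n.+1 - k))) hi.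
  elim: k => [|k IH] kn.
    have -> : inord (n.+1 - 0) = ord_max :> D by apply: ord_inj; rewrite inordK subn0.
    by rewrite hi_rcons gap ?max_o1 // hi_rcons.
  have [klo khi] := IH (ltnW kn).
  have E1 : (inord (n.+1 - k.+1) : D) = (n.+1 - k.+1)%N :> nat by rewrite inordK //; lia.
  have E2 : (inord (n.+1 - k) : D) = (n.+1 - k)%N :> nat by rewrite inordK //; lia.
  have H : t (prepend (rcons v (inord (n.+1 - k.+1))) hi) = prepend (rcons v (inord (n.+1 - k.+1))) hi.
    apply: (proj2 (@adjacent_fix _ t t' v _ _ tK t'K tM _)) klo.
    by rewrite E1 E2; lia.
  split=> //; apply/gap => //; apply/eqP => /(congr1 (@nat_of_ord _)).
  by rewrite E1 val_o1; lia.
have zero : t (prepend (rcons v ord0) lo) = prepend (rcons v ord0) lo /\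
    t (prepend (rcons v ord0) hi) = prepend (rcons v ord0) hi.
  by rewrite -gap ?zero_o1 // lo_rcons.
move=> j; have [->|j0] := eqVneq j ord0; first exact: zero.
have [->|j1] := eqVneq j o1.
  split; first exact: (proj1 (@adjacent_fix _ t t' v ord0 o1 tK t'K tM (val_o1 n)) zero.2).
  apply: (proj2 (@adjacent_fix _ t t' v o1 (inord 2) tK t'K tM _)).
    by rewrite val_o1 inordK //; lia.
  by have := (up n.-1 ltac:(lia)).1; rewrite (_ : (n.+1 - n.-1)%N = 2) //; lia.
have jv : (1 < j)%N.
  rewrite ltn_neqAle gtn0 // andbT; apply/eqP => E; case/eqP: j1; apply: ord_inj.
  by rewrite val_o1.
have := up (n.+1 - j)%N ltac:(have := ltn_ord j; lia).
rewrite (_ : inord _ = j) //; apply: ord_inj.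
by rewrite subKn ?inordK // -ltnS.
Qed.

Lemma cones_fix t t' : cancel t t' -> cancel t' t -> smono t ->
  (forall v, o1 \notin v -> forall x, t (iter (N v) (exotic v) x) = iter (N v) (exotic v) (t x)) ->
  forall v, o1 \notin v -> t (prepend v lo) = prepend v lo /\ t (prepend v hi) = prepend v hi.
Proof.
move=> tK t'K tM tE; elim/last_ind => [_|v j IH].
  by split; [exact: smono_lo tK t'K tM|exact: smono_hi tK t'K tM].
rewrite mem_rcons inE negb_or => /andP[_ vN]; have [vlo vhi] := IH vN.
exact: (children_fix tK t'K tM tE vN vlo vhi).
Qed.

(** The ends of all cones of words without letter 1 are fixed, hence also the streams without 1, and
    [t] induces a map [s] on the cone of each [w 1]. Like [t], this [s] commutes with the powers of
    the exotic maps of words longer than [w]; the last hypothesis makes [t \o s'] a prefix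
    replacement at some depth, so it is the identity by [local_rigid]. Thus [s] is [t] itself, and
    [blk_ind] concludes. *)
Lemma exotic_rigid t t' : cancel t t' -> cancel t' t -> smono t ->
  (forall v, o1 \notin v -> forall x, t (iter (N v) (exotic v) x) = iter (N v) (exotic v) (t x)) ->
  (forall w (s s' : Y -> Y), o1 \notin w -> cancel s s' -> cancel s' s ->
    (forall x, t (blk w x) = blk w (s x)) -> exists d, forall a, size a = d ->
      exists a', forall x, t (s' (prepend a x)) = prepend a' x) ->
  t =1 id.
Proof.
move=> tK t'K tM tE tL; have fixed := cones_fix tK t'K tM tE.
apply: blk_ind => [x xN|w x wN].
  apply: eqs_eq => i; apply/eqs_sym.
  have iN : o1 \notin stake i x by apply/mapP => -[j _ E]; apply: (xN j).
  have [ilo ihi] := fixed _ iN.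
  have [s [_ [_ _ _ sE]]] := cone_fix tK t'K tM ilo ihi.
  rewrite -[X in eqs i _ (t X)](prepend_stake i x) sE; apply/eqs_stake.
  by rewrite -{2}(size_stake i x) stake_prepend.
have [wlo whi] := fixed w wN.
have [olo ohi] := children_fix tK t'K tM tE wN wlo whi o1.
have [s [s' [sK s'K sM sE]]] := cone_fix tK t'K tM olo ohi.
have {}sE y : t (blk w y) = blk w (s y) by rewrite !blkE sE.
have [d dP] := tL w s s' wN sK s'K sE.
have s'M := smono_can sK s'K sM.
have sC v : o1 \notin v -> (size w < size v)%N -> forall y,
    s (iter (N v) (exotic v) y) = iter (N v) (exotic v) (s y).
  move=> vN wv y; apply: (@prepend_inj _ (rcons w o1)); rewrite -blkE -sE !blkE.
  have bB : blocks (rcons w o1) by rewrite -cats1; apply: blocksS => //; exact: blocks0.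
  have sb : (size (rcons w o1) <= size v)%N by rewrite size_rcons.
  by rewrite -!exotic_iter_blocks // tE // -!blkE sE.
suff H : t \o s' =1 id.
  by rewrite sE; congr blk; have := H (s x); rewrite /= sK => ->.
apply: (@local_rigid _ (s \o t') (size w) d).
- by move=> y /=; rewrite tK s'K.
- by move=> y /=; rewrite sK t'K.
- by move=> y z /s'M /tM.
- move=> v vN wv y /=; rewrite -tE //; congr t.
  by rewrite -{1}(s'K y) -sC // sK.
exact: dP.
Qed.

End Rigidity.

End Exotic.

(** * Continuity of block maps and their compatibility with prefixes *)

Section Continuity.

Variable n : nat.
Local Notation D := 'I_n.+2.
Local Notation Y := (cantor_seq n.+2).
Local Notation o1 := (@o1 n).
Implicit Types (x y z : Y) (s t w : seq D) (f g : Y -> Y).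

Definition scont f := forall x m, exists k, forall y, eqs k x y -> eqs m (f x) (f y).

Lemma sploc_scont f : sploc f -> scont f.
Proof.
move=> lf x m; have [s [t [[a ->] st]]] := lf x; exists (size s + m)%N => y E.
have [b yE] : incone s y by apply: eqs_incone E (incone_prepend s a); exact: leq_addr.
move: E; rewrite yE => /eqs_prependE E; rewrite !st.
by apply: (eqs_le (leq_addl (size t) m)); exact: eqs_prepend.
Qed.

Lemma scont_comp f g : scont f -> scont g -> scont (g \o f).
Proof.
move=> cf cg x m; have [k kP] := cg (f x) m; have [l lP] := cf x k.
by exists l => y /lP /kP.
Qed.

Lemma scont_sub1 g : scont g -> scont (sub1 g).
Proof.
move=> cg x m; have [xN|[[w a] /= [wN ->]]] := dec1 x.
  exists m => y E; rewrite sub1_no1 //; have [yN|[[w b] /= [wN yE]]] := dec1 y.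
    by rewrite sub1_no1.
  rewrite yE sub1_blk // in E *; apply: (eqs_trans E) => i im.
  have wm : (m <= size w)%N.
    rewrite leqNgt; apply/negP => wm; apply: (xN (size w)).
    by rewrite E // /blk prependE ltnn subnn.
  by rewrite /blk !prependE (leq_trans im wm).
have [k kP] := cg a m; exists (size (rcons w o1) + k)%N => y E.
have [b yE] : incone (rcons w o1) y.
  by apply: eqs_incone E _; [exact: leq_addr|rewrite blkE; exact: incone_prepend].
move: E; rewrite yE blkE => /eqs_prependE /kP E; rewrite -!blkE !sub1_blk // !blkE.
by apply: (eqs_le (leq_addl (size (rcons w o1)) m)); exact: eqs_prepend.
Qed.

Lemma scont_lev f : inert f -> scont f -> scont (lev f).
Proof.
move=> fI cf; have H k : scont (lev_ f k).
  elim: k => [|k IH] //; exact: (scont_comp (scont_sub1 IH) cf).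
move=> x m; have [k kP] := H m x m; exists k => y /kP E.
apply: (@eqs_trans _ _ (lev_ f m x)); first exact: (eqs_le (leqnSn m) (@lev_eqs _ _ fI m x)).
apply: (eqs_trans E); apply: eqs_sym; exact: (eqs_le (leqnSn m) (@lev_eqs _ _ fI m y)).
Qed.

Lemma sploc_comp f g : sploc f -> sploc g -> sploc (g \o f).
Proof.
move=> lf lg x; have [u [v [[a xE] uv]]] := lf x.
have [u' [v' [[a' xE'] uv']]] := lg (f x).
have E : prepend v a = prepend u' a' by rewrite -uv -xE.
have [[p pE]|[p pE]] := prepend_comp E.
  subst u'; move: E; rewrite prepend_cat => /prepend_inj aE.
  exists (u ++ p), v'; split=> [|b] /=; first by exists a'; rewrite prepend_cat xE aE.
  by rewrite prepend_cat uv -prepend_cat uv'.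
exists u, (v' ++ p); split=> [|b] /=; first by exists a.
by rewrite uv pE !prepend_cat uv'.
Qed.

Lemma sploc_prepend s : sploc (prepend s).
Proof. by move=> x; exists [::], s; split; first exists x. Qed.

(* Prefixing a word commutes with [sub1 (lev f)] up to a locally prefix-replacing *)
(* map, because [lev f = f \o sub1 (lev f)] and [f] is locally prefix-replacing.  *)
Lemma sub1_lev_prepend f s : inert f -> sploc f -> exists tau, sploc tau /\
  forall x, sub1 (lev f) (prepend s x) = tau (sub1 (lev f) x).
Proof.
move=> fI lf; have levE x : lev f x = f (sub1 (lev f) x).
  have [xN|[[w a] /= [wN ->]]] := dec1 x; first by rewrite lev_no1 // sub1_no1.
  by rewrite lev_blk // sub1_blk.
elim: s => [|d s [tau [lt tE]]].
  by exists id; split=> //; exact: (@sploc_prepend [::]).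
have [->|/eqP d1] := eqVneq d o1.
  exists (prepend [:: o1] \o (f \o tau)); split.
    by apply: sploc_comp; [exact: sploc_comp|exact: sploc_prepend].
  move=> x; rewrite -[prepend _ x]/(blk [::] (prepend s x)) sub1_blk //.
  by rewrite levE tE.
exists (prepend [:: d] \o tau); split; first by apply: sploc_comp => //; exact: sploc_prepend.
move=> x; rewrite /= -tE; move: (prepend s x) => y.
have [yN|[[w b] /= [wN ->]]] := dec1 y.
  by rewrite !sub1_no1 //; exact: no1_scons.
rewrite -[scons d (blk w b)]/(blk (d :: w) b) !sub1_blk //.
by rewrite inE negb_or eq_sym wN andbT; apply/eqP.
Qed.

End Continuity.

(** * Exotic homeomorphisms normalizing T *)

Section ExoticHomeo.

Variables n r : nat.
Local Notation D := 'I_n.+2.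
Local Notation Y := (cantor_seq n.+2).
Local Notation X := (cantor n.+2 r.+1).
Local Notation W := (word n.+2 r.+1).
Local Notation inT := (@is_HigmanThompsonT n.+2 r.+1).
Local Notation hom := (homeo X).
Implicit Types (x y z : X) (u v w : W) (f g h s t : hom).

Local Open Scope group_scope.

Definition tail_map (k : Y -> Y) x : X := (x.1, k x.2).

Lemma tail_map_homeo (k k' : Y -> Y) : cancel k k' -> cancel k' k -> scont k -> scont k' ->
  exists g : hom, g =1 tail_map k /\ g^-1 =1 tail_map k'.
Proof.
move=> kK k'K ck ck'.
have C (q : Y -> Y) : scont q -> continuous (tail_map q).
  move=> cq; apply/continuousP_eqx => -[d a] m; have [l lP] := cq a m.
  by exists l => -[e b] [/= -> E]; split=> //; exact: lP.
have K1 : cancel (tail_map k) (tail_map k') by case=> d a; rewrite /tail_map /= kK.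
have K2 : cancel (tail_map k') (tail_map k) by case=> d a; rewrite /tail_map /= k'K.
by exists (Homeo K1 K2 (C _ ck) (C _ ck')).
Qed.

Lemma tail_map_mono (k : Y -> Y) : smono k -> monox (tail_map k).
Proof. by move=> kM x y [L|[E L]]; [left|right; split=> //; exact: kM]. Qed.

(** Near [f^-1 z] the map [t] replaces [u] by [v]. By [sub1_lev_prepend], on these two cones [f]
    gives [p] and [q] of one and the same stream, both locally prefix-replacing, so [t ^ f] locally
    undoes [p] and applies [q]. *)
Lemma lev_norm f (k : Y -> Y) (t : hom) : f =1 tail_map (sub1 (lev k)) -> smono (sub1 (lev k)) ->
  inert k -> sploc k -> inT t -> inT (t ^ f).
Proof.
move=> fE fM kI kl Tt; apply: T_crit; last first.
  apply: cycp_conj; last exact: isT_cycp.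
  left; rewrite (funext fE); apply: monox_cycp; exact: tail_map_mono.
move=> z; have [u [v [[b xE] uv]]] := isT_ploc Tt (f^-1 z).
have [p [lp pE]] := sub1_lev_prepend u.2 kI kl.
have [q [lq qE]] := sub1_lev_prepend v.2 kI kl.
pose c := sub1 (lev k) b.
have [s1 [s1' [[c1 c1E] s1E]]] := lp c; have [s2 [s2' [[c2 c2E] s2E]]] := lq c.
have [e1 [e2 [c3 [c3E eE]]]] : exists e1 e2 c3, c = prepend (s1 ++ e1) c3 /\ s1 ++ e1 = s2 ++ e2.
  have E : prepend s1 c1 = prepend s2 c2 by rewrite -c1E.
  have [[e F]|[e F]] := prepend_comp E.
    by exists e, [::], c2; rewrite cats0 -F.
  by exists [::], e, c1; rewrite cats0 -F.
have key a : (t ^ f) (u.1, prepend (s1' ++ e1) a) = (v.1, prepend (s2' ++ e2) a).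
  have [y yE] : exists y : Y, sub1 (lev k) y = prepend (s1 ++ e1) a.
    exists (f^-1 ((u.1, prepend (s1 ++ e1) a) : X)).2.
    have := hmulVK f ((u.1, prepend (s1 ++ e1) a) : X); rewrite fE => /(congr1 (fun w : X => w.2)).
    exact.
  have -> : (u.1, prepend (s1' ++ e1) a) = f (wcat u y).
    by rewrite fE /tail_map /= pE yE !prepend_cat s1E.
  by rewrite hconjE hmulK uv fE /tail_map /= qE yE eE !prepend_cat s2E.
exists (u.1, s1' ++ e1), (v.1, s2' ++ e2); split; last exact: key.
exists c3; rewrite /wcat /= -(hmulVK f z) xE fE /tail_map /= pE -/c c3E.
by rewrite !prepend_cat s1E.
Qed.

Lemma exotic_ex (v : seq D) : (0 < n)%N -> @o1 n \notin v -> exists g : hom,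
  [/\ g =1 tail_map (sub1 (exotic v)), forall t, inT t -> inT (t ^ g) & forall t, inT t -> inT (t ^ g^-1)].
Proof.
move=> n0 vN.
have fI := Ats_inert vN (Amap_inert n0); have fI' := Ats_inert vN (Ainv_inert n0).
have fl := Ats_loc v (@Amap_loc n); have fl' := Ats_loc v (@Ainv_loc n).
have K := exoticK n0 vN; have K' := exotic_invK n0 vN; have M := exotic_mono n0 vN.
have M' := smono_can K K' M.
have [g [gE gE']] := tail_map_homeo (sub1K K) (sub1K K')
  (scont_sub1 (scont_lev fI (sploc_scont fl))) (scont_sub1 (scont_lev fI' (sploc_scont fl'))).
exists g; split=> // t.
  exact: (lev_norm (k := Ats v (@Amap n)) gE (sub1_mono M) fI fl).
exact: (lev_norm (k := Ats v (@Ainv n)) gE' (sub1_mono M') fI' fl').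
Qed.

End ExoticHomeo.

(** * Rigidity *)

Section Germs.

Variables n r : nat.
Local Notation Y := (cantor_seq n.+2).
Local Notation X := (cantor n.+2 r.+1).
Local Notation W := (word n.+2 r.+1).
Local Notation inT := (@is_HigmanThompsonT n.+2 r.+1).
Local Notation hom := (homeo X).
Local Notation zw := (@zw n r).
Local Notation lo := (@lo n).
Local Notation hi := (@hi n).
Local Notation xmax := (@xmax n r).
Local Notation q := (@xmin n r).
Implicit Types (x z : X) (u v w : W) (f g h s t y : hom).

Local Open Scope group_scope.

Lemma dense_below x z : (forall m, sdrop m x.2 <> lo) -> xlt z x -> exists p, xlt z p /\ xlt p x.
Proof.
move=> xN zx; have nz m : exists j, (m <= j)%N /\ (0 < dig x.2 j)%N.
  have [j [_ E]] := neq_first (xN m); exists (m + j)%N; split; first exact: leq_addr.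
  by rewrite lt0n; apply/eqP => F; apply: E; apply: ord_inj.
have H j : (0 < dig x.2 j)%N -> xlt (x.1, prepend (stake j x.2) lo) x.
  move=> xj; right; split=> //=; exists j; split.
    by apply/eqs_sym/eqs_stake; rewrite -{2}(size_stake j x.2) stake_prepend.
  by rewrite {1}/dig prependE size_stake ltnn.
case: zx => [L|[E [i [Ei Li]]]].
  have [j [_ xj]] := nz 0%N; exists (x.1, prepend (stake j x.2) lo); split; last exact: H.
  by left.
have [j [ij xj]] := nz i.+1; exists (x.1, prepend (stake j x.2) lo); split; last exact: H.
have xE l : (l < j)%N -> (prepend (stake j x.2) lo : Y) l = x.2 l.
  by move=> lj; rewrite prependE size_stake lj nth_mkseq.
right; split=> //; exists i; split=> [l li|].
  by rewrite /= Ei // xE // (ltn_trans li).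
have -> // : dig (prepend (stake j x.2) lo) i = dig x.2 i by rewrite /dig xE.
Qed.

(** The minimum follows the maximum immediately in the cyclic order, and so must their images; a
    stream that is not eventually zero is a limit from below and follows no point immediately. *)
Lemma image_xmin y : cycp y -> exists w, w.2 <> [::] /\ y q = wcat w lo.
Proof.
move=> cy; have [[m mE]|H] := pselect (exists m, sdrop m (y q).2 = lo).
  exists (pre m.+1 (y q)); split=> //; rewrite -{1}(wcat_pre m.+1 (y q)); congr wcat.
  by apply/funext => i; rewrite /sdrop addSnnS; exact: (congr1 (@^~ i.+1) mE).
have ycq : y xmax <> y q by move=> /hinj [] _ /(congr1 (@^~ 0%N)).
have N z : ~ cyc (y xmax) z (y q).
  move=> /(cycp_inv cy); rewrite !hmulK => -[[]|[[]|[]]] A B; last exact: xmax_max B.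
  - exact: xmax_max A.
  - exact: xmin_min A.
exfalso; have [/(dense_below _) F|F] := xlt_total ycq.
  have [p [pl pr]] := F (fun m E => H (ex_intro _ m E)).
  by apply: (N p); left.
apply: (N q); right; left; split=> //; apply: xmin_lt => E.
by apply: H; exists 0%N; rewrite E; apply/funext.
Qed.

Definition germ f g := exists m, forall a, f (wcat (zw m) a) = g (wcat (zw m) a).

Lemma zwD m k : zw (m + k) = wext (zw m) (nseq k ord0).
Proof. by rewrite /zw /wext nseqD. Qed.

Lemma zw_wcat m k a : wcat (zw (m + k)) a = wcat (zw m) (prepend (nseq k ord0) a) :> X.
Proof. by rewrite zwD wcat_wext. Qed.

Lemma xmin_zw m : q = wcat (zw m) lo.
Proof.
rewrite /wcat /xmin /=; congr pair; apply/funext => i.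
by rewrite prependE nth_nseq !if_same.
Qed.

Lemma pre_q m : pre m q = zw m.
Proof.
rewrite /pre /zw; congr pair; rewrite [RHS]/=.
apply: (@eq_from_nth _ ord0); rewrite ?size_stake ?size_nseq // => i im.
by rewrite nth_mkseq // nth_nseq im.
Qed.

Lemma zw_eqx m x : eqx m q x <-> wprefix (zw m) x.
Proof.
rewrite pre_eqx pre_q wprefixP -[size _]/(size (nseq m (@ord0 n.+1))) size_nseq.
by split.
Qed.

Lemma germ_q f m : f q = q -> exists k, forall a, exists b, f (wcat (zw k) a) = wcat (zw m) b.
Proof.
move=> fq; have [k kP] := hom_mod f q m; exists k => a.
have /zw_eqx/kP : wprefix (zw k) (wcat (zw k) a) by exact: wprefix_wcat.
by rewrite fq => /zw_eqx.
Qed.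

Lemma germ_refl f : germ f f. Proof. by exists 0%N. Qed.

Lemma germ_trans g f h : germ f g -> germ g h -> germ f h.
Proof.
move=> [m H] [l H']; exists (m + l)%N => a.
by rewrite zw_wcat H -zw_wcat addnC zw_wcat H'.
Qed.

Lemma germ_mul f f' g g' : f q = q -> germ f f' -> germ g g' -> germ (f * g) (f' * g').
Proof.
move=> fq [m H] [l H']; have [k kP] := germ_q l fq; exists (m + k)%N => a.
rewrite !hmulE; have -> : f' (wcat (zw (m + k)) a) = f (wcat (zw (m + k)) a).
  by rewrite zw_wcat H.
by rewrite addnC zw_wcat; have [b ->] := kP (prepend (nseq m ord0) a); rewrite H'.
Qed.

Lemma fix_inv f : f q = q -> f^-1 q = q.
Proof. by move=> E; rewrite -{1}E hmulK. Qed.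

Lemma germ_conj f f' h : f q = q -> h q = q -> germ f f' -> germ (f ^ h) (f' ^ h).
Proof.
move=> fq hq H; apply: germ_mul; [exact: fix_inv|exact: germ_refl|].
by apply: germ_mul => //; exact: germ_refl.
Qed.

Lemma germ_exp f f' k : f q = q -> germ f f' -> germ (f ^+ k) (f' ^+ k).
Proof.
move=> fq H; elim: k => [|k IH]; first exact: germ_refl.
by rewrite !expgS; apply: germ_mul.
Qed.

Lemma zw_hi i j : wcat (zw i) hi = wcat (zw j) hi :> X -> i = j.
Proof.
have H k l : (k < l)%N -> wcat (zw k) hi <> wcat (zw l) hi :> X.
  move=> kl /(congr1 (fun x : X => x.2 k)); rewrite /= !prependE !size_nseq ltnn kl.
  by rewrite nth_nseq kl.
by move=> E; case: (ltngtP i j) => [/H|/H /nesym|].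
Qed.

Lemma T_germ t : inT t -> t q = q -> exists i j, forall a, t (wcat (zw i) a) = wcat (zw j) a.
Proof.
move=> Tt tq; have [u [v [[a E] uv]]] := isT_ploc Tt q.
have H w b : q = wcat w b -> w = zw (size w.2) /\ b = lo.
  move=> F; have F' : w = zw (size w.2).
    have /wprefixP : wprefix w q by exists b.
    by rewrite pre_q.
  split=> //; move: F; rewrite F' (xmin_zw (size w.2)) => /wcat_inj -> //.
have [uE aE] := H _ _ E.
have [vE _] := H v a ltac:(by rewrite -uv -E tq).
by exists (size u.2), (size v.2) => b; rewrite -uE -vE.
Qed.

(** Near the minimum it deletes one zero; by [T_germ], its powers give the germs at the minimum of
    all elements of [T] that fix it. *)
Definition sigma : hom := hA (zw 0).

Lemma sigma_zw m a : sigma (wcat (zw m.+2) a) = wcat (zw m.+1) a.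
Proof.
rewrite /sigma -[in LHS](add0n m.+2) zw_wcat hAE /Amap /= /wcat /=.
by congr pair; apply/funext.
Qed.

Lemma sigma_exp k m a : (sigma ^+ k) (wcat (zw (k + m.+1)) a) = wcat (zw m.+1) a.
Proof.
elim: k => [|k IH]; first by rewrite expg0.
by rewrite expgS hmulE addSn addnS sigma_zw -addnS IH.
Qed.

Lemma sigma_q : sigma q = q.
Proof. by rewrite (xmin_zw 2) sigma_zw -!xmin_zw. Qed.

Lemma sigma_ge x : ~ xlt (sigma x) x.
Proof.
have [[a ->]|H] := pselect (wprefix (zw 0) x); last by rewrite /sigma hA_supp //; exact: xlt_irr.
rewrite /sigma hAE => /xlt_wcat.
have [->|alo] := pselect (a = lo); first by rewrite Amap_lo => /slt_irr.
have [->|ahi] := pselect (a = hi); first by rewrite Amap_hi => /slt_irr.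
exact: slt_asym (Amap_up alo ahi).
Qed.

Definition norm y := forall t, inT t -> inT (t ^ y) /\ inT (t ^ y^-1).

Lemma mono_inv y : monox y -> monox y^-1.
Proof.
move=> my a b ab; have [E|/xlt_total[//|/my]] := pselect (y^-1 a = y^-1 b).
  by move: ab; rewrite (hinj E) => /xlt_irr.
by rewrite !hmulVK => /(xlt_asym ab).
Qed.

(** By [T_germ] the conjugate replaces [0^i] by [0^j] near the minimum, and [j <= i] because [sigma]
    moves no point down and [y] is increasing. *)
Lemma sigma_conj y : monox y -> y q = q -> norm y -> exists e, germ (sigma ^ y) (sigma ^+ e).
Proof.
move=> my yq yN; have [Ts _] := yN _ (hA_T (zw 0)).
have [|i [j ij]] := T_germ Ts; first by rewrite hconjE fix_inv // sigma_q.
have ji : (j <= i)%N.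
  rewrite leqNgt; apply/negP => L.
  have zl : xlt ((sigma ^ y) (wcat (zw i) hi)) (wcat (zw i) hi).
    rewrite ij; right; split=> //; exists i; split=> [l li|].
      by rewrite /= !prependE !size_nseq li (ltn_trans li L) !nth_nseq li (ltn_trans li L).
    by rewrite /dig /= !prependE !size_nseq ltnn L nth_nseq L subnn.
  have := mono_inv my zl; rewrite hconjE hmulK; exact: sigma_ge.
exists (i - j)%N; exists (i + 1)%N => a; rewrite {1}zw_wcat ij -zw_wcat.
by rewrite (_ : (i + 1 = (i - j) + j.+1)%N) ?sigma_exp ?addn1 //; lia.
Qed.

(* The exponents [e] and [e'] obtained for [y] and its inverse satisfy           *)
(* [e' * e = 1].                                                                 *)
Lemma sigma_commute y : monox y -> y q = q -> norm y -> germ (sigma * y) (y * sigma).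
Proof.
move=> my yq yN; have [e eP] := sigma_conj my yq yN.
have yN' : norm y^-1 by move=> t Tt; have [] := yN _ Tt; rewrite invgK.
have [e' e'P] := sigma_conj (mono_inv my) (fix_inv yq) yN'.
have H : germ sigma (sigma ^+ (e' * e)).
  rewrite -{1}(conjgK y sigma); apply: (@germ_trans ((sigma ^+ e) ^ y^-1)).
    apply: germ_conj => //; last exact: fix_inv.
    by rewrite hconjE fix_inv // sigma_q.
  rewrite conjXg expgnA; apply: germ_exp => //.
  by rewrite hconjE invgK yq sigma_q fix_inv.
have [m mP] := H; have := mP (prepend (nseq (e' * e + 2) ord0) hi).
rewrite -zw_wcat; have -> : (m + (e' * e + 2) = (m + e' * e).+2)%N by lia.
rewrite sigma_zw; have -> : ((m + e' * e).+2 = e' * e + m.+2)%N by lia.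
rewrite sigma_exp => /zw_hi E.
have e1 : e = 1%N by move: E; case: (e') => [|[|k]] /=; nia.
move: eP; rewrite e1 expg1 => eP.
have -> : sigma * y = y * (sigma ^ y) by rewrite /conjg mulVKg.
by apply: germ_mul => //; exact: germ_refl.
Qed.

End Germs.

(** * Maps commuting modulo T with powers of the exotic homeomorphisms *)

Section Rigid.

Variables n r : nat.
Local Notation D := 'I_n.+2.
Local Notation Y := (cantor_seq n.+2).
Local Notation X := (cantor n.+2 r.+1).
Local Notation W := (word n.+2 r.+1).
Local Notation inT := (@is_HigmanThompsonT n.+2 r.+1).
Local Notation hom := (homeo X).
Local Notation zw := (@zw n r).
Local Notation lo := (@lo n).
Local Notation hi := (@hi n).
Local Notation o1 := (@o1 n).
Local Notation q := (@xmin n r).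
Implicit Types (x z : X) (u w : W) (v : seq D) (f g h s t y : hom).

Local Open Scope group_scope.

Hypothesis n0 : (0 < n)%N.
Variables (G : seq D -> hom) (N : seq D -> nat).
Hypothesis GE : forall v, o1 \notin v -> G v =1 tail_map (sub1 (exotic v)).
Hypothesis GT : forall v, o1 \notin v -> forall t, inT t -> inT (t ^ G v).
Hypothesis N0 : forall v, (0 < N v)%N.

Let K v := G v ^+ N v.

Lemma zeros_no1 k : o1 \notin nseq k (@ord0 n.+1).
Proof. by rewrite mem_nseq negb_and (negbTE (o1_neq0 n)) orbT. Qed.

Lemma sub1_prepend (g : Y -> Y) (w : seq D) (a : Y) : o1 \notin w ->
  sub1 g (prepend w a) = prepend w (sub1 g a).
Proof.
move=> wN; have [aN|[[u b] /= [uN ->]]] := dec1 a.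
  by rewrite !sub1_no1 //; exact: no1_prepend.
rewrite sub1_blk // /blk -!prepend_cat -/(blk (w ++ u) _) -/(blk (w ++ u) _) sub1_blk //.
by rewrite mem_cat negb_or wN.
Qed.

Definition nz (a : Y) i := eqs i lo a /\ (a i : D) <> ord0.

Lemma nz_ex (a : Y) : a <> lo -> exists i, nz a i.
Proof. by move=> /nesym/neq_first[i [E F]]; exists i; split=> // /esym. Qed.

Lemma nz_uniq (a : Y) i j : nz a i -> nz a j -> i = j.
Proof.
by move=> [Ei Fi] [Ej Fj]; case: (ltngtP i j) => // [/Ej/esym|/Ei/esym].
Qed.

(** The first nonzero letter occurs no later than the first letter 1, and [sub1] only changes what
    follows that letter. *)
Lemma nz_sub1 (g : Y -> Y) (a : Y) i : nz a i -> nz (sub1 g a) i.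
Proof.
have [aN|[[w b] /= [wN ->]]] := dec1 a; first by rewrite sub1_no1.
rewrite sub1_blk // => -[E F].
have iw : (i <= size w)%N.
  rewrite leqNgt; apply/negP => /E; rewrite /blk prependE ltnn subnn /= => H.
  by have := o1_neq0 n; rewrite -H eqxx.
have bE c l : (l <= size w)%N -> blk w c l = nth ord0 (rcons w o1) l.
  by move=> lw; rewrite blkE prependE size_rcons ltnS lw.
split=> [l li|]; last by move: F; rewrite !bE.
by have := E l li; rewrite !bE ?(leq_trans (ltnW li)).
Qed.

Lemma nz_zeros k (a : Y) i : nz a i -> nz (prepend (nseq k ord0) a) (k + i)%N.
Proof.
move=> [E F]; split=> [l li|].
  rewrite prependE size_nseq nth_nseq if_same; case: (ltnP l k) => // kl.
  by rewrite -(E (l - k)%N) // ltn_subLR.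
by rewrite prependE size_nseq ltnNge leq_addr addKn.
Qed.

Lemma K_zw v k (a : Y) : o1 \notin v ->
  K v (wcat (zw k) a) = wcat (zw k) (iter (N v) (sub1 (exotic v)) a).
Proof.
move=> vN; rewrite /K; elim: (N v) => [|m IH]; first by rewrite expg0.
rewrite expgSr hmulE IH GE // /tail_map /= sub1_prepend //; exact: zeros_no1.
Qed.

Lemma K_blk v (d : 'I_r.+1) (w : seq D) (a : Y) : o1 \notin v -> o1 \notin w ->
  K v ((d, blk w a) : X) = (d, blk w (iter (N v) (exotic v) a)).
Proof.
move=> vN wN; rewrite /K; elim: (N v) => [|m IH]; first by rewrite expg0.
by rewrite expgSr hmulE IH GE // /tail_map /= sub1_blk.
Qed.

Lemma K_no1 v x : o1 \notin v -> no1 x.2 -> K v x = x.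
Proof.
move=> vN xN; rewrite /K; elim: (N v) => [|m IH]; first by rewrite expg0.
by rewrite expgSr hmulE IH GE // /tail_map sub1_no1 //; case: (x).
Qed.

Lemma K_q v : o1 \notin v -> K v q = q.
Proof. by move=> vN; apply: K_no1 => //; exact: no1_lo. Qed.

Lemma K_T v t : o1 \notin v -> inT t -> inT (t ^ K v).
Proof.
move=> vN Tt; rewrite /K; elim: (N v) => [|m IH]; first by rewrite expg0 conjg1.
by rewrite expgSr conjgM; exact: GT.
Qed.

Section Fixing.

Variable y : hom.
Hypotheses (my : monox y) (yq : y q = q) (yN : norm y).
Hypothesis yK : forall v, o1 \notin v -> inT [~ y, K v].

(** The commutator is in [T] and fixes the minimum, so near it replaces [0^i] by [0^j]. At the image
    under [y] of a nearby point fixed by [K v] it acts as [K v], which keeps the position of the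
    first nonzero letter; hence [i = j]. *)
Lemma germ_K v : o1 \notin v -> germ (y * K v) (K v * y).
Proof.
move=> vN; have [t [Tt E]] : exists t, inT t /\ y * K v = K v * y * t.
  by exists [~ y, K v]; split; [exact: yK|exact: commgC].
have E' x : K v (y x) = t (y (K v x)) by exact: (congr1 (fun g : hom => g x) E).
have tq : t q = q by have := E' q; rewrite K_q // yq K_q.
have [i [j ij]] := T_germ Tt tq.
have [k kP] := germ_q i yq.
have [b bE] := kP hi.
have xq : wcat (zw k) hi <> q.
  by rewrite (xmin_zw n r k) => /wcat_inj /(congr1 (@^~ 0%N)).
have blo : b <> lo.
  by move=> F; apply: xq; apply: (@hinj _ _ y); rewrite bE F -xmin_zw yq.
have Et : K v (wcat (zw i) b) = wcat (zw j) b.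
  rewrite -ij -bE E' [K v (wcat (zw k) hi)]K_no1 //=; apply: no1_prepend; [exact: zeros_no1|exact: no1_hi].
have [l lP] := nz_ex blo.
have nzi : nz (prepend (nseq i ord0) (iter (N v) (sub1 (exotic v)) b)) (i + l).
  by apply: nz_zeros; elim: (N v) => //= m IH; exact: nz_sub1.
have ijE : i = j.
  move: Et; rewrite K_zw // => -[F]; rewrite F in nzi.
  have := nz_uniq nzi (nz_zeros j lP); lia.
rewrite E -[X in germ _ X]mulg1; apply: germ_mul; first by rewrite hmulE K_q.
  exact: germ_refl.
by exists i => a; rewrite ij ijE.
Qed.

(** The neighbourhood given by [germ_K] depends on [v]. The contraction [sigma^-1] commutes near the
    minimum with [y], by [sigma_commute], and with every [K v], so it pulls the relation back to one
    cone valid for all [v]. *)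
Lemma conj_cone : exists m, [/\ (0 < m)%N,
  forall a, exists b, y (wcat (zw m) a) = wcat (zw 1) b &
  forall v a, o1 \notin v -> y (K v (wcat (zw m) a)) = K v (y (wcat (zw m) a))].
Proof.
have [m1 m1P] := sigma_commute my yq yN; have [m2 m2P] := germ_q 1 yq.
pose m := (m1 + m2)%N.+1.
have y1 a : exists b, y (wcat (zw m) a) = wcat (zw 1) b.
  rewrite (_ : m = (m2 + m1.+1)%N); last by rewrite /m; lia.
  by rewrite zw_wcat; exact: m2P.
pose s := (sigma n r)^-1.
have sE k a : s (wcat (zw k.+1) a) = wcat (zw k.+2) a.
  by rewrite /s -(@sigma_zw n r k a) hmulK.
have ys k a : y (s (wcat (zw (m + k)) a)) = s (y (wcat (zw (m + k)) a)).
  rewrite {1}/m addSn sE -[LHS](hmulK (sigma n r)) -/s; congr (homeo_fun s _).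
  have := m1P (prepend (nseq (m2 + k).+2 ord0) a); rewrite !hmulE -zw_wcat.
  rewrite (_ : (m1 + (m2 + k).+2 = (m1 + m2 + k).+2)%N); last lia.
  by move=> <-; rewrite sigma_zw.
have sj j k a : (s ^+ j) (wcat (zw k.+1) a) = wcat (zw (k.+1 + j)) a.
  elim: j => [|j IH]; first by rewrite expg0 addn0.
  by rewrite expgSr hmulE IH addSn sE addnS.
have ysj j a : y ((s ^+ j) (wcat (zw m) a)) = (s ^+ j) (y (wcat (zw m) a)).
  elim: j => [|j IH]; first by rewrite expg0.
  by rewrite expgSr !hmulE -IH sj -ys.
exists m; split=> // v a vN; have [m3 m3P] := germ_K vN.
apply: (@hinj _ _ (s ^+ m3)).
have [b bE] := y1 a; have sb : (s ^+ m3) (K v (wcat (zw 1) b)) = K v ((s ^+ m3) (wcat (zw 1) b)).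
  by rewrite K_zw // !sj K_zw.
rewrite bE sb -bE -ysj K_zw // -ysj !sj -K_zw // addnC !zw_wcat.
by have := m3P (prepend (nseq m ord0) a); rewrite !hmulE.
Qed.

Lemma xcone_convex u (a b : Y) x : xlt (wcat u a) x -> xlt x (wcat u b) -> wprefix u x.
Proof.
move=> L L'; apply: contrapT => H.
exact: (xlt_asym L (xcone_gt _ L' H)).
Qed.

Lemma iter_ex_neq (a : Y) : a <> lo -> a <> hi -> iter (N [::]) (exotic [::]) a <> a.
Proof.
move=> alo ahi E; have U := @exotic_up n n0 [::] isT a alo ahi.
by have := iter_up n0 (isT : o1 \notin [::]) U (N0 [::]); rewrite E => /slt_irr.
Qed.

Lemma iter_ex_lo m : iter m (exotic [::]) lo = lo.
Proof. by elim: m => //= m ->; exact: (@exotic_lo n [::] isT). Qed.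

Lemma iter_ex_hi m : iter m (exotic [::]) hi = hi.
Proof. by elim: m => //= m ->; exact: (@exotic_hi n n0 [::] isT). Qed.

Definition ocone (d : 'I_r.+1) (w : seq D) : W := (d, rcons w o1).

Lemma oconeE d (w : seq D) (a : Y) : wcat (ocone d w) a = (d, blk w a) :> X.
Proof. by rewrite /wcat /= blkE. Qed.

Lemma K_ocone v d (w : seq D) (a : Y) : o1 \notin v -> o1 \notin w ->
  K v (wcat (ocone d w) a) = wcat (ocone d w) (iter (N v) (exotic v) a).
Proof. by move=> vN wN; rewrite !oconeE K_blk. Qed.

(* The cones of the words ending with their first letter 1 are recognized from    *)
(* the fixed points of [K [::]].                                                   *)
Lemma image_cone : exists u d (w : seq D) (B B' : Y -> Y), [/\ o1 \notin w, (0 < size u.2)%N,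
  [/\ cancel B B', cancel B' B & smono B],
  (forall a, y (wcat u a) = wcat (ocone d w) (B a)) &
  forall v, o1 \notin v -> forall a, B (iter (N v) (exotic v) a) = iter (N v) (exotic v) (B a)].
Proof.
have [m [m0 _ mK]] := conj_cone; have zN := zeros_no1 m.
pose e := ocone ord0 (nseq m ord0).
have eE a : wcat e a = wcat (zw m) (scons o1 a) by rewrite /e oconeE.
have yKe v a : o1 \notin v -> y (K v (wcat e a)) = K v (y (wcat e a)).
  by move=> vN; rewrite eE; exact: mK.
pose c : Y := scons ord0 hi.
have clo : c <> lo by move=> /(congr1 (@^~ 1%N)).
have chi : c <> hi by move=> /(congr1 (@^~ 0%N)).
have nilN : o1 \notin [::] by [].
have Ke a : K [::] (wcat e a) = wcat e (iter (N [::]) (exotic [::]) a) by exact: K_ocone.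
have zK : K [::] (y (wcat e c)) <> y (wcat e c).
  rewrite -yKe // => /hinj; rewrite Ke => /wcat_inj; exact: iter_ex_neq.
have [d [w [b [wN zE]]]] : exists d (w : seq D) b, o1 \notin w /\ y (wcat e c) = wcat (ocone d w) b.
  case: (dec1 (y (wcat e c)).2) => [/(K_no1 nilN) //|[[w b] /= [wN E]]].
  by exists (y (wcat e c)).1, w, b; split=> //; rewrite oconeE -E; case: (y _).
pose e' := ocone d w; have Ke' a : K [::] (wcat e' a) = wcat e' (iter (N [::]) (exotic [::]) a).
  exact: K_ocone.
have blo : b <> lo by move=> F; apply: zK; rewrite zE F Ke' iter_ex_lo.
have bhi : b <> hi by move=> F; apply: zK; rewrite zE F Ke' iter_ex_hi.
have my' := mono_inv my.
have gap' x : xlt (wcat e' lo) x -> xlt x (wcat e' hi) -> K [::] x <> x.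
  move=> L1 L2; have [a aE] := xcone_convex L1 L2; move: L1 L2; rewrite aE.
  move=> /xlt_wcat L1 /xlt_wcat L2; rewrite Ke' => /wcat_inj; apply: iter_ex_neq => F.
    by move: L1; rewrite F => /slt_irr.
  by move: L2; rewrite F => /slt_irr.
have gap x : xlt (y (wcat e lo)) x -> xlt x (y (wcat e hi)) -> K [::] x <> x.
  move=> /my'; rewrite hmulK => L1 /my'; rewrite hmulK => L2; rewrite -(hmulVK y x).
  have [a aE] := xcone_convex L1 L2; move: L1 L2; rewrite aE.
  move=> /xlt_wcat L1 /xlt_wcat L2; rewrite -yKe // Ke => /hinj/wcat_inj; apply: iter_ex_neq => F.
    by move: L1; rewrite F => /slt_irr.
  by move: L2; rewrite F => /slt_irr.
have zlo : xlt (wcat e' lo) (y (wcat e c)) by rewrite zE; apply/xlt_wcat; exact: lo_min.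
have zhi : xlt (y (wcat e c)) (wcat e' hi) by rewrite zE; apply/xlt_wcat; exact: hi_max.
have ylo' : xlt (y (wcat e lo)) (y (wcat e c)) by apply/my/xlt_wcat; exact: lo_min.
have yhi' : xlt (y (wcat e c)) (y (wcat e hi)) by apply/my/xlt_wcat; exact: hi_max.
(* Two gaps between fixed points of [K [::]] that share the point [y (wcat e c)] have the same
   ends. *)
have ylo : y (wcat e lo) = wcat e' lo.
  apply: contrapT => /xlt_total[L|L].
    by apply: (gap (wcat e' lo)) => //; [exact: xlt_trans yhi'|rewrite Ke' iter_ex_lo].
  apply: (gap' (y (wcat e lo))) => //; first exact: xlt_trans zhi.
  by rewrite -yKe // Ke iter_ex_lo.
have yhi : y (wcat e hi) = wcat e' hi.
  apply: contrapT => /xlt_total[L|L].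
    apply: (gap' (y (wcat e hi))) => //; first exact: xlt_trans zlo yhi'.
    by rewrite -yKe // Ke iter_ex_hi.
  by apply: (gap (wcat e' hi)) => //; [exact: xlt_trans ylo' zhi|rewrite Ke' iter_ex_hi].
have key (g : hom) u u' : monox g -> g (wcat u lo) = wcat u' lo -> g (wcat u hi) = wcat u' hi ->
    forall a, exists b, g (wcat u a) = wcat u' b.
  move=> gm glo ghi a; have [->|alo] := pselect (a = lo); first by exists lo.
  have [->|ahi] := pselect (a = hi); first by exists hi.
  suff [b' ->] : wprefix u' (g (wcat u a)) by exists b'.
  apply: (@xcone_convex _ lo hi); first by rewrite -glo; apply/gm/xlt_wcat; exact: lo_min.
  by rewrite -ghi; apply/gm/xlt_wcat; exact: hi_max.
have /choice[B BE] := key y e e' my ylo yhi.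
have /choice[B' B'E] := key y^-1 e' e my' ltac:(by rewrite -ylo hmulK) ltac:(by rewrite -yhi hmulK).
exists e, d, w, B, B'; split=> //.
- by rewrite /= size_rcons.
- split.
  + by move=> a; apply: (@wcat_inj _ _ e); rewrite -B'E -BE hmulK.
  + by move=> a; apply: (@wcat_inj _ _ e'); rewrite -BE -B'E hmulVK.
  + by move=> a a' L; apply/(xlt_wcat e'); rewrite -!BE; apply/my/xlt_wcat.
- move=> v vN a; apply: (@wcat_inj _ _ e').
  by rewrite -K_ocone // -!BE -yKe // K_ocone.
Qed.

(** [exotic_rigid] makes [B] the identity. Its local hypothesis comes from normalizing [T]: for [t]
    in [T] carrying the cone of [u w' 1] to that of [u], the map [t ^ y] is in [T], and it reads as
    [B \o s'] on the corresponding cones. *)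
Lemma cone_in_T : exists u u', (0 < size u.2)%N /\ sends y u u'.
Proof.
have [u [d [w [B [B' [wN u0 [BK B'K BM] BE BC]]]]]] := image_cone.
pose e' := ocone d w; exists u, e'; split=> // a.
rewrite BE (exotic_rigid n0 N0 BK B'K BM BC) //.
move=> w' s s' w'N sK s'K sE.
pose c := rcons w' o1.
have [t Tt tE] := @sends_ex _ _ (wext u c) u ltac:(by rewrite size_cat ltn_addr) u0.
have [Tty _] := yN Tt; have [k kP] := isT_unif Tty.
have tyE b : (t ^ y) (wcat (wext e' c) b) = wcat e' (B (s' b)).
  rewrite hconjE -BE -tE !wcat_wext; congr (y (t _)).
  by apply: (@hinj _ _ y); rewrite hmulVK BE -/e' /c -!blkE sE s'K.
exists k => b bk.
pose p := wext (wext e' c) b; pose p1 : W := (p.1, take k p.2).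
have pk : (k <= size p.2)%N by rewrite size_cat bk leq_addl.
have pE : p = wext p1 (drop k p.2) by rewrite /p1 /wext /= cat_take_drop.
have [p' p'E] := kP p1 ltac:(by rewrite size_takel).
have E (x : Y) : wcat e' (B (s' (prepend b x))) = wcat (wext p' (drop k p.2)) x.
  rewrite -tyE -[wcat _ (prepend b x)]wcat_wext -/p.
  have -> : wcat p x = wcat p1 (prepend (drop k p.2) x) :> X by rewrite -wcat_wext -pE.
  by rewrite p'E wcat_wext.
have [[l lE]|[[|l0 l] lE]] := wcat_comp (E lo).
- by exists l => x; apply: (@wcat_inj _ _ e'); rewrite E lE wcat_wext.
- by exists [::] => x; apply: (@wcat_inj _ _ e'); rewrite E lE [in RHS]wcat_wext.
have [l1 l01] : exists l1 : D, l1 <> l0.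
  have [->|/eqP H0] := eqVneq l0 ord0; first by exists ord_max.
  by exists ord0 => F; apply: H0.
have := E (scons l1 lo); rewrite lE [LHS]wcat_wext => /wcat_inj /(congr1 (@^~ 0%N)) /= F.
by case: l01.
Qed.

(** If [g] in [T] carries a given cone to the one where [y] replaces prefixes, then [y] is [g], then
    [y], then [(g^-1) ^ y], and the last factor is in [T]. *)
Lemma fixing_T : inT y.
Proof.
have [u [u' [u0 uE]]] := cone_in_T.
apply: T_crit; last exact: monox_cycp.
move=> x; have [g Tg gE] := @sends_ex _ _ (pre 1 x) u isT u0.
have [Tt _] := yN (isT_inv Tg); set t := g^-1 ^ y in Tt.
have yE : y = g * y * t by rewrite /t /conjg !mulgA mulgK mulgV mul1g.
rewrite yE; apply: (ploc_at_comp (f := g * y)); last exact: isT_ploc.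
exists (pre 1 x), u'; split; first exact: wprefix_pre.
by move=> a; rewrite hmulE gE uE.
Qed.

End Fixing.

Lemma rigid_T y : cycp y -> norm y -> (forall v, o1 \notin v -> inT [~ y, K v]) -> inT y.
Proof.
move=> cy yN yK; have [w [w0 yq]] := image_xmin cy.
have [t [Tt tq]] := sends_xmin w0; have ytq : (y * t) q = q by rewrite hmulE yq.
suff H : inT (y * t) by rewrite -(mulgK t y); apply: isT_mul => //; exact: isT_inv.
have Tt' := isT_inv Tt; apply: fixing_T => //.
- by apply: cycp_fix_mono => //; apply: (cycp_comp cy); exact: isT_cycp.
- move=> s Ts; split; first by rewrite conjgM; apply: isT_conj => //; have [] := yN _ Ts.
  by rewrite invgM conjgM; have [] := yN _ (isT_conj Ts Tt').
- move=> v vN; have -> : [~ y * t, K v] = [~ y, K v] ^ t * (t^-1 * t ^ K v).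
    by rewrite /commg /conjg !invgM !mulgA !mulgK.
  apply: isT_mul; first by apply: isT_conj => //; exact: yK.
  by apply: isT_mul => //; exact: K_T.
Qed.

End Rigid.

(** * Completeness of the automorphism group *)

Section Complete.

Variable G : groupType.
Implicit Types (x y z : G) (a b : aut G).

Local Open Scope group_scope.

Lemma aut_conjE a b x : (b ^ a) (a x) = a (b x).
Proof. by rewrite /= aut_funK. Qed.

Lemma aut1 a : a 1 = 1.
Proof. by apply: (@mulgI _ (a 1)); rewrite -aut_morph !mulg1. Qed.

Lemma autV a x : a x^-1 = (a x)^-1.
Proof. by apply: (@mulgI _ (a x)); rewrite -aut_morph !mulgV aut1. Qed.

Lemma autJ a x y : a (x ^ y) = a x ^ a y.
Proof. by rewrite /conjg !aut_morph autV. Qed.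

Lemma innerM x y : inner (x * y) = inner x * inner y :> aut G.
Proof. by apply: aut_ext => u /=; rewrite conjgM. Qed.

Lemma inner_conj a x : inner x ^ a = inner (a x).
Proof.
apply: aut_ext => u; rewrite -[u](aut_invK a); rewrite aut_conjE /=.
by rewrite autJ.
Qed.

Lemma inner1 : inner 1 = 1 :> aut G.
Proof. by apply: aut_ext => u /=; rewrite conjg1. Qed.

Lemma innerV x : inner x^-1 = (inner x)^-1 :> aut G.
Proof. by apply: (@mulgI _ (inner x)); rewrite -innerM !mulgV inner1. Qed.

End Complete.

Section Completeness.

Variable G : groupType.
Implicit Types (x y z : G) (a b : aut G).

Local Open Scope group_scope.

Hypothesis Z1 : forall x, (forall y, y * x = x * y) -> x = 1.

Lemma inner_inj : injective (@inner G).
Proof.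
move=> x y E; suff H : x * y^-1 = 1 by rewrite -(mulgVK y x) H mul1g.
apply: Z1 => z; have := congr1 (fun a : aut G => a z) E => /= F.
have H : z * x = x * z ^ y by rewrite -F /conjg mulVKg.
by rewrite mulgA H /conjg -!mulgA mulgV mulg1.
Qed.

Hypothesis inner_char : forall (phi : aut (aut G)) x, exists y, phi (inner x) = inner y.

(** Burnside: [phi] restricts to an automorphism [a] of the group of inner automorphisms, that is,
    of [G]. As [inner x ^ b = inner (b x)], this restriction determines [phi], which is therefore
    the conjugation by [a]. *)
Lemma inner_bij : group_isomorphism (@inner (aut G)).
Proof.
split=> [a b|]; first by apply: aut_ext => u /=; rewrite conjgM.
have inj : injective (@inner (aut G)).
  move=> a b E; apply: aut_ext => x; apply: inner_inj.
  by rewrite -!inner_conj; exact: (congr1 (fun f : aut (aut G) => f (inner x)) E).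
suff sur (phi : aut (aut G)) : exists a, inner a = phi.
  have /choice[f fE] := sur; exists f => [a|phi //]; exact: inj.
have /choice[s sE] := inner_char phi.
have /choice[s' s'E] := inner_char phi^-1.
have sM : {morph s : x y / x * y}.
  by move=> x y; apply: inner_inj; rewrite -sE !innerM aut_morph !sE.
have sK : cancel s s'.
  by move=> x; apply: inner_inj; rewrite -s'E -sE /= aut_funK.
have s'K : cancel s' s.
  by move=> x; apply: inner_inj; rewrite -sE -s'E /= aut_invK.
pose a := Aut sM sK s'K; exists a; apply: aut_ext => b.
apply: aut_ext => x; rewrite -[x]s'K; move: (s' x) => z.
rewrite [LHS](aut_conjE a b z) /=; apply: inner_inj.
by rewrite -inner_conj -!sE -autJ inner_conj.
Qed.

End Completeness.

(** * Commutators in normal subgroups *)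

Section NormalClosure.

Variables n r : nat.
Local Notation X := (cantor n.+2 r.+1).
Local Notation W := (word n.+2 r.+1).
Local Notation inT := (@is_HigmanThompsonT n.+2 r.+1).
Local Notation hom := (homeo X).
Implicit Types (x : X) (u w : W) (f g t : hom).

Local Open Scope group_scope.

(* If [nu] moves the cone of [w] off itself, [[~ f, g] = [~ (f^-1) ^ nu * f, g]]  *)
(* for [f] and [g] supported in that cone.                                        *)
Lemma normal_commutator (Q : hom -> Prop) nu : (forall s t, Q s -> Q t -> Q (s * t)) ->
  (forall s, Q s -> Q s^-1) -> (forall s t, Q s -> inT t -> Q (s ^ t)) -> Q nu -> nu <> 1 ->
  forall u f g, (0 < size u.2)%N -> inT f -> inT g -> supp u f -> supp u g -> Q [~ f, g].
Proof.
move=> QM QV QJ Qnu nu1 u f g u0 Tf Tg sf sg.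
have [x xP] : exists x, nu x <> x.
  apply: contrapT => H; apply: nu1; apply: homeo_ext => x; apply: contrapT => F.
  by apply: H; exists x.
have [m mP] := moved_disj xP; have [w [w0 wx wP]] := cone_at x m.
have [t Tt tE] := sends_ex u0 w0.
have main f' g' : inT f' -> inT g' -> supp w f' -> supp w g' -> Q [~ f', g'].
  move=> Tf' Tg' sf' sg'; pose h := (f'^-1) ^ nu.
  have hs z : wprefix w z -> h z = z.
    move=> wz; rewrite /h hconjE (supp_inv sf') ?hmulVK // => wn.
    by apply: (mP (nu^-1 z) z); [exact: wP|exact: wP|exact: hmulVK].
  have hcomm k : supp w k -> h * k = k * h.
    move=> sk; apply: (@comm_disj _ _ (fun z => h z <> z) (wprefix w)) => //.
    - by move=> z; exact: contrapT.
    - by move=> z hz /hs.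
  have Qhf : Q (h * f').
    have -> : h * f' = nu^-1 * nu ^ f'.
      by rewrite /h /conjg !mulgA.
    by apply: QM; [exact: QV|exact: QJ].
  have -> : [~ f', g'] = [~ h * f', g'].
    have hg : h ^ g' = h by rewrite /conjg hcomm // mulKg.
    by rewrite /commg conjMg hg invgM -mulgA mulKg.
  rewrite /commg; apply: QM; first exact: QV.
  exact: QJ.
have Tt' := isT_inv Tt.
have := main (f ^ t) (g ^ t) (isT_conj Tf Tt) (isT_conj Tg Tt) (sends_supp tE sf) (sends_supp tE sg).
rewrite -conjRg => H; rewrite -(conjgK t [~ f, g]); exact: QJ.
Qed.

End NormalClosure.

(** * The monolith of Aut T and the action of its automorphisms *)

Section Final.

Variables n r : nat.
Local Notation D := 'I_n.+2.
Local Notation X := (cantor n.+2 r.+1).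
Local Notation W := (word n.+2 r.+1).
Local Notation inT := (@is_HigmanThompsonT n.+2 r.+1).
Local Notation hom := (homeo X).

Local Open Scope group_scope.

Variables (G : groupType) (iota : G -> hom).
Hypothesis iM : {morph iota : x y / x * y}.
Hypothesis iI : injective iota.
Hypothesis iT : forall g, inT g <-> exists t, iota t = g.

Local Notation A := (aut G).
Implicit Types (s t x y z : G) (a b : A) (f g h : hom).

Lemma i1 : iota 1 = 1.
Proof. by apply: (@mulgI _ (iota 1)); rewrite -iM !mulg1. Qed.

Lemma iV x : iota x^-1 = (iota x)^-1.
Proof. by apply: (@mulgI _ (iota x)); rewrite -iM !mulgV i1. Qed.

Lemma iJ x y : iota (x ^ y) = iota x ^ iota y.
Proof. by rewrite /conjg !iM iV. Qed.

Lemma i_T x : inT (iota x).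
Proof. by apply/iT; exists x. Qed.

Record normal (P : A -> Prop) : Prop := Normal {
  normal_mul : forall a b, P a -> P b -> P (a * b);
  normal_inv : forall a, P a -> P a^-1;
  normal_conj : forall a b, P a -> P (a ^ b);
  normal_neq1 : exists a, P a /\ a <> 1 }.

Definition monolith a := forall P, normal P -> P a.

Definition inM g := exists t, monolith (inner t) /\ iota t = g.

Lemma monolith_aut (phi : aut A) a : monolith a -> monolith (phi a).
Proof.
move=> Ma P [PM PV PJ [b [Pb b1]]]; have := Ma (fun c => P (phi c)); apply; split=> [c d|c|c d|].
- by move=> Pc Pd; rewrite aut_morph; exact: PM.
- by move=> Pc; rewrite autV; exact: PV.
- by move=> Pc; rewrite autJ; exact: PJ.
exists (aut_inv phi b); rewrite aut_invK; split=> // E; apply: b1.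
by rewrite -(aut_invK phi b) E aut1.
Qed.

Lemma monolith_conj a b : monolith a -> monolith (a ^ b).
Proof. by move=> Ma P PN; apply: (normal_conj PN); exact: Ma. Qed.

(** If a normal [P] contains [a] with [a^-1 y <> y], it contains [a * a^-1 ^ inner y], which is the
    inner automorphism of a nontrivial [nu]; [normal_commutator] then puts the required commutators
    in [P]. *)
Lemma S_large : large inM.
Proof.
split=> [_ [t [_ <-]]|_ _ [s [Ms <-]] [t [Mt <-]]|_ [t [Mt <-]]|_ _ [s [Ms <-]] /iT[t <-]|].
- exact: i_T.
- exists (s * t); split; last exact: iM.
  by move=> P PN; rewrite innerM; apply: (normal_mul PN); [exact: Ms|exact: Mt].
- exists t^-1; split; last exact: iV.
  by move=> P PN; rewrite innerV; apply: (normal_inv PN); exact: Mt.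
- exists (s ^ t); split; last exact: iJ.
  by rewrite -[s ^ t]/(inner t s) -inner_conj; exact: monolith_conj.
move=> u _ _ u0 /iT[f <-] /iT[g <-] sf sg.
exists [~ f, g]; split; last by rewrite /commg iM iV iJ.
move=> P PN; have [PM PV PJ [a [Pa a1]]] := PN.
pose Q h := exists t, iota t = h /\ P (inner t).
suff [t [tE Pt]] : Q [~ iota f, iota g].
  suff -> : [~ f, g] = t by [].
  by apply: iI; rewrite tE /commg iM iV iJ.
have [y ay] : exists y, a^-1 y <> y.
  apply: contrapT => H; apply: a1; rewrite -[a]invgK; suff -> : a^-1 = 1 by rewrite invg1.
  by apply: aut_ext => y; apply: contrapT => F; apply: H; exists y.
pose nu := (a^-1 y)^-1 * y.
apply: (@normal_commutator _ _ Q (iota nu) _ _ _ _ _ u) => //; try exact: i_T.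
- move=> _ _ [s [<- Ps]] [t [<- Pt]]; exists (s * t); rewrite iM innerM; split=> //.
  exact: PM.
- by move=> _ [s [<- Ps]]; exists s^-1; rewrite iV innerV; split=> //; exact: PV.
- move=> _ _ [s [<- Ps]] /iT[t <-]; exists (s ^ t); rewrite iJ; split=> //.
  by rewrite -[s ^ t]/(inner t s) -inner_conj; exact: PJ.
- exists nu; split=> //.
  have -> : inner nu = a * a^-1 ^ inner y.
    by rewrite /nu innerM innerV -inner_conj /conjg !invgM invgK !mulgA.
  by apply: PM => //; apply: PJ; exact: PV.
- rewrite -i1 => /iI F; apply: ay; rewrite -[LHS]mulg1 -[1]F /nu mulVKg //.
Qed.

Let SL := S_large.

Lemma Z1 x : (forall y, y * x = x * y) -> x = 1.
Proof.
move=> xZ; apply: iI; rewrite i1; apply: (centralizer1 SL) => _ [t [_ <-]].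
by rewrite -!iM xZ.
Qed.

Let inI := inner_inj Z1.

Lemma monolith_inner a : monolith a -> exists x, a = inner x.
Proof.
move=> Ma; have := Ma (fun a => exists x, a = inner x); apply; split.
- by move=> _ _ [x ->] [y ->]; exists (x * y); rewrite innerM.
- by move=> _ [x ->]; exists x^-1; rewrite innerV.
- by move=> _ b [x ->]; exists (b x); rewrite inner_conj.
have [s [[t [_ tE]] _ ms]] := large_cone SL (isT : 0 < size ((ord0, [:: ord0]) : W).2).
exists (inner t); split; first by exists t.
rewrite -inner1 => /inI t1.
have [c [ca]] := ms (scons ord0 (@hi n)) 0%N
  (fun F => ltac:(by move: (congr1 (@^~ 1%N) F))) (fun F => ltac:(by move: (congr1 (@^~ 0%N) F))).
by rewrite expg1 -tE t1 i1 => /wcat_inj /esym.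
Qed.

Definition realizes a h := forall t, iota (a t) = iota t ^ h.

Lemma S_aut a s : inM (iota s) -> inM (iota (a s)).
Proof.
move=> [t [Mt /iI E]]; exists (a t); rewrite E; split=> //.
by rewrite -E -inner_conj; exact: monolith_conj.
Qed.

Lemma conj_eq (u v k : hom) : k ^ u = k ^ v -> u * v^-1 * k = k * (u * v^-1).
Proof.
move=> E; have H : k * u = u * k ^ v by rewrite -E /conjg mulVKg.
by rewrite mulgA H /conjg -!mulgA mulgV mulg1.
Qed.

Lemma conj_uniq u v : (forall s, inM (iota s) -> iota s ^ u = iota s ^ v) -> u = v.
Proof.
move=> H; suff E : u * v^-1 = 1 by rewrite -(mulgVK v u) E mul1g.
by apply: (centralizer1 SL) => _ [s [Ms <-]]; apply: conj_eq; apply: H; exists s.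
Qed.

(** A homeomorphism is determined by its conjugation action on [inM], whose centralizer is
    trivial. *)
Lemma realizesP a h : (forall s, inM (iota s) -> iota (a s) = iota s ^ h) -> realizes a h.
Proof.
move=> H t; apply: conj_uniq => s Ss; have Ss' := S_aut a^-1 Ss.
have sE : s = a (a^-1 s) by rewrite /= aut_invK.
rewrite sE -iJ -autJ H //; last by rewrite iJ; apply: (large_conj SL) => //; exact: i_T.
by rewrite H // iJ conjJg.
Qed.

Lemma realizes_uniq a h h' : realizes a h -> realizes a h' -> h = h'.
Proof. by move=> H H'; apply: conj_uniq => s _; rewrite -H. Qed.

Lemma realizes_norm a h : realizes a h -> norm h.
Proof.
move=> ah _ /iT[t <-]; split; first by rewrite -ah; exact: i_T.
have -> : iota t ^ h^-1 = iota (aut_inv a t).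
  by rewrite -[t in LHS](aut_invK a) ah conjgK.
exact: i_T.
Qed.

Lemma norm_realizes h : norm h -> exists a, realizes a h.
Proof.
move=> hN; have /choice[f fE] : forall t, exists t', iota t' = iota t ^ h.
  by move=> t; apply/iT; have [] := hN _ (i_T t).
have /choice[f' f'E] : forall t, exists t', iota t' = iota t ^ h^-1.
  by move=> t; apply/iT; have [] := hN _ (i_T t).
have fM : {morph f : x y / x * y} by move=> x y; apply: iI; rewrite iM !fE iM conjMg.
have fK : cancel f f' by move=> x; apply: iI; rewrite f'E fE conjgK.
have f'K : cancel f' f by move=> x; apply: iI; rewrite fE f'E conjgKV.
by exists (Aut fM fK f'K).
Qed.

Lemma realizes_mul a b g h : realizes a g -> realizes b h -> realizes (a * b) (g * h).
Proof. by move=> ag bh t; rewrite -[(a * b) t]/(b (a t)) bh ag conjgM. Qed.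

Lemma realizes_inv a g : realizes a g -> realizes a^-1 g^-1.
Proof. by move=> ag t; rewrite -[t in RHS](aut_invK a) ag conjgK. Qed.

Lemma realizes_exp a g k : realizes a g -> realizes (a ^+ k) (g ^+ k).
Proof.
move=> ag; elim: k => [|k IH]; first by move=> t; rewrite !expg0 conjg1.
by rewrite !expgS; exact: realizes_mul.
Qed.

Lemma realizes_conj a b g h : realizes a g -> realizes b h -> realizes (a ^ b) (g ^ h).
Proof.
by move=> ag bh; apply: realizes_mul; [exact: realizes_inv|exact: realizes_mul].
Qed.

Lemma exotic_realized (v : seq D) : (0 < n)%N -> @o1 n \notin v -> exists g,
  g =1 tail_map (sub1 (exotic v)) /\ norm g.
Proof.
by move=> n0 vN; have [g [gE g1 g2]] := exotic_ex r n0 vN; exists g; split=> // t Tt; split; auto.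
Qed.

Section Phi.

Variable phi : aut A.

Lemma phi_autS : exists sg tu, autS inM sg tu /\
  forall x, inM (iota x) -> exists x', sg (iota x) = iota x' /\ phi (inner x) = inner x'.
Proof.
have key (psi : aut A) : exists sg, forall x, inM (iota x) -> exists x',
    [/\ sg (iota x) = iota x', inM (iota x') & psi (inner x) = inner x'].
  suff /choice[sg sgE] : forall g, exists g', forall x, iota x = g -> inM g -> exists x',
      [/\ g' = iota x', inM (iota x') & psi (inner x) = inner x'].
    by exists sg => x Sx; exact: (sgE (iota x)).
  move=> g; have [[t [Mt tE]]|Sg] := pselect (inM g); last by exists 1.
  have Mt' := monolith_aut psi Mt; have [t' t'E] := monolith_inner Mt'.
  exists (iota t') => x xE _; exists t'; split=> //; first by exists t'; rewrite -t'E.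
  by rewrite -t'E; congr (psi (inner _)); apply: iI; rewrite xE.
have [sg sgE] := key phi; have [tu tuE] := key phi^-1; exists sg, tu; split; last first.
  by move=> x /sgE[x' [E _ F]]; exists x'.
have SI g : inM g -> exists2 t, inM (iota t) & g = iota t by move=> [t [Mt <-]]; exists t => //; exists t.
split=> [_ /SI[t St ->]|_ /SI[t St ->]|_ _ /SI[s Ss ->] /SI[t St ->]|_ /SI[t St ->]|_ /SI[t St ->]].
- by have [t' [-> ]] := sgE t St.
- by have [t' [-> ]] := tuE t St.
- have [s' [-> _ sE]] := sgE s Ss; have [t' [-> _ tE]] := sgE t St.
  have [x' [+ _ xE]] := sgE (s * t) ltac:(by rewrite iM; apply: (large_mul SL)).
  rewrite -!iM => ->; congr iota; apply: inI.
  by rewrite -xE !innerM aut_morph sE tE.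
- have [t' [-> St' tE]] := sgE t St; have [t2 [-> _ tE']] := tuE t' St'.
  by congr iota; apply: inI; rewrite -tE' -tE /= aut_funK.
- have [t' [-> St' tE]] := tuE t St; have [t2 [-> _ tE']] := sgE t' St'.
  by congr iota; apply: inI; rewrite -tE' -tE /= aut_invK.
Qed.

(** For [x] in the monolith, [phi] maps [inner (x ^ y)] to the conjugate of [phi (inner x)] by
    [phi (inner y)]. On both monolith elements [phi] is the conjugation by [h], which identifies
    [phi (inner y)] on [inM]. *)
Lemma phi_homeo : exists h, good inM h /\ forall y, realizes (phi (inner y)) (iota y ^ h).
Proof.
have [sg [tu [sgA sgE]]] := phi_autS; have [h hE] := autS_homeo SL sgA.
exists h; split=> [s Ss|y]; first by rewrite -hE //; apply: (large_T SL); exact: (autS_in sgA).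
apply: realizesP => s [s0 [Ms /iI s0E]]; rewrite s0E in Ms.
have Mx := monolith_aut phi^-1 Ms; have [x xE] := monolith_inner Mx.
rewrite xE in Mx; have Sx : inM (iota x) by exists x.
have sE : phi (inner x) = inner s by rewrite -xE /= aut_invK.
have Sxy : inM (iota (x ^ y)) by rewrite iJ; apply: (large_conj SL) => //; exact: i_T.
have [s' [s'E s'P]] := sgE x Sx; have [z [zE zP]] := sgE _ Sxy.
have Es : s = s' by apply: inI; rewrite -sE.
have -> : phi (inner y) s = z.
  by apply: inI; rewrite -zP -inner_conj -sE -autJ inner_conj.
by rewrite -zE hE // iJ conjJg -(hE (iota x)) // s'E -Es.
Qed.

Theorem inner_char y : exists z, phi (inner y) = inner z.
Proof.
have [h [hS hP]] := phi_homeo.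
suff /iT[z zE] : inT (iota y ^ h).
  by exists z; apply: aut_ext => t; apply: iI; rewrite hP -zE -iJ.
have [c [M [Tc M0 cM cT]]] := T_mod SL.
have KT k : inT k -> locS inM k -> inT (k ^ h) by exact: locS_conj.
suff Tch : inT (c ^ h).
  have [i [Li _]] := cT _ (i_T y).
  rewrite -(mulgK (c ^+ i) (iota y)) conjMg conjVg conjXg.
  apply: isT_mul; last by apply: isT_inv; exact: isT_exp.
  by apply: KT => //; apply: isT_mul; [exact: i_T|exact: isT_exp].
have [n0|n0] := posnP n; first by apply: KT => //; have [i [_ ]] := cT _ Tc; exact.
have [c0 c0E] := proj1 (iT c) Tc; pose b := phi (inner c0).
have bY : realizes b (c ^ h) by rewrite -c0E; exact: hP.
have bN := realizes_norm bY.
have ch : cycp (c ^ h) by apply: cycp_conj; [exact: (orientation SL)|exact: isT_cycp].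
have /choice[E EP] : forall v : seq D, exists g, @o1 n \notin v ->
    g =1 tail_map (sub1 (exotic v)) /\ norm g.
  move=> v; have [vN|vN] := boolP (@o1 n \notin v); last by exists 1.
  by have [g gP] := exotic_realized n0 vN; exists g.
suff /choice[N NP] : forall v : seq D, exists N, (0 < N)%N /\
    (@o1 n \notin v -> inT [~ c ^ h, E v ^+ N]).
  apply: (rigid_T n0 (G := E) (N := N)) => // v.
  - by move=> /EP[].
  - by move=> /EP[_ gN] t /gN [].
  - by case: (NP v).
  - by case: (NP v).
move=> v; have [vN|vN] := boolP (@o1 n \notin v); last by exists 1%N.
have [_ gN] := EP v vN; move: (E v) gN => g gN.
have [gam gamP] := norm_realizes gN; pose del := aut_inv phi gam.
(* The images of [c0] under powers of [del] have finitely many classes modulo maps locally in [inM].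
   For two with the same class, conjugating their quotient by [h] compares [c ^ h] conjugated by two
   powers of [g], modulo [T]. *)
have /choice[e eP] : forall i, exists j, (j < M)%N /\ locS inM (iota ((del ^+ i) c0) * c ^+ j).
  move=> i; have [j [Lj _]] := cT _ (i_T ((del ^+ i) c0)).
  exists (j %% M)%N; rewrite ltn_mod M0; split=> //.
  by move: Lj; rewrite {1}(divn_eq j M) expgnDr mulnC expgnA cM expg1n mul1g.
have [i [j [ij eij]]] : exists i j, (i < j)%N /\ e i = e j.
  have /(uniqPn 0%N)[i [j [ij]]] : ~~ uniq [seq e i | i <- seq.iota 0 M.+1].
    apply/negP => /uniq_leq_size H.
    have /H : {subset [seq e i | i <- seq.iota 0 M.+1] <= seq.iota 0 M}.
      by move=> _ /mapP[k _ ->]; rewrite mem_iota; case: (eP k).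
    by rewrite size_map !size_iota ltnn.
  rewrite size_map size_iota => jM.
  rewrite !(nth_map 0%N) ?size_iota ?(ltn_trans ij) // !nth_iota ?(ltn_trans ij) //.
  by move=> eij; exists i, j.
pose a k := (del ^+ k) c0.
have aY k : iota (a k) ^ h = (c ^ h) ^ (g ^+ k).
  apply: (@realizes_uniq (phi (inner (a k)))); first exact: hP.
  rewrite /a -inner_conj autJ (_ : phi (del ^+ k) = gam ^+ k).
    exact: realizes_conj bY (realizes_exp k gamP).
  elim: k => [|k IH]; first exact: aut1.
  by rewrite !expgS aut_morph IH /del aut_invK.
have gX k : norm (g ^+ k).
  elim: k => [|k IH] t Tt; first by rewrite expg0 invg1 !conjg1.
  have [t1 t2] := gN _ Tt; rewrite expgS invgM !conjgM; split; first by have [] := IH _ t1.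
  by have [_ /gN[]] := IH _ Tt.
have H : inT (iota (a i) ^ h * (iota (a j) ^ h)^-1).
  have [_ Li] := eP i; have [_ Lj] := eP j.
  rewrite -conjVg -conjMg.
  have -> : iota (a i) * (iota (a j))^-1 = (iota (a i) * c ^+ e i) * (iota (a j) * c ^+ e j)^-1.
    by rewrite eij invgM !mulgA mulgK.
  rewrite conjMg conjVg; apply: isT_mul; [|apply: isT_inv]; apply: KT => //;
    by apply: isT_mul; [exact: i_T|exact: isT_exp].
exists (j - i)%N; split; first by rewrite subn_gt0.
move=> _; have := (gX i _ H).2; rewrite !aY conjMg conjgK conjVg.
have -> : ((c ^ h) ^ (g ^+ j)) ^ (g ^+ i)^-1 = (c ^ h) ^ (g ^+ (j - i)).
  by rewrite -{1}(subnK (ltnW ij)) expgnDr conjgM conjgK.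
move: (g ^+ (j - i)) => k /isT_inv; rewrite invgM invgK => Tk.
have -> : [~ c ^ h, k] = ((c ^ h) ^ k * (c ^ h)^-1) ^ (c ^ h).
  by move: (c ^ h) => Z; rewrite -[RHS]/(Z^-1 * (Z ^ k * Z^-1 * Z)) mulgVK.
by have [] := bN _ Tk.
Qed.

End Phi.

Theorem inner_bijective : group_isomorphism (@inner A).
Proof. exact: inner_bij Z1 inner_char. Qed.

End Final.

Theorem theorem1p3 (n r : nat) (n_ge2 : 2 <= n) (r_ge1 : 1 <= r)
    (r_lt_n : r < n) :
  group_isomorphism (@inner (aut (HigmanThompsonT n_ge2 r_ge1))).
Proof.
case: n r n_ge2 r_ge1 {r_lt_n} => [|[|n]] [|r] // n_ge2 r_ge1.
apply: (@inner_bijective n r _ (fun t : HigmanThompsonT n_ge2 r_ge1 => val t)).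
- by move=> x y; rewrite gmulfM.
- exact: val_inj.
- move=> g; split=> [Tg|[t <-]]; first by exists (exist _ g (asboolT Tg)).
  by apply/asboolP; case: t.
Qed.
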